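(* Let $(M^n,J,g)$ be a balanced Hermitian manifold of complex dimension $n\ge 2$, with Chern torsion $T$, Bismut connection $\nabla^b$ and Chern holomorphic sectional curvature $H^c$. Assume that $$\nabla^b T=0,\qquad H^c\equiv c$$ for a constant $c\neq 0$. Then $T=0$. Consequently, $g$ is Kähler.
   Context: No compactness or completeness of $M$ is assumed. The metric $g$ is extended complex bilinearly to $TM\otimes_{\mathbb R}\mathbb C$, and $\|X\|^2=g(X,\overline X)$ for $X\in T^{1,0}M$. $\nabla^c$ is the Chern connection of $g$, $R^c$ its curvature (with $R^c(X,\overline Y,Z,\overline W)=g(R^c(X,\overline Y)Z,\overline W)$ and $R(X,Y)=\nabla_X\nabla_Y-\nabla_Y\nabla_X-\nabla_{[X,Y]}$), and $T=T^c$ its torsion, regarded as a section of $\Lambda^2(T^{1,0}M)^*\otimes T^{1,0}M$. For nonzero $X\in T^{1,0}M$, the Chern holomorphic sectional curvature is $$H^c(X)=\frac{R^c(X,\overline X,X,\overline X)}{\|X\|^4},$$ and $H^c\equiv c$ means $H^c(X)=c$ for all nonzero $X\in T^{1,0}M$. The Bismut connection $\nabla^b$ is the unique Hermitian connection ($\nabla^b g=0$, $\nabla^b J=0$) whose torsion is totally skew-symmetric. $g$ is balanced if $d\omega^{n-1}=0$, where $\omega$ is the Hermitian form of $g$; equivalently $\sum_i T^i_{ik}=0$ for all $k$ in any local unitary frame $e_1,\dots,e_n$, where $T(e_i,e_k)=\sum_j T^j_{ik}e_j$. *)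

(* Defs.v *)
From mathcomp Require Import all_boot all_order all_algebra all_fingroup.
From mathcomp Require Import all_classical all_reals all_analysis.
From mathcomp Require Import complex.

Set Implicit Arguments.
Unset Strict Implicit.
Unset Printing Implicit Defensive.

Import Order.TTheory GRing.Theory Num.Theory numFieldNormedType.Exports.

Local Open Scope classical_set_scope.
Local Open Scope ring_scope.

(* C^n is modelled by R^2n: the row vector row_mx x y stands for x + i y.
   Tangent vectors at a point of C^n are elements of the same space, written
   in the frame (d/dx^1, .., d/dx^n, d/dy^1, .., d/dy^n). *)
Notation cspace R n := ('rV[R]_(n + n)).

Section Coordinates.
Context {R : realType} {n : nat}.
Local Notation V := (cspace R n).
Local Notation idx := 'I_(n + n).

(* Acts on the right of row vectors; this is multiplication by i on C^n. *)
Definition Jmx : 'M[R]_(n + n) := block_mx 0 1%:M (- 1%:M) 0.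

Definition frame (a : idx) : V := delta_mx 0 a.

(* C^oo on the open set U: every iterated directional derivative exists and is
   Frechet differentiable (in particular continuous) at every point of U. *)
Definition smooth_on {W : normedModType R} (U : set V) (f : V -> W) : Prop :=
  forall (vs : seq V) (x : V), U x ->
    differentiable (foldr (fun (v : V) (h : V -> W) => 'D_v h) f vs) x.

(* The second clause is the Cauchy-Riemann equation dF(J v) = J dF(v). *)
Definition holomorphic_on (U : set V) (F : V -> V) : Prop :=
  smooth_on U F /\
  forall (x v : V), U x -> 'D_(v *m Jmx) F x = 'D_v F x *m Jmx.

(** Differential forms: [al x v] is the value of al at x on v_0, .., v_{k-1}. *)

Definition form (k : nat) := V -> ('I_k -> V) -> R.

Definition wedge (p q : nat) (al : form p) (be : form q) : form (p + q) :=
  fun x v => ((p`! * q`!)%N%:R)^-1 *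
    \sum_(s : 'S_(p + q)) (-1) ^+ s *
      (al x (fun i => v (s (lshift q i))) * be x (fun j => v (s (rshift p j)))).

Fixpoint form_pow (al : form 2) (k : nat) : form (k * 2) :=
  match k with
  | 0 => fun _ _ => 1
  | k'.+1 => wedge al (@form_pow al k')
  end.

(* The v_i are extended to constant vector fields, whose brackets vanish. *)
Definition ext_d (k : nat) (al : form k) : form k.+1 :=
  fun x v => \sum_(i < k.+1)
    (-1) ^+ i * 'D_(v i) (fun y => al y (fun j => v (lift i j))) x.

(** Local expressions of metrics and connections *)

Definition metric_val (g : V -> 'M[R]_(n + n)) (x u v : V) : R :=
  (u *m g x *m v^T) 0 0.

(* omega(u, v) = g(J u, v) *)
Definition hermitian_form (g : V -> 'M[R]_(n + n)) : form 2 :=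
  fun x v => metric_val g x (v ord0 *m Jmx) (v ord_max).

(* Christoffel symbols: G x a b c is the c-th component of nabla_a e_b. *)
Definition symbols := V -> idx -> idx -> idx -> R.

Definition symbols_val (G : symbols) (x u v : V) : V :=
  \row_c \sum_a \sum_b u 0 a * v 0 b * G x a b c.

Definition torsion (G : symbols) : symbols :=
  fun x a b c => G x a b c - G x b a c.

(* The d-th component of R(e_a, e_b) e_c, with
   R(X, Y) = nabla_X nabla_Y - nabla_Y nabla_X - nabla_[X, Y]. *)
Definition curvature (G : symbols) (x : V) (a b c d : idx) : R :=
  'D_(frame a) (fun y => G y b c d) x - 'D_(frame b) (fun y => G y a c d) x
  + \sum_e (G x b c e * G x a e d - G x a c e * G x b e d).

(* The d-th component of (nabla_a T)(e_b, e_c). *)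
Definition cov_deriv (G T : symbols) (x : V) (a b c d : idx) : R :=
  'D_(frame a) (fun y => T y b c d) x
  + \sum_e (G x a e d * T x b c e - G x a b e * T x e c d
            - G x a c e * T x b e d).

(** Complex multilinear extension to the complexified tangent space *)

Local Notation VC := ('rV[R[i]]_(n + n)).

Definition cbar (X : VC) : VC := map_mx conjc X.

Definition T10 (X : VC) : Prop :=
  X *m map_mx (real_complex R) Jmx = 'i%C *: X.

Definition metricC (g : V -> 'M[R]_(n + n)) (x : V) (X Y : VC) : R[i] :=
  (X *m map_mx (real_complex R) (g x) *m Y^T) 0 0.

Definition symbolsC (G : symbols) (x : V) (X Y : VC) : VC :=
  \row_c \sum_a \sum_b X 0 a * Y 0 b * (G x a b c)%:C%C.

Definition curvatureC (G : symbols) (x : V) (X Y Z : VC) : VC :=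
  \row_d \sum_a \sum_b \sum_c
    X 0 a * Y 0 b * Z 0 c * (curvature G x a b c d)%:C%C.

Definition cov_derivC (G T : symbols) (x : V) (A X Y : VC) : VC :=
  \row_d \sum_a \sum_b \sum_c
    A 0 a * X 0 b * Y 0 c * (cov_deriv G T x a b c d)%:C%C.

Definition hol_sect_curv (g : V -> 'M[R]_(n + n)) (G : symbols) (x : V)
    (X : VC) : R[i] :=
  metricC g x (curvatureC G x X (cbar X) X) (cbar X)
    / metricC g x X (cbar X) ^+ 2.

End Coordinates.

Arguments symbols : clear implicits.
Arguments form_pow {R n}.

(* A complex manifold of dimension n, given by a holomorphic atlas; chart_inv
   is only meaningful on the image of the chart. *)
Record complexManifold (R : realType) (n : nat) := ComplexManifold {
  points :> topologicalType;
  points_hausdorff : hausdorff_space points;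
  points_second_countable : @second_countable points;
  chart_index : Type;
  chart_dom : chart_index -> set points;
  chart : chart_index -> points -> cspace R n;
  chart_inv : chart_index -> cspace R n -> points;
  chart_cover : forall p, exists i, chart_dom i p;
  chart_dom_open : forall i, open (chart_dom i);
  chart_im_open : forall i, open (chart i @` chart_dom i);
  chartK : forall i p, chart_dom i p -> chart_inv i (chart i p) = p;
  chart_continuous : forall i, {within chart_dom i, continuous (chart i)};
  chart_inv_continuous : forall i,
    {within chart i @` chart_dom i, continuous (chart_inv i)};
  chart_holomorphic : forall i j,
    holomorphic_on (chart i @` (chart_dom i `&` chart_dom j))
                   (chart j \o chart_inv i)
}.

Section Manifold.
Context {R : realType} {n : nat}.
Implicit Type M : complexManifold R n.

Definition chart_im M (i : chart_index M) : set (cspace R n) :=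
  chart i @` chart_dom i.

Definition overlap M (i j : chart_index M) : set (cspace R n) :=
  chart i @` (chart_dom i `&` chart_dom j).

Definition transition M (i j : chart_index M) : cspace R n -> cspace R n :=
  chart j \o chart_inv i.

(* A J-invariant Riemannian metric, given by its matrices in the charts. *)
Record hermitianMetric M := HermitianMetric {
  gmx : chart_index M -> cspace R n -> 'M[R]_(n + n);
  gmx_smooth : forall i a b, smooth_on (chart_im i) (fun x => gmx i x a b : R);
  gmx_sym : forall i x, chart_im i x -> (gmx i x)^T = gmx i x;
  gmx_pos : forall i x v, chart_im i x -> v != 0 ->
    0 < metric_val (gmx i) x v v;
  gmx_J : forall i x u v, chart_im i x ->
    metric_val (gmx i) x (u *m Jmx) (v *m Jmx) = metric_val (gmx i) x u v;
  gmx_change : forall i j x u v, overlap i j x ->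
    metric_val (gmx i) x u v =
    metric_val (gmx j) (transition i j x)
      ('D_u (transition i j) x) ('D_v (transition i j) x)
}.

(* An affine connection on the real tangent bundle, given by its Christoffel
   symbols in the charts. *)
Record connection M := Connection {
  christoffel : chart_index M -> symbols R n;
  christoffel_smooth : forall i a b c,
    smooth_on (chart_im i) (fun x => christoffel i x a b c : R);
  christoffel_change : forall i j x u v, overlap i j x ->
    'D_(symbols_val (christoffel i) x u v) (transition i j) x =
    'D_u ('D_v (transition i j)) x +
    symbols_val (christoffel j) (transition i j x)
      ('D_u (transition i j) x) ('D_v (transition i j) x)
}.

Definition metric_parallel M (g : hermitianMetric M) (D : connection M) :=
  forall i x a b c, chart_im i x ->
    'D_(frame a) (fun y => gmx g i y b c : R) x =
    \sum_e (christoffel D i x a b e * gmx g i x e c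
            + christoffel D i x a c e * gmx g i x b e).

(* J has constant components in holomorphic charts, so nabla J = 0 reads
   nabla_u (J v) = J (nabla_u v) for constant fields v. *)
Definition J_parallel M (D : connection M) :=
  forall i x u v, chart_im i x ->
    symbols_val (christoffel D i) x u (v *m Jmx) =
    symbols_val (christoffel D i) x u v *m Jmx.

Definition hermitian_connection M (g : hermitianMetric M) (D : connection M) :=
  metric_parallel g D /\ J_parallel D.

(* The Hermitian connection whose (0,1) part is the dbar-operator of the
   holomorphic bundle T^{1,0}M: it annihilates the holomorphic frame
   d/dz^1, .., d/dz^n, that is, every constant section Z of T^{1,0}. *)
Definition is_chern M (g : hermitianMetric M) (D : connection M) :=
  hermitian_connection g D /\
  forall i x X Z, chart_im i x -> T10 X -> T10 Z ->
    symbolsC (christoffel D i) x (cbar X) Z = 0.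

(* g(T(u, v), w) is skew in (u, v) by construction, hence totally skew as soon
   as it is skew in (v, w). *)
Definition is_bismut M (g : hermitianMetric M) (D : connection M) :=
  hermitian_connection g D /\
  forall i x u v w, chart_im i x ->
    let T := torsion (christoffel D i) in
    metric_val (gmx g i) x (symbols_val T x u v) w =
    - metric_val (gmx g i) x (symbols_val T x u w) v.

Definition balanced M (g : hermitianMetric M) :=
  forall i x v, chart_im i x ->
    ext_d (form_pow (hermitian_form (gmx g i)) n.-1) x v = 0.

Definition kahler M (g : hermitianMetric M) :=
  forall i x v, chart_im i x -> ext_d (hermitian_form (gmx g i)) x v = 0.

(* The torsion of Dc, as a section of L^2(T^{1,0})^* (x) T^{1,0}, vanishes. *)
Definition torsion_zero M (Dc : connection M) :=
  forall i x X Y, chart_im i x -> T10 X -> T10 Y ->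
    symbolsC (torsion (christoffel Dc i)) x X Y = 0.

(* The same section is parallel for Db. When Db preserves J, its derivative is
   the restriction to T^{1,0} of the derivative of the real torsion tensor. *)
Definition torsion_parallel M (Db Dc : connection M) :=
  forall i x A X Y, chart_im i x -> T10 X -> T10 Y ->
    cov_derivC (christoffel Db i) (torsion (christoffel Dc i)) x A X Y = 0.

Definition constant_hol_sect_curv M (g : hermitianMetric M)
    (D : connection M) (c : R) :=
  forall i x X, chart_im i x -> T10 X -> X != 0 ->
    hol_sect_curv (gmx g i) (christoffel D i) x X = c%:C%C.

End Manifold.

(* Main.v *)
Require Import Defs.
From mathcomp Require Import all_boot all_order all_algebra.
From mathcomp Require Import all_classical all_reals all_analysis.
From mathcomp Require Import complex ring lra.

(** At a point, let T be the Chern torsion, regarded as a complex bilinear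
    bracket on the (1,0) tangent space, and let s(u, .) be the adjoint of
    T(u, .). The Bismut connection is the Chern connection plus s - T
    ([bismut_minus_chern]); hence it preserves s - T as soon as it preserves T,
    and both curvatures can be expressed through each other, T and s, without
    derivatives. Three consequences are algebraic. The part of the Chern
    Bianchi identity that is complex linear in all arguments contains no
    curvature and is the Jacobi identity of T ([chern_torsion_jacobi]): the
    tangent space is a complex Lie algebra with a Hermitian metric. The Bismut
    curvature acts on it by derivations ([curv_derivation]). Finally, the Bianchi
    identity and the constancy of the holomorphic sectional curvature determine
    the Bismut curvature by polarization ([rm_formula]): it is [c] times the
    curvature of a complex space form plus terms quadratic in the bracket and
    its adjoint.

    It remains to see that such a Lie algebra is abelian when [c] is nonzero
    ([bismut_abelian]). By the formula the curvature has pair symmetry, so that a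
    subspace invariant under all curvature operators does not interact with its
    orthogonal complement ([rm_split]). Contracting the formula over the radical
    of the Killing form and its complement shows that the Killing form vanishes
    ([killing_eq0]). By Cartan's criterion the elements of the derived algebra act
    nilpotently ([derived_nilpotent]), and by Engel's theorem some nonzero vector
    centralizes the derived algebra ([derived_centralizer]). The Ricci operator
    is a self-adjoint derivation that is positive on the orthogonal complement of
    the derived algebra ([ricci_perp_gt0]). Among its eigenvectors that
    centralize the derived algebra, take one of maximal eigenvalue: bracketing it
    with an eigenvector of the complement would give a larger eigenvalue, so it
    commutes with everything. But a nonzero center forces the bracket to be two-step
    nilpotent, where the derivation property contradicts the formula unless the
    bracket is zero ([center_trivial]).

    So T = 0, and the derivative of the Hermitian form omega, which is the cyclic
    sum of omega(T(u, v), w), vanishes as well ([ext_d_hermitian_form0]). *)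

Set Implicit Arguments.
Unset Strict Implicit.
Unset Printing Implicit Defensive.
Import Order.TTheory GRing.Theory Num.Theory numFieldNormedType.Exports.
Local Open Scope ring_scope.

(** * Hermitian linear algebra and polarization *)

Local Open Scope sesquilinear_scope.
Local Notation "''[' u , v ]" := (dotmx u v) : ring_scope.
Local Notation "A ^!" :=
  (orthomx Num.conj (mx_of_hermitian (hermitian1mx _)) A) : matrix_set_scope.

Section Hermitian.
Context {C : numClosedFieldType} {n : nat}.
Implicit Types (x y z : 'rV[C]_n) (A U : 'M[C]_n) (P : 'rV[C]_n -> Prop).

Lemma dotC x y : '[x, y]^* = '[y, x].
Proof. by rewrite (hermC _ y x) expr0 mul1r. Qed.

Lemma dotDl x y z : '[x + y, z] = '[x, z] + '[y, z].
Proof. exact: linearDl. Qed.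
Lemma dotDr x y z : '[z, x + y] = '[z, x] + '[z, y].
Proof. exact: linearDr. Qed.
Lemma dotNl x z : '[- x, z] = - '[x, z].
Proof. exact: linearNl. Qed.
Lemma dotNr x z : '[z, - x] = - '[z, x].
Proof. exact: linearNr. Qed.
Lemma dotZl a x z : '[a *: x, z] = a * '[x, z].
Proof. exact: linearZl_LR. Qed.
Lemma dotZr a x z : '[z, a *: x] = a^* * '[z, x].
Proof. exact: linearZr_LR. Qed.
Lemma dot0l z : '[0, z] = 0 :> C.
Proof. exact: linear0l. Qed.
Lemma dot0r z : '[z, 0] = 0 :> C.
Proof. exact: linear0r. Qed.
Definition dotE := (dotDl, dotDr, dotNl, dotNr, dotZl, dotZr, dot0l, dot0r).

Lemma dot_suml I (r : seq I) (P : pred I) (F : I -> 'rV[C]_n) z :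
  '[\sum_(i <- r | P i) F i, z] = \sum_(i <- r | P i) '[F i, z].
Proof. by apply: (big_morph (fun x => '[x, z])) => [x y|]; rewrite ?dotE. Qed.
Lemma dot_sumr I (r : seq I) (P : pred I) (F : I -> 'rV[C]_n) z :
  '[z, \sum_(i <- r | P i) F i] = \sum_(i <- r | P i) '[z, F i].
Proof. by apply: (big_morph (fun x => '[z, x])) => [x y|]; rewrite ?dotE. Qed.

Lemma dot_ge0 x : 0 <= '[x, x].
Proof. exact: dnorm_ge0. Qed.

Lemma dot_eq0 x : ('[x, x] == 0) = (x == 0).
Proof. exact: dnorm_eq0. Qed.

Lemma dot_ext x y : (forall z, '[x, z] = '[y, z]) -> x = y.
Proof.
move=> xy; apply/eqP; rewrite -subr_eq0 -dot_eq0 !dotE !xy; apply/eqP; ring.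
Qed.

Lemma dot_adj A x y : '[x *m A, y] = '[x, y *m A^t*].
Proof. by rewrite !dotmxE trmx_mul map_mxM trmxCK mulmxA. Qed.

Lemma dot_adjr A x y : '[x, y *m A] = '[x *m A^t*, y].
Proof. by rewrite dot_adj trmxCK. Qed.

(** Every linear predicate is membership in the row space of some matrix: take
    one of maximal rank among those contained in the predicate. *)
Lemma linear_pred_mx P :
  P 0 -> (forall a x y, P x -> P y -> P (a *: x + y)) ->
  exists U, forall x, P x <-> (x <= U)%MS.
Proof.
move=> P0 Plin.
pose Q k := `[< exists2 U : 'M[C]_n, (forall x, (x <= U)%MS -> P x) & \rank U = k >].
have Qex : exists k, Q k.
  exists 0%N; apply/asboolP; exists 0; last exact: mxrank0.
  by move=> x; rewrite submx0 => /eqP ->.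
have Qle k : Q k -> (k <= n)%N.
  by move=> /asboolP [U _ <-]; exact: rank_leq_col.
case: (ex_maxnP Qex Qle) => k /asboolP[U UP rU] kmax.
exists U => x; split; last exact: UP.
move=> Px; apply: contrapT => xU0; have xU : ~~ (x <= U)%MS by apply/negP.
have /kmax : Q (\rank (U + x)%MS).
  apply/asboolP; exists (U + x)%MS => // y /sub_addsmxP[[u v] /= ->].
  rewrite addrC [v]mx11_scalar mul_scalar_mx; apply: Plin => //.
  by apply: UP; rewrite submxMl.
rewrite -rU => le_r; apply: (negP xU); apply: submx_trans (addsmxSr U x) _.
have [le1 <-] := mxrank_leqif_sup (addsmxSl U x).
by rewrite eqn_leq le1 le_r.
Qed.

Definition orthonormal m (f : 'I_m -> 'rV[C]_n) :=
  forall i j, '[f i, f j] = (i == j)%:R.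

(** The bases of [U] and of its orthogonal complement are kept apart, because
    the sums over the two are treated differently. *)
Record adapted_frame U d m (f : 'I_d -> 'rV[C]_n) (h : 'I_m -> 'rV[C]_n) :=
  AdaptedFrame {
    frame_orthoU : orthonormal f;
    frame_orthoV : orthonormal h;
    frame_sub : forall i, (f i <= U)%MS;
    frame_perp : forall x j, (x <= U)%MS -> '[x, h j] = 0;
    frame_expand : forall x,
      x = \sum_i '[x, f i] *: f i + \sum_j '[x, h j] *: h j
  }.

Lemma unitary_adjmx k (M : 'M[C]_(k, n)) :
  k = n -> M \is unitarymx -> M^t* *m M = 1%:M.
Proof. by move=> ekn; subst k; move/unitarymxP/mulmx1C. Qed.

Lemma adapted_frame_exists U :
  exists d m (f : 'I_d -> 'rV[C]_n) (h : 'I_m -> 'rV[C]_n), adapted_frame U f h.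
Proof.
pose F := schmidt (row_base U); pose H := schmidt (row_base U^!%MS).
have FU : (F :=: U)%MS.
  by apply: eqmx_trans (eq_row_base U); exact/eqmx_schmidt_free/row_base_free.
have HU : (H :=: U^!)%MS.
  apply: eqmx_trans (eq_row_base _); exact/eqmx_schmidt_free/row_base_free.
exists (\rank U), (\rank U^!%MS), (fun i => row i F), (fun j => row j H).
have perp x j : (x <= U)%MS -> '[x, row j H] = 0.
  move=> xU; have jH : (row j H <= U^!)%MS by rewrite -HU row_sub.
  apply/eqP; rewrite -dotC conjC_eq0 dotmxE.
  have : (row j H <= x^!)%MS by apply: submx_trans jH _; rewrite submx_ortho.
  by move/orthomx1P => ->; rewrite mxE.
split=> //.
- exact/row_unitarymxP/schmidt_unitarymx/rank_leq_col.
- exact/row_unitarymxP/schmidt_unitarymx/rank_leq_col.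
- by move=> i; rewrite -FU row_sub.
move=> x; pose M := schmidt_complete U.
have Mu := schmidt_complete_unitarymx U.
have MM : M^t* *m M = 1%:M by exact: unitary_adjmx (add_rank_ortho U) Mu.
rewrite -[x in LHS]mulmx1 -MM mulmxA /M /schmidt_complete -/F -/H.
rewrite tr_col_mx map_row_mx mul_mx_row mul_row_col; congr (_ + _);
  rewrite mulmx_sum_row; apply: eq_bigr => i _; congr (_ *: _);
  rewrite dotmxE !mxE; apply: eq_bigr => k _; by rewrite !mxE.
Qed.

Section Frame.
Context {U : 'M[C]_n} {d m : nat} {f : 'I_d -> 'rV[C]_n} {h : 'I_m -> 'rV[C]_n}.
Hypothesis fr : adapted_frame U f h.

Lemma frame_parseval x y : '[x, y] =
  \sum_i '[x, f i] * '[f i, y] + \sum_j '[x, h j] * '[h j, y].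
Proof.
rewrite {1}(frame_expand fr x) dotDl !dot_suml; congr (_ + _);
  by apply: eq_bigr => i _; rewrite dotZl.
Qed.

Lemma frame_perpP x : (forall j, '[x, h j] = 0) -> (x <= U)%MS.
Proof.
move=> xh; rewrite (frame_expand fr x) [X in _ + X]big1 ?addr0; last first.
  by move=> j _; rewrite xh scale0r.
by apply: summx_sub => i _; apply/scalemx_sub/(frame_sub fr).
Qed.

Lemma frame_perp' x j : (x <= U)%MS -> '[h j, x] = 0.
Proof. by move=> xU; rewrite -dotC (frame_perp fr) ?conjC0. Qed.

End Frame.

End Hermitian.

(** Inserting l x + y for a scalar l and averaging over the fourth roots of unity
    isolates the parts of given bidegree. *)
Lemma polarization (C : numClosedFieldType) (V : lmodType C)
    (G : V -> V -> V -> V -> C) :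
  (forall a x x' y p q, G (a *: x + x') y p q = a * G x y p q + G x' y p q) ->
  (forall a x y y' p q, G x (a *: y + y') p q = a^* * G x y p q + G x y' p q) ->
  (forall x y p q, G p y x q = G x y p q) ->
  (forall x y p q, G x q p y = G x y p q) ->
  (forall x, G x x x x = 0) -> forall x y p q, G x y p q = 0.
Proof.
move=> G1 G2 G31 G42 Gx.
have G3 a x y p p' q : G x y (a *: p + p') q = a * G x y p q + G x y p' q.
  by rewrite G31 G1 !(G31 x).
have G4 a x y p q q' : G x y p (a *: q + q') = a^* * G x y p q + G x y p q'.
  by rewrite G42 G2 !(G42 x y).
have expand l l' x y : l^* = l' ->
      l ^+ 2 * G y x y x + l' ^+ 2 * G x y x y
    + 2 * l ^+ 2 * l' * G y y y x + 2 * l * l' ^+ 2 * G y y x y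
    + 4 * l * l' * G y y x x + 2 * l * G y x x x + 2 * l' * G x y x x = 0.
  move=> <-; have := Gx (l *: y + x); rewrite !G1 !G2 !G3 !G4 !Gx.
  by rewrite !(fun b d => G31 y b x d) !(fun b d => G42 b y d x) => <-; ring.
have i2 : 'i * 'i = -1 :> C by rewrite -expr2 sqrCi.
(* The sum over the fourth roots of unity, with signs, keeps the monomials of
   bidegree (2,0) and (0,2) in the scalar. *)
have diag0 x y : G y x y x + G x y x y = 0.
  have e1 := expand 1 1 x y (conjC1 C).
  have e2 := expand (-1) (-1) x y (conjCN1 C).
  have e3 := expand 'i (- 'i) x y (conjCi C).
  have e4 := expand (- 'i) 'i x y (etrans (rmorphN _ _) (etrans (congr1 _ (conjCi C)) (opprK _))).
  apply: (mulfI (_ : 4 != 0 :> C)); first by rewrite pnatr_eq0.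
  rewrite mulr0.
  have := congr2 +%R (congr2 +%R e1 e2) (congr1 -%R (congr2 +%R e3 e4)).
  rewrite !(addr0, oppr0) => <-; ring: i2.
have diag x y : G x y x y = 0.
  have e1 := diag0 x y; have := diag0 x ((1 + 'i) *: y + 0).
  have G10 u v w : G 0 u v w = 0.
    by have := G1 (-1) 0 0 u v w; rewrite scaler0 addr0 mulN1r addNr.
  have G20 u v w : G u 0 v w = 0.
    by rewrite -[0](scaler0 _ 0) -[_ *: 0]addr0 G2 rmorph0 mul0r add0r; have := G2 (-1) u 0 0 v w; rewrite scaler0 addr0 rmorphN rmorph1 mulN1r addNr.
  rewrite !G1 !G2 !G3 !G4.
  have G30 u v w : G u v 0 w = 0 by rewrite G31 G10.
  have G40 u v w : G u v w 0 = 0 by rewrite G42 G20.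
  rewrite !(G10, G20, G30, G40) rmorphD rmorph1 /= conjCi.
  move=> e2; apply: (mulfI (_ : 4 * 'i != 0 :> C)).
    by rewrite mulf_neq0 ?pnatr_eq0 ?neq0Ci.
  rewrite mulr0.
  have := congr2 +%R (congr1 ( *%R (2 * 'i)) e1) (congr1 -%R e2).
  rewrite !(mulr0, oppr0, addr0) => <-; ring: i2.
have diag3 x y p : G x y p y = 0.
  have := diag (1 *: x + p) y; rewrite !G1 !G3 !diag (G31 x).
  move=> e; apply: (mulfI (_ : 2 != 0 :> C)).
    by rewrite pnatr_eq0.
  by rewrite mulr0 -[RHS]e; ring.
move=> x y p q; have := diag3 x (1 *: y + q) p; rewrite !G2 !G4 !diag3 (G42 x q p y).
rewrite rmorph1 => e; apply: (mulfI (_ : 2 != 0 :> C)).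
  by rewrite pnatr_eq0.
by rewrite mulr0 -[RHS]e; ring.
Qed.

(** * The torsion bracket and the curvature formula *)

(** The (1,0) tangent space at a point whose Chern torsion is parallel for the
    Bismut connection. Operators act on the right of row vectors: [y *m ad x] is
    the torsion of [x] and [y], and [z *m Rm x y] the Bismut curvature, linear in
    [x] and conjugate linear in [y]. The right-hand side of [Rm_bianchi] comes
    from the cyclic sum of the iterated Bismut torsion, which is made of [ad] and
    its adjoint. In [Rm_hsc] the quadratic term is the difference of the Chern and the
    Bismut holomorphic sectional curvature. *)
Record bismutPoint (C : numClosedFieldType) (n : nat) (c : C) := BismutPoint {
  ad : 'rV[C]_n -> 'M[C]_n;
  Rm : 'rV[C]_n -> 'rV[C]_n -> 'M[C]_n;
  ad_linear : forall a x y, ad (a *: x + y) = a *: ad x + ad y;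
  ad_skew : forall x y, y *m ad x = - (x *m ad y);
  ad_bracket : forall x y, ad (y *m ad x) = ad y *m ad x - ad x *m ad y;
  Rm_linear : forall a x y z, Rm (a *: x + y) z = a *: Rm x z + Rm y z;
  Rm_adj : forall x y, (Rm x y)^t* = Rm y x;
  Rm_derivation : forall x y p,
    ad (p *m Rm x y) = ad p *m Rm x y - Rm x y *m ad p;
  Rm_bianchi : forall x y p q,
    '[x *m Rm p y, q] - '[p *m Rm x y, q] =
    2 * ('[p *m ad x, q *m ad y]
         - '[p *m (ad y)^t*, q *m (ad x)^t*]
         - '[x *m (ad q)^t*, y *m (ad p)^t*]
         + '[x *m (ad y)^t*, q *m (ad p)^t*]
         + '[p *m (ad q)^t*, y *m (ad x)^t*]);
  Rm_hsc : forall x,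
    '[x *m Rm x x, x] + 2 * '[x *m (ad x)^t*, x *m (ad x)^t*]
    = c * '[x, x] ^+ 2;
  hsc_real : c^* = c
}.

Section BismutPoint.
Context {C : numClosedFieldType} {n : nat} {c : C} (B : bismutPoint n c).
Implicit Types x y z p q k l u v w : 'rV[C]_n.

Definition bracket x y := y *m ad B x.
Definition adj_bracket x y := y *m (ad B x)^t*.
Definition curv x y p := p *m Rm B x y.
Local Notation br := bracket.
Local Notation sp := adj_bracket.
Local Notation rm := curv.

Lemma brDr x y z : br x (y + z) = br x y + br x z.
Proof. exact: mulmxDl. Qed.
Lemma brZr a x y : br x (a *: y) = a *: br x y.
Proof. by rewrite /bracket -scalemxAl. Qed.
Lemma brC x y : br x y = - br y x.
Proof. exact: ad_skew. Qed.
Lemma brDl x y z : br (x + y) z = br x z + br y z.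
Proof. by rewrite -[x]scale1r /bracket ad_linear mulmxDr !scale1r. Qed.
Lemma ad0 : ad B 0 = 0.
Proof. by have := ad_linear B (-1) 0 0; rewrite scaler0 addr0 scaleN1r addNr. Qed.
Lemma adZ a x : ad B (a *: x) = a *: ad B x.
Proof. by rewrite -[a *: x]addr0 ad_linear ad0 addr0. Qed.
Lemma brZl a x y : br (a *: x) y = a *: br x y.
Proof. by rewrite /bracket adZ -scalemxAr. Qed.
Lemma br0l x : br 0 x = 0. Proof. by rewrite /bracket ad0 mulmx0. Qed.
Lemma br0r x : br x 0 = 0. Proof. exact: mul0mx. Qed.
Lemma brNl x y : br (- x) y = - br x y.
Proof. by rewrite -scaleN1r brZl scaleN1r. Qed.
Lemma brNr x y : br x (- y) = - br x y.
Proof. exact: mulNmx. Qed.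
Lemma br_jacobi x y z : br (br x y) z = br x (br y z) - br y (br x z).
Proof. by rewrite /bracket ad_bracket mulmxBr !mulmxA. Qed.

Lemma brxx x : br x x = 0.
Proof.
have /eqP := brC x x; rewrite -addr_eq0 -mulr2n -scaler_nat scaler_eq0.
by rewrite pnatr_eq0 => /eqP.
Qed.

Definition brE := (brDl, brDr, brNl, brNr, brZl, brZr, br0l, br0r).

Lemma br_suml I (r : seq I) (P : pred I) (F : I -> 'rV[C]_n) z :
  br (\sum_(i <- r | P i) F i) z = \sum_(i <- r | P i) br (F i) z.
Proof. by apply: (big_morph (br^~ z)) => [x y|]; rewrite ?brE. Qed.
Lemma br_sumr I (r : seq I) (P : pred I) (F : I -> 'rV[C]_n) z :
  br z (\sum_(i <- r | P i) F i) = \sum_(i <- r | P i) br z (F i).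
Proof. by apply: (big_morph (br z)) => [x y|]; rewrite ?brE. Qed.

Lemma dot_sp x y z : '[sp x y, z] = '[y, br x z].
Proof. by rewrite /adj_bracket /bracket dot_adjr. Qed.
Lemma dot_spr x y z : '[z, sp x y] = '[br x z, y].
Proof. by rewrite -dotC dot_sp dotC. Qed.

Lemma spDr x y z : sp x (y + z) = sp x y + sp x z.
Proof. exact: mulmxDl. Qed.
Lemma spZr a x y : sp x (a *: y) = a *: sp x y.
Proof. by rewrite /adj_bracket -scalemxAl. Qed.
Lemma spDl x y z : sp (x + y) z = sp x z + sp y z.
Proof. by apply: dot_ext => w; rewrite dotE !dot_sp brE dotE. Qed.
Lemma spZl a x y : sp (a *: x) y = a^* *: sp x y.
Proof. by apply: dot_ext => w; rewrite dotE !dot_sp brE dotE. Qed.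
Lemma sp0r x : sp x 0 = 0. Proof. exact: mul0mx. Qed.
Definition spE := (spDl, spDr, spZl, spZr, sp0r).

Lemma dot_rm x y p q : '[rm x y p, q] = '[p, rm y x q].
Proof. by rewrite /curv dot_adj Rm_adj. Qed.
Lemma rm_linl a x y z p : rm (a *: x + y) z p = a *: rm x z p + rm y z p.
Proof. by rewrite /curv Rm_linear mulmxDr -scalemxAr. Qed.
Lemma rm_linr a x y z p : rm z (a *: x + y) p = a^* *: rm z x p + rm z y p.
Proof.
by apply: dot_ext => w; rewrite dot_rm rm_linl !dotE -!dot_rm.
Qed.
Lemma rm_br x y p q : rm x y (br p q) = br (rm x y p) q + br p (rm x y q).
Proof. by rewrite /bracket /curv Rm_derivation mulmxBr !mulmxA subrK. Qed.

(** The polarized curvature formula: the Bianchi identity makes the difference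
    of the two sides symmetric in [x, p] and in [y, q], and constancy of the
    holomorphic sectional curvature makes it vanish on the diagonal. *)
Lemma rm_formula x y p q : '[rm x y p, q] =
  c / 2 * ('[x, y] * '[p, q] + '[p, y] * '[x, q]) - '[br x p, br y q]
  + ('[sp y p, sp x q] + '[sp q x, sp p y]) / 2
  - 3 / 2 * ('[sp y x, sp p q] + '[sp q p, sp x y]).
Proof.
pose F x y p q := '[rm x y p, q] - (
  c / 2 * ('[x, y] * '[p, q] + '[p, y] * '[x, q]) - '[br x p, br y q]
  + ('[sp y p, sp x q] + '[sp q x, sp p y]) / 2
  - 3 / 2 * ('[sp y x, sp p q] + '[sp q p, sp x y])).
apply/eqP; rewrite -subr_eq0; apply/eqP; rewrite -/(F x y p q).
have FC x1 y1 p1 q1 : F y1 x1 q1 p1 = (F x1 y1 p1 q1)^*.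
  rewrite /F !(rmorphB, rmorphD, rmorphM) /= !fmorphV ?rmorph_nat (hsc_real B).
  rewrite !dotC dot_rm.
  by field.
have F13 x1 y1 p1 q1 : F p1 y1 x1 q1 = F x1 y1 p1 q1.
  have := Rm_bianchi B x1 y1 p1 q1; rewrite -!/(rm _ _ _).
  rewrite -!/(sp _ _) -!/(br _ _) => /eqP; rewrite subr_eq => /eqP e.
  by rewrite /F e (brC p1 x1) dotNl; field.
apply: (@polarization _ _ F) => //.
- by move=> a x1 x2 y1 p1 q1; rewrite /F rm_linl !brE !spE !dotE ?conjCK; field.
- by move=> a x1 y1 y2 p1 q1; rewrite /F rm_linr !brE !spE !dotE ?conjCK; field.
- by move=> x1 y1 p1 q1; rewrite [LHS]FC F13 -FC.
move=> x1; rewrite /F; have := Rm_hsc B x1.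
rewrite brxx -/(rm _ _ _) -!/(sp _ _) dot0l => /eqP e.
by rewrite -subr_eq0 in e; rewrite -[RHS](eqP e); field.
Qed.

Lemma rm_pair_sym x y p q : '[rm x y p, q] = '[rm p q x, y].
Proof.
by rewrite !rm_formula (brC p x) (brC q y) !dotE; field.
Qed.

(** A parallel subspace and its complement do not interact: the pair symmetry
    turns invariance of [P] under the curvature operators into their vanishing. *)
Lemma rm_split (P : 'rV[C]_n -> Prop) k l p :
  (forall x y z, P z -> P (rm x y z)) -> P k ->
  (forall z, P z -> '[z, l] = 0) -> rm k l p = 0.
Proof.
move=> PR Pk lP; apply: dot_ext => q.
by rewrite dot0l rm_pair_sym lP //; exact: PR.
Qed.

Lemma sp_center k y : (forall x, br k x = 0) -> sp k y = 0.
Proof. by move=> kz; apply: dot_ext => w; rewrite dot_sp kz !dotE. Qed.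

(** A nonzero center forces the algebra to be two-step nilpotent of Heisenberg
    type; the derivation property of [Rm p p] on a bracket [br p p'] then
    compares the incompatible multiples 2/3 and 7/6 of [c]. *)
Lemma center_trivial k : c != 0 -> k != 0 -> (forall x, br k x = 0) ->
  forall x y, br x y = 0.
Proof.
move=> c0 k0 kz.
pose Z x := forall y, br x y = 0.
have [||W WP] := @linear_pred_mx C n Z.
- by move=> y; rewrite br0l.
- by move=> a x y xz yz w; rewrite !brE xz yz scaler0 addr0.
have [d [m [f [h fr]]]] := adapted_frame_exists W.
have ZR x y z : Z z -> Z (rm x y z).
  by move=> zz w; have := rm_br x y z w; rewrite !zz /curv mul0mx addr0.
pose perp l := forall z, Z z -> '[z, l] = 0.
have perpC l z : perp l -> Z z -> '[l, z] = 0.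
  by move=> lp zz; rewrite -dotC lp ?conjC0.
have perp_sp x y : perp (sp x y).
  by move=> z zz; rewrite dot_spr brC zz oppr0 dot0l.
have hperp j : perp (h j) by move=> z /WP zW; exact: (frame_perp fr).
have key z l p q : Z z -> perp l ->
    c * '[p, l] * '[z, q] + '[sp q z, sp p l] = 3 * '[sp l z, sp p q].
  move=> zz lp; have := congr1 (fun x => '[x, q]) (rm_split p ZR zz lp).
  rewrite /= dot0l rm_formula lp // zz !(sp_center _ zz) !dotE => e.
  apply/eqP; rewrite -subr_eq0 -[X in _ == X](mulr0 2) -[X in 2 * X]e.
  by apply/eqP; field.
have key2 z z' l p : Z z -> Z z' -> perp l ->
    '[sp l z, sp p z'] = c / 3 * '[p, l] * '[z, z'].
  move=> zz zz' lp; have := key z l p z' zz lp.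
  rewrite (sp_center _ zz') dot0l addr0 => e.
  apply: (mulfI (_ : 3 != 0 :> C)); first by rewrite pnatr_eq0.
  by rewrite -e; field.
have sp_perp q p : perp q -> sp p q = 0.
  move=> qp; have vp : perp (sp p q) by [].
  have orth l : perp l -> '[sp l k, sp p q] = 0.
    move=> lp; have e1 := key k l p q kz lp; have e2 := key k q p l kz qp.
    rewrite (qp _ kz) mulr0 add0r in e1; rewrite (lp _ kz) mulr0 add0r in e2.
    apply: (mulfI (_ : 8 != 0 :> C)); first by rewrite pnatr_eq0.
    have e : '[sp l k, sp p q] = 9 * '[sp l k, sp p q] by rewrite {1}e2 e1; ring.
    by rewrite mulr0 -[RHS](subrr ('[sp l k, sp p q])) [X in _ = X - _]e; ring.
  set v := sp p q in vp orth *.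
  have vk : sp v k = 0.
    apply/eqP; rewrite -dot_eq0 dot_sp brC dotNr -dot_sp orth ?oppr0 //.
  apply/eqP; have := key2 k k v v kz kz vp; rewrite vk dot0l => /esym/eqP.
  by rewrite !mulf_eq0 invr_eq0 pnatr_eq0 (negPf c0) !dot_eq0 (negPf k0) orbF.
have bracket_center x y : Z (br x y).
  apply/WP/(frame_perpP fr) => j.
  by rewrite -dot_spr sp_perp ?dot0r.
have hh i j : br (h i) (h j) = 0.
  set p := h i; set p' := h j; set K := br p p'.
  have [pp pp'] : perp p /\ perp p' by split; exact: hperp.
  have KZ : Z K by exact: bracket_center.
  have wK : '[K, br p (sp p K)] = c / 3 * '[p, p] * '[K, K].
    rewrite -dotC -dot_spr (key2 K K p p KZ KZ pp).
    by rewrite !rmorphM fmorphV rmorph_nat /= (hsc_real B) !dotC.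
  have e1 : '[rm p p K, K] = 2 / 3 * c * '[p, p] * '[K, K].
    rewrite rm_formula (brC p K) KZ !(sp_center _ KZ) (key2 K K p p KZ KZ pp).
    by rewrite (pp _ KZ) !dotE; field.
  have e2 : '[br (rm p p p) p', K] = c * '[p, p] * '[K, K].
    rewrite brC dotNl -dot_spr rm_formula brxx (sp_perp p p) // !dotE.
    by rewrite dot_spr (brC p' p) -/K dotNl; field.
  have e3 : '[br p (rm p p p'), K] = c / 6 * '[p, p] * '[K, K].
    rewrite -dot_spr rm_formula (sp_perp p p) // (sp_perp p' p) // (sp_perp p _) //.
    rewrite -/K wK !dotE !dot_spr brxx -/K !dotE.
    by field.
  have := congr1 (fun x => '[x, K]) (rm_br p p p p').
  rewrite /= -/K dotDl e1 e2 e3 => e.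
  have : c * '[p, p] * '[K, K] = 0.
    apply: (mulfI (_ : 1 / 2 != 0 :> C)).
      by rewrite mulf_neq0 ?invr_eq0 ?pnatr_eq0 ?oner_eq0.
    rewrite mulr0 -[RHS](subrr (2 / 3 * c * '[p, p] * '[K, K])) [X in _ = X - _]e.
    by field.
  move/eqP; rewrite !mulf_eq0 (negPf c0) (frame_orthoV fr) eqxx oner_eq0 /=.
  by rewrite dot_eq0 => /eqP.
have expand x y : br x y = \sum_j '[x, h j] *: br (h j) y.
  rewrite {1}(frame_expand fr x) brDl !br_suml big1 ?add0r.
    by apply: eq_bigr => j _; rewrite brZl.
  by move=> i _; rewrite brZl ((WP _).2 (frame_sub fr i)) scaler0.
move=> x y; rewrite expand big1 // => i _; rewrite brC expand big1 ?oppr0 ?scaler0 //.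
by move=> j _; rewrite hh scaler0.
Qed.

End BismutPoint.

(** * The Killing form *)

Section Killing.
Context {C : numClosedFieldType} {n : nat} {c : C} (B : bismutPoint n c).
Implicit Types x y z p q u v w : 'rV[C]_n.
Local Notation br := (bracket B).
Local Notation sp := (adj_bracket B).
Local Notation rm := (curv B).

Definition derivation (D : 'M[C]_n) :=
  forall p, ad B (p *m D) = ad B p *m D - D *m ad B p.

Lemma derivationP D : derivation D <->
  forall x y, br x y *m D = br (x *m D) y + br x (y *m D).
Proof.
split=> [dD x y|dD p].
  by rewrite /bracket dD mulmxBr !mulmxA subrK.
apply/row_matrixP => i; rewrite !rowE mulmxBr; have := dD p (delta_mx 0 i).
by rewrite /bracket !mulmxA => ->; rewrite addrK.
Qed.

Lemma derivation_Rm x y : derivation (Rm B x y).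
Proof. exact: Rm_derivation. Qed.
Lemma derivation_ad x : derivation (ad B x).
Proof. by move=> p; exact: ad_bracket. Qed.

Definition killing x y := \tr (ad B x *m ad B y).

Lemma killing_lin a x y z : killing (a *: x + y) z = a * killing x z + killing y z.
Proof. by rewrite /killing ad_linear mulmxDl -scalemxAl mxtraceD mxtraceZ. Qed.
Lemma killingC x y : killing x y = killing y x.
Proof. exact: mxtrace_mulC. Qed.

Lemma killing_derivation D x y : derivation D ->
  killing (x *m D) y = - killing x (y *m D).
Proof.
move=> dD; rewrite /killing !dD mulmxBl mulmxBr !(raddfB mxtrace) /= opprB.
by rewrite -!mulmxA (mxtrace_mulC D) -!mulmxA.
Qed.

Lemma killing0 y : killing 0 y = 0.
Proof. by rewrite /killing ad0 mul0mx mxtrace0. Qed.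
Lemma killingDl x y z : killing (x + y) z = killing x z + killing y z.
Proof. by rewrite -[x]scale1r killing_lin mul1r scale1r. Qed.
Lemma killing_suml I (r : seq I) (P : pred I) (F : I -> 'rV[C]_n) z :
  killing (\sum_(i <- r | P i) F i) z = \sum_(i <- r | P i) killing (F i) z.
Proof.
by apply: (big_morph (killing^~ z)) => [x y|]; [exact: killingDl|exact: killing0].
Qed.
Lemma killingZ a x z : killing (a *: x) z = a * killing x z.
Proof. by rewrite -[a *: x]addr0 killing_lin killing0 addr0. Qed.

Section Radical.
Context {U : 'M[C]_n} {d m : nat} {f : 'I_d -> 'rV[C]_n} {h : 'I_m -> 'rV[C]_n}.
Hypothesis fr : adapted_frame U f h.
Hypothesis UP : forall x, (forall y, killing x y = 0) <-> (x <= U)%MS.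

(** A derivation is skew for the Killing form, hence traceless on the quotient
    by the radical, where that form is nondegenerate. *)
Lemma killing_trace D : derivation D -> \sum_j '[h j *m D, h j] = 0.
Proof.
move=> dD.
pose A := \matrix_(i, j) '[h i *m D, h j].
pose N := \matrix_(i, j) killing (h i) (h j).
have fK i y : killing (f i) y = 0 by apply: (UP _).2; exact: frame_sub fr i.
have AN i k : (A *m N) i k = killing (h i *m D) (h k).
  rewrite (frame_expand fr (h i *m D)) killingDl !killing_suml.
  rewrite [X in X + _]big1 ?add0r => [|j _]; last by rewrite killingZ fK mulr0.
  rewrite !mxE; apply: eq_bigr => j _.
  by rewrite killingZ !mxE.
have NT : N^T = N by apply/matrixP => i j; rewrite !mxE killingC.
have skew : A *m N = - (N *m A^T).
  apply/matrixP => i k; rewrite AN killing_derivation // killingC -AN.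
  by rewrite [RHS]mxE -{2}NT -trmx_mul [in RHS]mxE.
have Nu : N \in unitmx.
  rewrite -row_free_unit -kermx_eq0; apply/rowV0P => v /sub_kermxP vN.
  pose x := \sum_j v 0 j *: h j.
  have xh j : '[x, h j] = v 0 j.
    rewrite dot_suml (bigD1 j) //= dotZl (frame_orthoV fr) eqxx mulr1.
    by rewrite big1 ?addr0 // => i /negPf ij; rewrite dotZl (frame_orthoV fr) ij mulr0.
  apply/rowP => j; rewrite -xh mxE (frame_perp fr) //; apply/UP => y.
  rewrite killingC (frame_expand fr y) killingDl !killing_suml big1 ?add0r => [|i _]; last first.
    by rewrite killingZ fK mulr0.
  rewrite big1 // => k _; rewrite killingZ killingC killing_suml.
  have /rowP/(_ k) := vN; rewrite mxE [RHS]mxE => e.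
  rewrite (_ : \sum_j _ = 0) ?mulr0 // -[RHS]e.
  by apply: eq_bigr => i _; rewrite killingZ !mxE.
have trA : \tr A = - \tr A.
  rewrite -{1}[A](mulmxK Nu) skew mulNmx raddfN /= mxtrace_mulC mulKmx //.
  by rewrite mxtrace_tr.
transitivity (\tr A); first by apply: eq_bigr => j _; rewrite mxE.
move/eqP: trA; rewrite -addr_eq0 -mulr2n -mulr_natl mulf_eq0 pnatr_eq0 /=.
by move/eqP.
Qed.

End Radical.

(** The curvature operators preserve the radical of the Killing form and are
    traceless on its orthogonal complement. Contracting [rm_formula] over the
    complement, once with the radical and once with the complement itself, leaves
    [c] times (m ^ 2 + m) / 2, where [m] is the dimension of the complement. *)
Lemma killing_eq0 : c != 0 -> forall x y, killing x y = 0.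
Proof.
move=> c0.
have [||U UP] := @linear_pred_mx C n (fun x => forall y, killing x y = 0).
- exact: killing0.
- by move=> a x y xK yK z; rewrite killing_lin xK yK mulr0 addr0.
have [d [m [f [h fr]]]] := adapted_frame_exists U.
pose inU x := forall y, killing x y = 0.
have inU_der D x : derivation D -> inU x -> inU (x *m D).
  by move=> dD xU y; rewrite killing_derivation // xU oppr0.
have fU i : inU (f i) by apply/UP; exact: frame_sub fr i.
have perp x j : inU x -> '[x, h j] = 0 by move/UP => xU; exact: (frame_perp fr).
have perpC x j : inU x -> '[h j, x] = 0 by move/UP => xU; exact: (frame_perp' fr).
have trh D := killing_trace fr UP (D := D).
have spf x j : inU x -> sp x (h j) = 0.
  move=> xU; apply: dot_ext => w; rewrite dot_sp dot0l perpC // brC.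
  have -> : - br w x = (- x) *m ad B w by rewrite mulNmx.
  by apply: inU_der; [exact: derivation_ad|move=> y; rewrite -scaleN1r killingZ xU mulr0].
have sph : \sum_j sp (h j) (h j) = 0.
  apply: dot_ext => w; rewrite dot0l dot_suml.
  transitivity (- (\sum_j '[h j *m ad B w, h j])^*).
    rewrite rmorph_sum -sumrN; apply: eq_bigr => j _.
    by rewrite /= dot_sp brC dotNr dotC.
  by rewrite (trh _ (derivation_ad w)) conjC0 oppr0.
have nu0 (I : finType) (g : I -> 'rV[C]_n) :
    \sum_j \sum_i ('[sp (h j) (h j), sp (g i) (g i)] +
                    '[sp (g i) (g i), sp (h j) (h j)]) = 0.
  rewrite exchange_big big1 // => i _; rewrite big_split /= -dot_suml -dot_sumr.
  by rewrite sph !dotE addr0.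
have trR x : \sum_j '[rm (h j) (h j) x, x] = 0.
  rewrite -[RHS](trh _ (derivation_Rm x x)); apply: eq_bigr => j _.
  exact: rm_pair_sym.
pose phi j j' i := '[br (h j) (h j'), f i] * '[f i, br (h j) (h j')].
(* The complement contracted with the radical. *)
have sum_phi : \sum_j \sum_j' \sum_i phi j j' i = 0.
  have term j i : '[rm (h j) (h j) (f i), f i] =
      2 * ('[sp (h j) (f i), sp (h j) (f i)]
           - '[br (h j) (f i), br (h j) (f i)])
      - 2 * ('[sp (h j) (h j), sp (f i) (f i)] +
             '[sp (f i) (f i), sp (h j) (h j)]).
    have : '[rm (h j) (f i) (f i), h j] = 0.
      rewrite dot_rm (rm_split (P := inU)) ?dot0r //.
      - by move=> x y z; exact: inU_der (derivation_Rm x y).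
      - by move=> z; exact: perp.
    rewrite !rm_formula (brC B (f i) (h j)) (spf (f i) j) // perp // perpC //.
    rewrite !dotE => e; rewrite -[LHS]subr0 -[X in _ - X = _]e; by field.
  have : \sum_j \sum_i '[rm (h j) (h j) (f i), f i] = 0.
    by rewrite exchange_big big1.
  under eq_bigr do under eq_bigr do rewrite term.
  under eq_bigr do rewrite sumrB -!mulr_sumr.
  rewrite sumrB -!mulr_sumr nu0 mulr0 subr0 => /eqP.
  rewrite mulf_eq0 pnatr_eq0 => /eqP e; rewrite -[RHS]e; apply: eq_bigr => j _.
  rewrite sumrB.
  have spsp i : '[sp (h j) (f i), sp (h j) (f i)] =
      \sum_i' '[br (h j) (f i'), f i] * '[f i, br (h j) (f i')]
      + \sum_j' phi j j' i.
    rewrite (frame_parseval fr); congr (_ + _); apply: eq_bigr => k _;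
      by rewrite dot_sp dot_spr mulrC.
  under [X in _ = X - _]eq_bigr do rewrite spsp.
  rewrite big_split /= [X in _ = _ + X - _]exchange_big /= addrAC.
  rewrite (_ : _ - _ = 0) ?add0r //; apply/eqP; rewrite subr_eq0; apply/eqP.
  rewrite exchange_big; apply: eq_bigr => i _.
  rewrite [RHS](frame_parseval fr) [X in _ + X]big1 ?addr0 // => k _.
  by rewrite perp ?mul0r //; apply: inU_der => //; exact: derivation_ad.
have br_sp : \sum_j \sum_k '[br (h j) (h k), br (h j) (h k)] =
    \sum_j \sum_k '[sp (h j) (h k), sp (h j) (h k)].
  transitivity (\sum_j \sum_k \sum_i phi j k i + \sum_j \sum_k \sum_l
      '[br (h j) (h k), h l] * '[h l, br (h j) (h k)]).
    rewrite -big_split; apply: eq_bigr => j _; rewrite -big_split.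
    by apply: eq_bigr => k _; exact: frame_parseval fr _ _.
  rewrite sum_phi add0r; apply: eq_bigr => j _; rewrite exchange_big.
  apply: eq_bigr => k _; rewrite [RHS](frame_parseval fr) [X in X + _]big1 ?add0r.
    by apply: eq_bigr => l _; rewrite dot_sp dot_spr mulrC.
  move=> i _; rewrite dot_spr perp ?mulr0 //.
  by apply: inU_der => //; exact: derivation_ad.
(* The complement contracted with itself: all quadratic terms cancel. *)
have : c / 2 * (m ^ 2 + m)%:R = 0.
  have term j j' : '[rm (h j) (h j) (h j'), h j'] =
      c / 2 * (1 + (j == j')%:R) - '[br (h j) (h j'), br (h j) (h j')]
      + ('[sp (h j) (h j'), sp (h j) (h j')]
         + '[sp (h j') (h j), sp (h j') (h j)]) / 2
      - 3 / 2 * ('[sp (h j) (h j), sp (h j') (h j')] +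
             '[sp (h j') (h j'), sp (h j) (h j)]).
    rewrite rm_formula !(frame_orthoV fr) !eqxx (eq_sym j').
    by case: (j == j'); rewrite ?mulr1 ?mulr0.
  have : \sum_j \sum_j' '[rm (h j) (h j) (h j'), h j'] = 0.
    by rewrite exchange_big big1.
  under eq_bigr do under eq_bigr do rewrite term.
  have lin (u v s s' w : 'I_m -> 'I_m -> C) :
      \sum_j \sum_k (c / 2 * u j k - v j k + (s j k + s' j k) / 2 - 3 / 2 * w j k)
      = c / 2 * (\sum_j \sum_k u j k) - \sum_j \sum_k v j k
        + (\sum_j \sum_k s j k + \sum_j \sum_k s' j k) / 2
        - 3 / 2 * (\sum_j \sum_k w j k).
    rewrite -big_split mulr_suml !mulr_sumr.
    rewrite -sumrB -big_split -sumrB; apply: eq_bigr => j _ /=.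
    rewrite -big_split mulr_suml !mulr_sumr.
    by rewrite -sumrB -big_split -sumrB; apply: eq_bigr.
  rewrite (lin (fun j k => 1 + (j == k)%:R)
    (fun j k => '[br (h j) (h k), br (h j) (h k)])
    (fun j k => '[sp (h j) (h k), sp (h j) (h k)])
    (fun j k => '[sp (h k) (h j), sp (h k) (h j)])
    (fun j k => '[sp (h j) (h j), sp (h k) (h k)]
                + '[sp (h k) (h k), sp (h j) (h j)])) /= nu0.
  have br_sp' := br_sp; rewrite [in RHS]exchange_big in br_sp'.
  rewrite -br_sp' -br_sp.
  have -> : \sum_(j < m) \sum_(k < m) (1 + (j == k)%:R) = (m ^ 2 + m)%:R :> C.
    under eq_bigr => j _ do rewrite big_split sumr_const card_ord /=.
    rewrite big_split /= sumr_const card_ord -mulrnA natrD; congr (_ + _).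
    rewrite -[in RHS](card_ord m) -sumr_const; apply: eq_bigr => j _.
    rewrite (bigD1 j) //= eqxx big1 ?addr0 // => i /negPf ij.
    by rewrite eq_sym ij.
  by move=> e; rewrite -[RHS]e; field.
move/eqP; rewrite !mulf_eq0 (negPf c0) invr_eq0 !pnatr_eq0 /= addn_eq0 => /andP[_ /eqP m0].
move=> x y; apply: (UP x).2; apply: (frame_perpP fr) => -[j jm].
by exfalso; rewrite m0 in jm.
Qed.

End Killing.

(** * Cartan's criterion *)

Section PolyMx.
Context {C : numClosedFieldType}.

(** Chinese remainders. Evaluated at a matrix, the polynomial acts on each
    generalized eigenspace as the conjugate of the eigenvalue. *)
Lemma poly_conj_interpolation (rs : seq C) N :
  exists p : {poly C}, forall l, l \in rs -> ('X - l%:P) ^+ N %| p - (l^*)%:P.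
Proof.
pose Q (s : seq C) := \prod_(l <- s) ('X - l%:P) ^+ N : {poly C}.
have cop l s : l \notin s -> coprimep (('X - l%:P) ^+ N) (Q s).
  move=> ls; rewrite /Q big_seq; elim/big_ind: _ => [|p q cp cq|m ms]; [exact: coprimep1| |].
    by rewrite coprimepMr cp cq.
  rewrite coprimep_expl // coprimep_expr // coprimep_XsubC root_XsubC.
  by apply: contraNneq ls => e; rewrite ?e // -e.
suff H s : uniq s ->
    exists p : {poly C}, forall l, l \in s -> ('X - l%:P) ^+ N %| p - (l^*)%:P.
  have [p pP] := H (undup rs) (undup_uniq rs).
  by exists p => l lrs; apply: pP; rewrite mem_undup.
elim: s => [_|l s IH /= /andP[ls us]]; first by exists 0.
have [p pP] := IH us.
have /Bezout_eq1_coprimepP[u /eqP eu] := cop l s ls.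
rewrite eq_sym -subr_eq eq_sym in eu; move/eqP in eu.
exists (p * (u.1 * ('X - l%:P) ^+ N) + (l^*)%:P * (u.2 * Q s)) => m.
rewrite inE => /predU1P[->|ms].
  rewrite [X in _ %| X](_ : _ = (p - (l^*)%:P) * u.1 * ('X - l%:P) ^+ N) ?dvdp_mull //.
  by rewrite -mulrA !eu; ring.
rewrite [X in _ %| X](_ : _ = (p - (m^*)%:P) + ((l^*)%:P - p) * u.2 * Q s).
  apply: dvdp_add; first exact: pP.
  apply: dvdp_mull; rewrite /Q (big_rem m) //=; exact: dvdp_mulr.
by rewrite eu; ring.
Qed.

Lemma trig_horner n (A : 'M[C]_n.+1) (p : {poly C}) : is_trig_mx A ->
  is_trig_mx (horner_mx A p) /\ forall i, horner_mx A p i i = p.[A i i].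
Proof.
move=> /is_trig_mxP At; elim/poly_ind: p => [|p a [/is_trig_mxP Tt Td]].
  rewrite rmorph0; split; first exact: mx0_is_trig.
  by move=> i; rewrite mxE horner0.
rewrite rmorphD rmorphM /= horner_mx_X horner_mx_C.
have mulE (i j : 'I_n.+1) : (i <= j)%N -> (horner_mx A p *m A) i j = (i == j)%:R * (p.[A i i] * A i i).
  move=> ij; rewrite mxE (bigD1 i) //= big1 ?addr0 => [|k ki]; last first.
    have [lt_ik|le_ki] := ltnP i k; first by rewrite Tt // mul0r.
    have lt_ki : (k < i)%N by rewrite ltn_neqAle ki le_ki.
    by rewrite [A k j]At ?mulr0 // (leq_trans lt_ki).
  have [->|neq_ij] := eqVneq i j; first by rewrite Td mul1r.
  by rewrite [A i j]At ?mulr0 ?mul0r // ltn_neqAle neq_ij.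
split.
  apply/is_trig_mxP => i j ij; rewrite mxE mulE 1?ltnW // mxE.
  by rewrite -val_eqE (ltn_eqF ij) mul0r add0r.
by move=> i; rewrite mxE mulE // mxE eqxx mul1r !hornerE mulr1n.
Qed.

End PolyMx.

Section Cartan.
Context {C : numClosedFieldType} {n : nat} {c : C} (B : bismutPoint n.+1 c).
Implicit Types x y u : 'rV[C]_n.+1.
Local Notation br := (bracket B).

(** The binomial expansion of the Leibniz rule, by induction on the exponents. *)
Lemma derivation_geigen D a b i j x y : derivation B D ->
  x *m (D - a%:M) ^+ i = 0 -> y *m (D - b%:M) ^+ j = 0 ->
  br x y *m (D - (a + b)%:M) ^+ (i + j) = 0.
Proof.
move=> /derivationP dD; have [k] := ubnP (i + j).
elim: k i j x y => // k IH [|i] [|j] x y ijk;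
  rewrite ?expr0 ?mulmx1 ?add0n ?addn0 => xi yj; rewrite ?xi ?yj ?br0l ?br0r ?mul0mx //.
rewrite addSn exprS [_ *m (_ * _)]mulmxA.
have -> : br x y *m (D - (a + b)%:M) = br (x *m (D - a%:M)) y + br x (y *m (D - b%:M)).
  by rewrite !mulmxBr dD !mul_mx_scalar scalerDl !brE opprD addrACA.
rewrite mulmxDl IH //; last by rewrite -mulmxA mulmxE -exprS.
rewrite add0r -addSnnS IH //; first by rewrite addSnnS -ltnS -addSn.
by rewrite -mulmxA mulmxE -exprS.
Qed.

(** Cartan's trick: the operator that acts as the conjugate eigenvalue on each
    generalized eigenspace of [ad u] is again a derivation, and its trace
    against [ad u] is the sum of the squared moduli of the eigenvalues. *)
Lemma cartan_nilpotent u : (forall D, derivation B D -> \tr (D *m ad B u) = 0) ->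
  ad B u ^+ n.+1 = 0.
Proof.
move=> tr0; set M := ad B u in tr0 *.
have [P Pu] := Schur M (ltn0Sn n); rewrite /similar_to /= conjymx //.
set T := P *m M *m P^t* => Tt.
have defT : T = P *m M *m P^t* by []; clearbody T.
have Punit : P \in unitmx by exact: unitarymx_unit.
have TP q : horner_mx T q = P *m horner_mx M q *m P^t*.
  by rewrite defT -invmx_unitary // horner_mx_uconj.
have PP : P^t* *m P = 1%:M by exact: unitary_adjmx Pu.
pose rs := [seq T i i | i <- enum 'I_n.+1].
have Trs i : T i i \in rs by apply: map_f; rewrite mem_enum.
have [p pP] := poly_conj_interpolation rs (n.+1 + n.+1).
pose D := horner_mx M p.
have hornerMl l k : horner_mx M (('X - l%:P) ^+ k) = (M - l%:M) ^+ k.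
  by rewrite rmorphXn rmorphB /= horner_mx_X horner_mx_C.
have pM l q : l \in rs -> (('X - l%:P) ^+ (n.+1 + n.+1) %| q) ->
    forall x, x *m (M - l%:M) ^+ (n.+1 + n.+1) = 0 -> x *m horner_mx M q = 0.
  move=> _ /dvdpP[r ->] x xl; rewrite mulrC rmorphM /= hornerMl.
  by rewrite -mulmxE mulmxA xl mul0mx.
have Dl l x : l \in rs -> x *m (M - l%:M) ^+ (n.+1 + n.+1) = 0 -> x *m D = l^* *: x.
  move=> /[dup] lrs /pP pl xl; have := pM _ _ lrs pl x xl.
  by rewrite rmorphB /= horner_mx_C mulmxBr mul_mx_scalar => /eqP; rewrite subr_eq0 => /eqP.
have geigen l x : x *m (M - l%:M) ^+ n.+1 = 0 -> x *m (M - l%:M) ^+ (n.+1 + n.+1) = 0.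
  by move=> xl; rewrite exprD -mulmxE mulmxA xl mul0mx.
have notin l k x : l \notin rs -> x *m (M - l%:M) ^+ k = 0 -> x = 0.
  move=> lrs; have Ml : M - l%:M \in unitmx.
    have : T - l%:M \in unitmx.
      rewrite unitmxE det_trig; last first.
        apply/is_trig_mxP => i j ij; rewrite !mxE (is_trig_mxP Tt) //.
        by rewrite -val_eqE (ltn_eqF ij) mulr0n subrr.
      rewrite unitfE prodf_seq_neq0; apply/allP => i _ /=.
      rewrite !mxE eqxx mulr1n subr_eq0.
      by apply: contraNneq lrs => <-; exact: Trs.
    have -> : T - l%:M = P *m (M - l%:M) *m P^t*.
      rewrite defT mulmxBr mulmxBl mul_mx_scalar -scalemxAl -[P *m P^t*]mulmx1.
      by rewrite (unitarymxP Pu) mulmx1 scalemx1.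
    by rewrite !unitmx_mul => /andP[/andP[]].
  elim: k => [|k IH]; first by rewrite expr0 mulmx1.
  rewrite exprSr -mulmxE mulmxA => /(congr1 (mulmx^~ (invmx (M - l%:M)))).
  by rewrite mulmxK // mul0mx.
pose s := undup rs.
have rsT i : (i < size s)%N -> s`_i \in rs.
  by move=> i_s; rewrite -mem_undup mem_nth.
have decomp x : exists y : 'I_(size s) -> 'rV[C]_n.+1,
    x = \sum_i y i /\ forall i, y i *m (M - (s`_i)%:M) ^+ n.+1 = 0.
  have : (x <= kermxpoly M (\prod_(i < size s) ('X - (s`_i)%:P) ^+ n.+1))%MS.
    apply/sub_kermxP; suff -> : horner_mx M (\prod_(i < size s) ('X - (s`_i)%:P) ^+ n.+1) = 0.
      by rewrite mulmx0.
    have TM q : horner_mx T q = 0 -> horner_mx M q = 0.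
      rewrite TP => /(congr1 (fun X => P^t* *m X *m P)); rewrite mulmx0 mul0mx.
      by rewrite !mulmxA PP mul1mx -mulmxA PP mulmx1.
    apply: TM; have := Cayley_Hamilton T; rewrite char_poly_trig //.
    rewrite -(big_mkord xpredT (fun i => ('X - (s`_i)%:P) ^+ n.+1)) -(big_nth 0 xpredT (fun l => ('X - l%:P) ^+ n.+1)).
    have -> : \prod_(i < n.+1) ('X - (T i i)%:P) = \prod_(l <- rs) ('X - l%:P).
      by rewrite big_map big_enum.
    rewrite -prodr_undup_exp_count -/s => chT.
    rewrite (eq_bigr (fun l => ('X - l%:P) ^+ count_mem l rs * ('X - l%:P) ^+ (n.+1 - count_mem l rs))).
      by rewrite big_split /= rmorphM /= chT mul0r.
    move=> l _; rewrite -exprD subnKC // (leq_trans (count_size _ _)) //.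
    by rewrite size_map size_enum_ord.
  rewrite kermxpoly_prod; last first.
    move=> i j _ _ ij; rewrite coprimep_expl // coprimep_expr //.
    rewrite coprimep_XsubC root_XsubC nth_uniq ?undup_uniq //.
  case/sub_sumsmxP => y ->; exists (fun i => y i *m kermxpoly M (('X - (s`_i)%:P) ^+ n.+1)).
  split=> // i; rewrite -mulmxA -hornerMl /kermxpoly mulmx_ker mulmx0 //.
have Dder : derivation B D.
  apply/derivationP => x y.
  have [xs [-> xsP]] := decomp x; have [ys [-> ysP]] := decomp y.
  rewrite !mulmx_suml !br_suml mulmx_suml -big_split; apply: eq_bigr => i _.
  rewrite !br_sumr mulmx_suml -big_split; apply: eq_bigr => j _ /=.
  rewrite (Dl _ _ (rsT i (ltn_ord i)) (geigen _ _ (xsP i))).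
  rewrite (Dl _ _ (rsT j (ltn_ord j)) (geigen _ _ (ysP j))).
  rewrite !brE -scalerDl -rmorphD /=.
  have := derivation_geigen (derivation_ad B u) (xsP i) (ysP j).
  rewrite -/M; have [/Dl H /H //|nin /(notin _ _ _ nin) ->] := boolP (s`_i + s`_j \in rs).
  by rewrite mul0mx scaler0.
have trD : \sum_i T i i * (T i i)^* = 0.
  rewrite -[RHS](tr0 D Dder).
  have -> : \tr (D *m M) = \tr (horner_mx T p *m T).
    rewrite TP defT -!mulmxA (mulmxA (P^t*) P) PP mul1mx [in RHS]mxtrace_mulC.
    by rewrite -!mulmxA PP mulmx1.
  have [/is_trig_mxP pT pTd] := trig_horner p Tt; move/is_trig_mxP: Tt => Tt0.
  apply: eq_bigr => i _; rewrite mxE (bigD1 i) //= big1 ?addr0 => [|k ki].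
    rewrite pTd mulrC; congr (_ * _); have : 'X - (T i i)%:P %| p - ((T i i)^*)%:P.
      apply: dvdp_trans (pP _ (Trs i)).
      by rewrite exprD exprS -mulrA dvdp_mulIl.
    by rewrite dvdp_XsubCl rootE !hornerE subr_eq0 => /eqP <-.
  have [lt_ik|le_ki] := ltnP i k; first by rewrite pT // mul0r.
  by rewrite Tt0 ?mulr0 // ltn_neqAle ki.
have Tii i : T i i = 0.
  apply/eqP; rewrite -normr_eq0 -sqrf_eq0 normCK.
  by have /eqP := trD; rewrite psumr_eq0 => [/allP/(_ i (mem_index_enum _))|k _]; rewrite ?mul_conjC_ge0.
have T0 : T ^+ n.+1 = 0.
  have := Cayley_Hamilton T; rewrite char_poly_trig //.
  under eq_bigr do rewrite Tii subr0.
  by rewrite prodr_const card_ord rmorphXn /= horner_mx_X.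
have := TP 'X^(n.+1); rewrite rmorphXn /= horner_mx_X T0 rmorphXn /= horner_mx_X.
move/(congr1 (fun X => invmx P *m X *m P)); rewrite mulmx0 mul0mx.
by rewrite !mulmxA mulVmx // mul1mx -invmx_unitary // mulmxKV // => <-.
Qed.

End Cartan.

(** * Engel's theorem *)

Section Engel.
Context {C : numClosedFieldType} {n : nat} {c : C} (B : bismutPoint n c).
Implicit Types (x y u w : 'rV[C]_n) (L W : 'M[C]_n).
Local Notation br := (bracket B).

(** Engel's theorem for the adjoint action, in the relative form that makes the
    induction on the dimension of [L] go through without quotient spaces. *)
Lemma engel L W W0 :
  (forall x y, (x <= L -> y <= L -> br x y <= L)%MS) ->
  (forall x w, (x <= L)%MS -> exists k, iter k (br x) w = 0) ->
  (forall x w, (x <= L -> w <= W -> br x w <= W)%MS) ->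
  (forall x w, (x <= L -> w <= W0 -> br x w <= W0)%MS) ->
  ~~ (W <= W0)%MS ->
  exists2 w, (w <= W)%MS && ~~ (w <= W0)%MS &
    forall x, (x <= L)%MS -> (br x w <= W0)%MS.
Proof.
have [r] := ubnP (\rank L); elim: r L W W0 => // r IH L W W0 rL Lc Lnil LW LW0 WW0.
have [/eqP L0|L0] := posnP (\rank L).
  have /row_subPn[i wi] := WW0; exists (row i W); first by rewrite row_sub.
  move=> x xL; suff -> : x = 0 by rewrite br0l sub0mx.
  by apply/eqP; rewrite -submx0; move: L0; rewrite mxrank_eq0 => /eqP <-.
(* A subalgebra [H] of maximal dimension among the proper ones has codimension
   one, by the induction hypothesis for [H] acting on [L] modulo [H]. *)
pose Q k := `[< exists H : 'M[C]_n, [/\ (H <= L)%MS, \rank H = k, (k < \rank L)%N &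
  forall x y, (x <= H -> y <= H -> br x y <= H)%MS] >].
have Qex : exists k, Q k.
  exists 0%N; apply/asboolP; exists 0; split; rewrite ?sub0mx ?mxrank0 //.
  by move=> x y; rewrite submx0 => /eqP -> _; rewrite br0l sub0mx.
have Qle k : Q k -> (k <= \rank L)%N by move=> /asboolP[H [_ _ /ltnW]].
case: (ex_maxnP Qex Qle) => k /asboolP[H [HL rH kL Hc]] kmax.
have rHr : (\rank H < r)%N by rewrite rH (leq_trans kL) // -ltnS.
have Hnil x w : (x <= H)%MS -> exists j, iter j (br x) w = 0.
  by move=> xH; apply: Lnil; exact: submx_trans xH HL.
have [||x /andP[xL xH] Hx] := IH H L H rHr Hc Hnil _ Hc.
- by move=> y z yH; apply: Lc; exact: submx_trans yH HL.
- by apply/negP => /mxrankS; rewrite rH leqNgt kL.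
have HxE y : (y <= H + x)%MS -> exists a h, [/\ y = h + a *: x & (h <= H)%MS].
  case/sub_addsmxP => -[u v] /= ->; exists (v 0 0), (u *m H).
  by rewrite {1}[v]mx11_scalar mul_scalar_mx submxMl.
have Hxc y z : (y <= H + x -> z <= H + x -> br y z <= H + x)%MS.
  move=> /HxE[a [h [-> hH]]] /HxE[b [h' [-> h'H]]].
  rewrite !brE brxx !scaler0 addr0; apply: submx_trans (addsmxSl H x).
  rewrite (brC B x h') -scaleN1r !(addmx_sub, scalemx_sub) ?Hx ?Hc //.
have HxL : (H + x <= L)%MS by rewrite addsmx_sub HL.
have LHx : (L <= H + x)%MS.
  have [leL <-] := mxrank_leqif_sup HxL; rewrite eqn_leq leL leqNgt.
  apply/negP => ltL; have /kmax : Q (\rank (H + x)%MS).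
    by apply/asboolP; exists (H + x)%MS.
  rewrite -rH => le_r; apply: (negP xH); apply: submx_trans (addsmxSr H x) _.
  have [leH <-] := mxrank_leqif_sup (addsmxSl H x).
  by rewrite eqn_leq leH le_r.
have [||w0 /andP[w0W w0W0] Hw0] := IH H W W0 rHr Hc Hnil _ _ WW0.
- by move=> y z yH; apply: LW; exact: submx_trans yH HL.
- by move=> y z yH; apply: LW0; exact: submx_trans yH HL.
have iterP k' : (iter k' (br x) w0 <= W)%MS /\
    forall h, (h <= H)%MS -> (br h (iter k' (br x) w0) <= W0)%MS.
  elim: k' => [|k' [iW iH]] /=; first by split.
  split=> [|h hH]; first exact: LW.
  have -> : br h (br x (iter k' (br x) w0)) =
      br (br h x) (iter k' (br x) w0) + br x (br h (iter k' (br x) w0)).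
    by rewrite br_jacobi subrK.
  by rewrite addmx_sub ?(iH _ (Hx _ hH)) // LW0 // iH.
have ex0 : exists k', (iter k' (br x) w0 <= W0)%MS.
  by have [k' e] := Lnil x w0 xL; exists k'; rewrite e sub0mx.
case: (ex_minnP ex0) => -[|k'] iW0 kmin; first by rewrite iW0 in w0W0.
exists (iter k' (br x) w0).
  rewrite (iterP k').1 /=; apply/negP => /kmin; by rewrite ltnn.
move=> y yL; have [a [h [-> hH]]] := HxE y (submx_trans yL LHx).
rewrite !brE addmx_sub ?scalemx_sub //; exact: (iterP k').2.
Qed.

End Engel.

(** * The derived algebra and the Ricci operator *)

Lemma finite_max (C : numDomainType) (Q : C -> Prop) (rs : seq C) :
  (forall l, Q l -> l \is Num.real) -> (forall l, Q l -> l \in rs) ->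
  (exists l, Q l) -> exists2 l, Q l & forall m, Q m -> m <= l.
Proof.
move=> Qr Qrs [l0 Ql0].
suff H (s : seq C) : (exists2 l, Q l & l \in s) ->
    exists2 l, Q l & forall m, Q m -> m \in s -> m <= l.
  have [|l Ql lmax] := H rs; first by exists l0; rewrite ?Qrs.
  by exists l => // m Qm; apply: lmax; rewrite ?Qrs.
elim: s => [[]//|a s IH [l Ql ls]].
have [Qa|nQa] := pselect (Q a); last first.
  have [|m Qm mmax] := IH.
    by exists l => //; move: ls; rewrite inE => /predU1P[e|//]; rewrite e in Ql.
  exists m => // m' Qm'; rewrite inE => /predU1P[e|]; last exact: mmax.
  by rewrite e in Qm'.
have [ex|nex] := pselect (exists2 l, Q l & l \in s); last first.
  exists a => // m Qm; rewrite inE => /predU1P[->//|ms]; case: nex.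
  by exists m.
have [m Qm mmax] := IH ex.
have [am|ma] := real_leP (Qr _ Qa) (Qr _ Qm).
  by exists m => // m' Qm'; rewrite inE => /predU1P[->//|]; exact: mmax.
exists a => // m' Qm'; rewrite inE => /predU1P[->//|m's].
exact: le_trans (mmax _ Qm' m's) (ltW ma).
Qed.

Lemma stable_eigenvector (C : numClosedFieldType) n (S : 'M[C]_n)
    (X : 'rV[C]_n -> Prop) :
  X 0 -> (forall a x y, X x -> X y -> X (a *: x + y)) ->
  (forall x, X x -> X (x *m S)) -> (exists2 x, X x & x != 0) ->
  exists a e, [/\ X e, e != 0 & e *m S = a *: e].
Proof.
move=> X0 Xlin XS [x Xx x0].
have [V VP] := linear_pred_mx X0 Xlin.
have Vs : stablemx V S.
  apply/row_subP => i; rewrite row_mul; apply/VP/XS/VP; exact: row_sub.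
have rV : (0 < \rank V)%N.
  rewrite lt0n mxrank_eq0; apply: contraNneq x0 => V0.
  by have /VP := Xx; rewrite V0 submx0.
have [a /eigenvalueP[v vS v0]] := eigenvalue_closed (conjmx (row_base V) S) rV.
have := sub_eigenspace_conjmx a v (etrans (stablemx_row_base _ _) Vs) (row_base_free V).
have -> : (v <= eigenspace (conjmx (row_base V) S) a)%MS by apply/eigenspaceP.
move=> /esym/eigenspaceP e; exists a, (v *m row_base V); split=> //.
- by apply/VP; rewrite -(eq_row_base V) submxMl.
- by rewrite mulmx_free_eq0 ?row_base_free.
Qed.

Section Solvable.
Context {C : numClosedFieldType} {n : nat} {c : C} (B : bismutPoint n c).
Implicit Types x y z p q u v w : 'rV[C]_n.
Local Notation br := (bracket B).
Local Notation sp := (adj_bracket B).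
Local Notation rm := (curv B).

(** The derived algebra is encoded as the double orthogonal of the set of brackets. *)
Definition perp q := forall x y, '[br x y, q] = 0.
Definition derived u := forall q, perp q -> '[u, q] = 0.

Lemma derived_br x y : derived (br x y).
Proof. by move=> q; exact. Qed.

(** Riesz: a functional that vanishes on brackets is the product with a vector of
    [perp]. *)
Lemma derived_functional (phi : 'rV[C]_n -> C) :
  (forall a x y, phi (a *: x + y) = a * phi x + phi y) ->
  (forall x y, phi (br x y) = 0) -> forall u, derived u -> phi u = 0.
Proof.
move=> lin phi0 u du.
have p0 : phi 0 = 0 by have := lin (-1) 0 0; rewrite scaler0 addr0 mulN1r addNr.
pose q := \row_i (phi (delta_mx 0 i))^*.
have phiE x : phi x = '[x, q].
  have big I (r : seq I) P (F : I -> 'rV[C]_n) :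
      phi (\sum_(i <- r | P i) F i) = \sum_(i <- r | P i) phi (F i).
    by apply: (big_morph phi) => // y z; rewrite -[y]scale1r lin mul1r scale1r.
  rewrite {1}[x]row_sum_delta big dotmxE mxE; apply: eq_bigr => i _.
  by rewrite -[_ *: _]addr0 lin p0 addr0 !mxE conjCK.
by rewrite phiE du // => x y; rewrite -phiE.
Qed.

Lemma perp_sp q x : perp q -> sp x q = 0.
Proof. by move=> pq; apply: dot_ext => w; rewrite dot_sp dot0l -dotC pq conjC0. Qed.

Lemma derivation_adj_perp D q : derivation B D -> perp q -> perp (q *m D^t*).
Proof.
move=> /derivationP dD pq x y.
by rewrite -dot_adj dD dotDl !pq addr0.
Qed.

Lemma derived_derivation D u : derivation B D -> derived u -> derived (u *m D).
Proof.
by move=> dD du q pq; rewrite dot_adj du //; exact: derivation_adj_perp.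
Qed.

Lemma derived0 : derived 0. Proof. by move=> q _; rewrite dot0l. Qed.
Lemma derived_lin a x y : derived x -> derived y -> derived (a *: x + y).
Proof. by move=> dx dy q pq; rewrite !dotE dx // dy // mulr0 addr0. Qed.

Section Ricci.
Context {U : 'M[C]_n} {d m : nat} {f : 'I_d -> 'rV[C]_n} {h : 'I_m -> 'rV[C]_n}.
Hypothesis fr : adapted_frame U f h.
Hypothesis UP : forall x, derived x <-> (x <= U)%MS.

(** The trace is taken over a frame adapted to the derived algebra. *)
Definition ricci := \sum_i Rm B (f i) (f i) + \sum_j Rm B (h j) (h j).

Lemma ricci_adj : ricci^t* = ricci.
Proof.
rewrite /ricci [(_ + _)^T]raddfD /= map_mxD ![(\sum_i _)^T]raddf_sum /=.
by rewrite !map_mx_sum; congr (_ + _); apply: eq_bigr => i _; rewrite Rm_adj.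
Qed.

Lemma derivation_ricci : derivation B ricci.
Proof.
have D2 D D' : derivation B D -> derivation B D' -> derivation B (D + D').
  by move=> dD dD' p; rewrite mulmxDr -[p *m D]scale1r ad_linear scale1r dD dD' mulmxDr mulmxDl opprD addrACA.
have D0 : derivation B 0 by move=> p; rewrite !mulmx0 mul0mx ad0 subr0.
by apply: (D2); apply: big_ind => // i _; exact: derivation_Rm.
Qed.

(** The derived algebra is invariant under the curvature operators, so
    [rm_split] kills the curvature terms that mix it with [perp]. Summed over the
    derived algebra, this writes [c] times its dimension as a sum of squares;
    hence [c] is positive, and so is the Ricci operator on [perp]. *)
Lemma ricci_perp_gt0 l : c != 0 -> (0 < d)%N -> perp l -> l != 0 ->
  0 < '[l *m ricci, l].
Proof.
move=> c0 d0 pl l0; have ll : 0 < '[l, l] by rewrite lt_def dot_eq0 l0 dot_ge0.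
have fU i : derived (f i) by apply/UP; exact: frame_sub fr i.
have ph j : perp (h j).
  by move=> x y; apply: (frame_perp fr); apply/UP; exact: derived_br.
have spl x : sp x l = 0 by exact: perp_sp.
have lU x : derived x -> '[x, l] = 0 by exact.
have lU' x : derived x -> '[l, x] = 0 by move=> dx; rewrite -dotC lU ?conjC0.
pose al := \sum_i '[br l (f i), br l (f i)].
pose be := \sum_j '[br l (h j), br l (h j)].
have al0 : 0 <= al by apply: sumr_ge0 => i _; exact: dot_ge0.
have be0 : 0 <= be by apply: sumr_ge0 => i _; exact: dot_ge0.
have si : \sum_i '[sp l (f i), sp l (f i)] = al + be.
  have e i : '[sp l (f i), sp l (f i)] =
     \sum_k '[br l (f k), f i] * '[f i, br l (f k)]
   + \sum_j '[br l (h j), f i] * '[f i, br l (h j)].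
    rewrite (frame_parseval fr); congr (_ + _); apply: eq_bigr => k _;
      by rewrite dot_sp dot_spr mulrC.
  have p x : \sum_i '[br l x, f i] * '[f i, br l x] = '[br l x, br l x].
    rewrite [RHS](frame_parseval fr) [X in _ + X]big1 ?addr0 // => j _.
    by rewrite ph mul0r.
  under eq_bigr do rewrite e.
  rewrite big_split exchange_big [X in _ + X = _]exchange_big /=.
  by rewrite /al /be; congr (_ + _); apply: eq_bigr => k _; rewrite p.
have mixed i : '[sp l (f i), sp l (f i)] =
    c / 3 * '[l, l] + 2 / 3 * '[br l (f i), br l (f i)].
  have : '[rm l (f i) (f i), l] = 0.
    rewrite dot_rm (rm_split (P := derived)) ?dot0r //.
    by move=> x y z; apply: derived_derivation; exact: derivation_Rm.
  rewrite rm_formula (brC B (f i)) !spl (frame_orthoU fr) eqxx (lU' _ (fU i)) !dotE => e.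
  by rewrite -[LHS]addr0 -[X in _ + X = _](mulr0 (2 / 3)) -[X in _ + _ * X = _]e /=; field.
have main : al + 3 * be = c * d%:R * '[l, l].
  have := si; under eq_bigr do rewrite mixed.
  rewrite big_split /= sumr_const card_ord -mulr_sumr -/al => e.
  have -> : al + 3 * be = 3 * (al + be) - 2 * al by ring.
  by rewrite -e -mulr_natr; field.
have c_gt0 : 0 < c.
  rewrite lt_def c0 /= -(pmulr_lge0 _ (_ : 0 < d%:R * '[l, l])).
    by rewrite mulrA -main addr_ge0 // mulr_ge0.
  by rewrite mulr_gt0 ?ltr0n.
have -> : '[l *m ricci, l] = be + c / 2 * (m.+1)%:R * '[l, l].
  rewrite /ricci mulmxDr !mulmx_sumr dotDl !dot_suml.
  have rU i : '[l *m Rm B (f i) (f i), l] =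
      c / 2 * '[l, l] - '[br l (f i), br l (f i)]
      + '[sp l (f i), sp l (f i)] / 2.
    rewrite -/(rm _ _ _) rm_pair_sym rm_formula !spl (frame_orthoU fr) eqxx.
    by rewrite (lU _ (fU i)) !dotE /=; field.
  have rV j : '[l *m Rm B (h j) (h j), l] =
      c / 2 * '[l, l] - '[br l (h j), br l (h j)]
      + c / 2 * ('[l, h j] * '[h j, l]).
    rewrite -/(rm _ _ _) rm_pair_sym rm_formula !spl (perp_sp _ (ph j)).
    by rewrite (frame_orthoV fr) eqxx !dotE /=; field.
  under eq_bigr do rewrite rU; under [X in _ + X]eq_bigr do rewrite rV.
  have half : \sum_i '[sp l (f i), sp l (f i)] / 2 = (al + be) / 2.
    by rewrite -si mulr_suml.
  rewrite !big_split /= !sumrN -/al -/be half -[X in _ + (_ + X) = _]mulr_sumr.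
  have -> : \sum_j '[l, h j] * '[h j, l] = '[l, l].
    rewrite [RHS](frame_parseval fr) [X in _ = X + _]big1 ?add0r // => i _.
    by rewrite (lU' _ (fU i)) mul0r.
  have sum_cst (a : C) k : \sum_(i < k) a = a * k%:R.
    by rewrite sumr_const card_ord mulr_natr.
  rewrite !sum_cst.
  have -> : c / 2 * '[l, l] * d%:R = (al + 3 * be) / 2 by rewrite main; field.
  have -> : m.+1%:R = m%:R + 1 :> C by rewrite -natr1.
  by field.
by rewrite ltr_wpDl // !mulr_gt0 ?invr_gt0 ?ltr0n.
Qed.

End Ricci.

End Solvable.

(** For a derivation D, the trace of D (ad [x, y]) is the Killing product of D x
    and y, which is zero: Cartan's criterion applies. *)
Lemma derived_nilpotent (C : numClosedFieldType) n (c : C) (B : bismutPoint n c)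
    (u w : 'rV[C]_n) :
  c != 0 -> derived B u -> iter n (bracket B u) w = 0.
Proof.
case: n => [|n] in B u w *; first by move=> _ _; apply/rowP => -[].
move=> c0 du; have K0 := killing_eq0 B c0.
have nil : ad B u ^+ n.+1 = 0.
  apply: cartan_nilpotent => D dD.
  apply: (derived_functional (B := B) (phi := fun u => \tr (D *m ad B u))) du.
    by move=> a x y; rewrite ad_linear mulmxDr -scalemxAr mxtraceD mxtraceZ.
  move=> x y; have := K0 (x *m D) y.
  rewrite /killing dD mulmxBl linearB /= /bracket ad_bracket mulmxBr linearB /=.
  by rewrite [\tr (D *m (_ *m _))]mxtrace_mulC -!mulmxA
    [in X in _ -> X = _]mxtrace_mulC !mulmxA.
have iterE k : iter k (bracket B u) w = w *m ad B u ^+ k.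
  elim: k => [|k /= ->]; first by rewrite mulmx1.
  by rewrite /bracket exprSr -mulmxE mulmxA.
by rewrite iterE nil mulmx0.
Qed.

Section Abelian.
Context {C : numClosedFieldType} {n : nat} {c : C} (B : bismutPoint n c).
Implicit Types x y z p q u v w : 'rV[C]_n.
Local Notation br := (bracket B).
Local Notation derived := (derived B).
Local Notation perp := (perp B).

(** Engel's theorem for the derived algebra acting on the whole algebra. *)
Lemma derived_centralizer : c != 0 -> (exists x : 'rV[C]_n, x != 0) ->
  exists2 w, w != 0 & forall u, derived u -> br u w = 0.
Proof.
move=> c0 [x0 x0N0].
have K0 := killing_eq0 B c0.
have [U UP] := linear_pred_mx (@derived0 _ _ _ B) (@derived_lin _ _ _ B).
have nil u w : derived u -> exists k, iter k (br u) w = 0.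
  by move=> du; exists n; exact: derived_nilpotent.
have Uc x y : (x <= U -> y <= U -> br x y <= U)%MS.
  by move=> _ _; apply/UP; exact: derived_br.
have U1 x y : (x <= U -> y <= 1%:M -> br x y <= (1%:M : 'M[C]_n))%MS.
  by move=> _ _; exact: submx1.
have U0 x y : (x <= U -> y <= (0 : 'M[C]_n) -> br x y <= (0 : 'M[C]_n))%MS.
  by move=> _; rewrite !submx0 => /eqP ->; rewrite br0r.
have n1 : ~~ ((1%:M : 'M[C]_n) <= (0 : 'M[C]_n))%MS.
  apply: contra x0N0; rewrite submx0 => /eqP e.
  by rewrite -[x0]mulmx1 e mulmx0.
have [w /andP[_ w0] wU] := engel Uc (fun x w xU => nil x w ((UP x).2 xU)) U1 U0 n1.
exists w; first by rewrite submx0 in w0.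
by move=> u /UP /wU; rewrite submx0 => /eqP.
Qed.

(** Among the eigenvectors of the Ricci operator that centralize the derived
    algebra, one of maximal eigenvalue is central, and [center_trivial] applies. *)
Theorem bismut_abelian : c != 0 -> forall x y, br x y = 0.
Proof.
move=> c0 x0 y0; apply: contrapT => xy0.
have x0N0 : x0 != 0 by apply/eqP => x00; case: xy0; rewrite x00 br0l.
have [|w0 w00 w0U] := derived_centralizer c0; first by exists x0.
have [U UP] := linear_pred_mx (@derived0 _ _ _ B) (@derived_lin _ _ _ B).
have [d [m [f [h fr]]]] := adapted_frame_exists U.
have d0 : (0 < d)%N.
  rewrite lt0n; apply/eqP => d0; apply: xy0; rewrite (frame_expand fr (br x0 y0)).
  rewrite !big1 ?addr0 // => [j _|[i id] _]; last by exfalso; rewrite d0 in id.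
  by rewrite (frame_perp fr) ?scale0r //; apply/UP; exact: derived_br.
set S := @ricci _ _ _ B d m f h.
have dS : derivation B S by exact: derivation_ricci.
have SS : S^t* = S by exact: ricci_adj.
have Sbr x y : br x y *m S = br (x *m S) y + br x (y *m S).
  by have /derivationP := dS; apply.
have Spos l : perp l -> l != 0 -> 0 < '[l *m S, l] by exact: (ricci_perp_gt0 fr UP).
pose C0 w := forall u, derived u -> br u w = 0.
have C0lin a x y : C0 x -> C0 y -> C0 (a *: x + y).
  by move=> xC yC u du; rewrite !brE xC // yC // scaler0 addr0.
have C0S x : C0 x -> C0 (x *m S).
  move=> xC u du; have := Sbr u x.
  by rewrite (xC u du) (xC _ (derived_derivation dS du)) mul0mx add0r.
pose Q l := exists w, [/\ C0 w, w != 0 & w *m S = l *: w].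
have Qreal l : Q l -> l \is Num.real.
  move=> [w [_ wN0 wS]]; apply/CrealP.
  have ww : '[w, w] != 0 by rewrite dot_eq0.
  by apply: (mulIf ww); rewrite -[LHS]dotZr -[RHS]dotZl -wS dot_adj SS.
have Qspec l : Q l -> eigenvalue S l.
  by move=> [w [_ wN0 wS]]; apply/eigenvalueP; exists w.
have [rs rsP] := closed_field_poly_normal (char_poly S).
have [| |l [w [wC wN0 wS]] lmax] := finite_max (Q := Q) (rs := rs) Qreal.
- move=> l /Qspec; rewrite eigenvalue_root_char rsP (monicP (char_poly_monic _)) scale1r.
  by rewrite root_prod_XsubC.
- have [| | | |a [e [eC e0 eS]]] := @stable_eigenvector C n S C0.
  + by move=> u du; rewrite br0r.
  + exact: C0lin.
  + exact: C0S.
  + by exists w0.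
  by exists a, e.
have wU u : derived u -> br u w = 0 by exact: wC.
pose P0 v := perp v /\ br v w = 0.
have P0lin a x y : P0 x -> P0 y -> P0 (a *: x + y).
  move=> [px xw] [py yw]; split; last by rewrite !brE xw yw scaler0 addr0.
  by move=> u v; rewrite !dotE px py mulr0 addr0.
have perpS v : perp v -> perp (v *m S).
  by move=> pv; rewrite -SS; exact: derivation_adj_perp.
have P0S v : P0 v -> P0 (v *m S).
  move=> [pv vw]; split; first exact: perpS.
  by have := Sbr v w; rewrite vw mul0mx wS brZr vw scaler0 addr0 => <-.
(* On the part of [perp] orthogonal to the centralizer of [w], an eigenvector of
   [S] would raise the maximal eigenvalue. *)
have wcent v : perp v -> br v w = 0.
  move=> pv; have [|V VP] := linear_pred_mx (P := P0) _ P0lin.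
    by split=> [x y|]; rewrite ?dot0r ?br0l.
  have [d' [m' [f' [h' fr']]]] := adapted_frame_exists V.
  pose X l := perp l /\ forall v, P0 v -> '[v, l] = 0.
  pose v' := v - \sum_i '[v, f' i] *: f' i.
  apply: contrapT => vw.
  have fP i : P0 (f' i) by apply/VP; exact: frame_sub fr' i.
  have sumP : P0 (\sum_i '[v, f' i] *: f' i).
    apply: (big_ind P0) => [|x y xP yP|i _].
    - by split=> [x y|]; rewrite ?dot0r ?br0l.
    - by rewrite -[x]scale1r; exact: P0lin.
    - by rewrite -[_ *: _]addr0; apply: P0lin => //; split=> [x y|]; rewrite ?dot0r ?br0l.
  have v'X : X v'.
    split=> [x y|z /VP zV]; first by rewrite !dotE pv sumP.1 oppr0 addr0.
    rewrite /v' {1}(frame_expand fr' v) addrAC subrr add0r dot_sumr big1 // => j _.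
    by rewrite dotZr (_ : '[z, h' j] = 0) ?mulr0 //; exact: (frame_perp fr').
  have [| | | |a [e [[ep eP] e0 eS]]] := @stable_eigenvector C n S X.
  - by split=> [x y|z _]; rewrite dot0r.
  - move=> a x y [px xP] [py yP]; split=> [u z|z zP]; rewrite !dotE.
      by rewrite px py mulr0 addr0.
    by rewrite xP // yP // mulr0 addr0.
  - move=> x [px xP]; split=> [|z zP]; first exact: perpS.
    by rewrite -SS -dot_adj xP //; exact: P0S.
  - exists v' => //; apply/eqP => v'0; apply: vw.
    by move/eqP: v'0; rewrite subr_eq0 => /eqP ->; exact: sumP.2.
  have ew : br e w != 0.
    apply/eqP => ew; have e_e : '[e, e] = 0 by apply: eP; split.
    by move: e0; rewrite -dot_eq0 e_e eqxx.
  have a_gt0 : 0 < a.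
    have := Spos e ep e0; rewrite eS dotZl pmulr_lgt0 //.
    by rewrite lt_def dot_eq0 e0 dot_ge0.
  have : a + l <= l.
    apply: lmax; exists (br e w); split=> //.
      move=> u du; have := br_jacobi B u e w.
      by rewrite (wU u) // br0r subr0 wU; [move=> <-|exact: derived_br].
    by rewrite Sbr eS wS !brE scalerDl.
  by rewrite gerDr => /(lt_le_trans a_gt0); rewrite ltxx.
have wz x : br w x = 0.
  rewrite brC (frame_expand fr x) brDl !br_suml !big1 ?addr0 ?oppr0 // => i _.
    rewrite brZl wcent ?scaler0 // => u v.
    by apply: (frame_perp fr); apply/UP; exact: derived_br.
  by rewrite brZl wU ?scaler0 //; apply/UP; exact: frame_sub fr i.
exact: xy0 (center_trivial c0 wN0 wz x0 y0).
Qed.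

End Abelian.

(** * From real to complex curvature data *)

(** The real form of [bismutPoint]: at a point, the complex structure, the metric,
    the Chern torsion, its adjoint and the curvature of the Bismut connection,
    whose torsion is [tau]. *)
Record torsionData (R : rcfType) (V : lmodType R) (c : R) := TorsionData {
  tJ : V -> V;
  tg : V -> V -> R;
  tT : V -> V -> V;
  ts : V -> V -> V;
  tR : V -> V -> V -> V;
  tJ_lin : forall a u v, tJ (a *: u + v) = a *: tJ u + tJ v;
  tJJ : forall u, tJ (tJ u) = - u;
  tg_lin : forall a u v w, tg (a *: u + v) w = a * tg u w + tg v w;
  tgC : forall u v, tg u v = tg v u;
  tg_gt0 : forall u, u != 0 -> 0 < tg u u;
  tgJ : forall u v, tg (tJ u) (tJ v) = tg u v;
  tT_lin : forall a u v w, tT w (a *: u + v) = a *: tT w u + tT w v;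
  tTC : forall u v, tT u v = - tT v u;
  tTJ : forall u v, tT u (tJ v) = tJ (tT u v);
  ts_adj : forall u v w, tg (ts u v) w = tg v (tT u w);
  tT_jacobi : forall u v w, tT u (tT v w) + tT v (tT w u) + tT w (tT u v) = 0;
  tR_lin1 : forall a u v w z, tR (a *: u + v) w z = a *: tR u w z + tR v w z;
  tRC : forall u v w, tR u v w = - tR v u w;
  tR_lin3 : forall a u v w z, tR w z (a *: u + v) = a *: tR w z u + tR w z v;
  tR_J : forall u v w, tR u v (tJ w) = tJ (tR u v w);
  tR_JJ : forall u v w, tR (tJ u) (tJ v) w = tR u v w;
  tR_skew : forall u v w z, tg (tR u v w) z = - tg w (tR u v z);
  tR_der : forall u v w z, tR u v (tT w z) = tT (tR u v w) z + tT w (tR u v z);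
  tR_bianchi : forall u v w,
    let tau x y := - tT x y + ts x y - ts y x in
    tR u v w + tR v w u + tR w u v
    = tau (tau u v) w + tau (tau v w) u + tau (tau w u) v;
  tR_hsc : forall u,
    tg (tR u (tJ u) (tJ u)) u + 2 * tg (ts u u) (ts u u) = c * tg u u ^+ 2
}.

Section TorsionData.
Context {R : rcfType} {V : lmodType R} {c : R} (B : torsionData V c).
Implicit Types u v w x y z p q : V.
Local Notation J := (tJ B).
Local Notation g := (tg B).
Local Notation T := (tT B).
Local Notation s := (ts B).
Local Notation Rb := (tR B).

Lemma tJ0 : J 0 = 0.
Proof. by have := tJ_lin B (-1) 0 0; rewrite scaler0 addr0 scaleN1r addNr. Qed.
Lemma tJD u v : J (u + v) = J u + J v.
Proof. by rewrite -[u in LHS]scale1r tJ_lin scale1r. Qed.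
Lemma tJZ a u : J (a *: u) = a *: J u.
Proof. by rewrite -[a *: u]addr0 tJ_lin tJ0 addr0. Qed.
Lemma tJN u : J (- u) = - J u.
Proof. by rewrite -scaleN1r tJZ scaleN1r. Qed.

Lemma tgDl u v w : g (u + v) w = g u w + g v w.
Proof. by rewrite -[u]scale1r tg_lin mul1r scale1r. Qed.
Lemma tg0l w : g 0 w = 0.
Proof. by have := tg_lin B (-1) 0 0 w; rewrite scaler0 addr0 mulN1r addNr. Qed.
Lemma tgZl a u w : g (a *: u) w = a * g u w.
Proof. by rewrite -[a *: u]addr0 tg_lin tg0l addr0. Qed.
Lemma tgNl u w : g (- u) w = - g u w.
Proof. by rewrite -scaleN1r tgZl mulN1r. Qed.
Lemma tgDr u v w : g w (u + v) = g w u + g w v.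
Proof. by rewrite !(tgC B w) tgDl. Qed.
Lemma tgZr a u w : g w (a *: u) = a * g w u.
Proof. by rewrite !(tgC B w) tgZl. Qed.
Lemma tgNr u w : g w (- u) = - g w u.
Proof. by rewrite !(tgC B w) tgNl. Qed.
Definition tgE := (tgDl, tgDr, tgZl, tgZr, tgNl, tgNr).

Lemma tg_ext u v : (forall w, g u w = g v w) -> u = v.
Proof.
move=> uv; apply/eqP; rewrite -subr_eq0; apply: contraT => /(tg_gt0 B).
by rewrite tgDl tgNl uv subrr ltxx.
Qed.

Lemma tgJl u v : g (J u) v = - g u (J v).
Proof. by rewrite -(tgJ B u) tJJ tgNr opprK. Qed.

Lemma tTDr u v w : T w (u + v) = T w u + T w v.
Proof. by rewrite -[u]scale1r tT_lin !scale1r. Qed.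
Lemma tT0r w : T w 0 = 0.
Proof. by have := tT_lin B (-1) 0 0 w; rewrite scaler0 addr0 scaleN1r addNr. Qed.
Lemma tTZr a u w : T w (a *: u) = a *: T w u.
Proof. by rewrite -[a *: u]addr0 tT_lin tT0r addr0. Qed.
Lemma tTNr u w : T w (- u) = - T w u.
Proof. by rewrite -scaleN1r tTZr scaleN1r. Qed.
Lemma tTDl u v w : T (u + v) w = T u w + T v w.
Proof. by rewrite !(tTC B _ w) tTDr opprD. Qed.
Lemma tTZl a u w : T (a *: u) w = a *: T u w.
Proof. by rewrite !(tTC B _ w) tTZr scalerN. Qed.
Lemma tTNl u w : T (- u) w = - T u w.
Proof. by rewrite !(tTC B _ w) tTNr. Qed.
Lemma tTJl u v : T (J u) v = J (T u v).
Proof. by rewrite tTC tTJ -tJN -tTC. Qed.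
Definition tTE := (tTDl, tTDr, tTZl, tTZr, tTNl, tTNr).

Lemma tsDr u v w : s w (u + v) = s w u + s w v.
Proof. by apply: tg_ext => z; rewrite !tgE !ts_adj tgE. Qed.
Lemma tsDl u v w : s (u + v) w = s u w + s v w.
Proof. by apply: tg_ext => z; rewrite !tgE !ts_adj tTDl tgE. Qed.
Lemma tsZl a u w : s (a *: u) w = a *: s u w.
Proof. by apply: tg_ext => z; rewrite !tgE !ts_adj tTZl tgE. Qed.
Lemma tsZr a u w : s w (a *: u) = a *: s w u.
Proof. by apply: tg_ext => z; rewrite !tgE !ts_adj tgE. Qed.
Lemma tsNl u w : s (- u) w = - s u w.
Proof. by rewrite -scaleN1r tsZl scaleN1r. Qed.
Lemma tsNr u w : s w (- u) = - s w u.
Proof. by rewrite -scaleN1r tsZr scaleN1r. Qed.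
Lemma tsJr u v : s u (J v) = J (s u v).
Proof. by apply: tg_ext => z; rewrite ts_adj !tgJl ts_adj tTJ. Qed.
Lemma tsJl u v : s (J u) v = - J (s u v).
Proof. by apply: tg_ext => z; rewrite ts_adj tgNl tgJl opprK ts_adj tTJl tTJ. Qed.
Definition tsE := (tsDl, tsDr, tsZl, tsZr, tsNl, tsNr).

Lemma ts_jacobi u v w : s (T u v) w = s v (s u w) - s u (s v w).
Proof.
apply: tg_ext => z; rewrite !(tgDl, tgNl, ts_adj) -tgNr -tgDr; congr (g w _).
have := tT_jacobi B u v z; rewrite (tTC B z u) (tTC B z (T u v)) tTNr => /eqP.
by rewrite subr_eq0 => /eqP.
Qed.

(** The complexified Bianchi identity: adding [J] of the same expression at
    [J y] keeps the terms that are conjugate linear in [y]; those that are also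
    conjugate linear in [p] or [x] cancel because [s] is the adjoint of a Lie
    algebra action. *)
Lemma bianchi_complex p y x :
  let cyc u v w := Rb u v w + Rb v w u + Rb w u v in
  cyc p y x + J (cyc p (J y) x) =
  2 *: (T (s y p) x - T (s y x) p + s (s p y) x - s (s x y) p + s y (T x p)).
Proof.
move=> cyc; rewrite /cyc !tR_bianchi; apply: tg_ext => q.
rewrite !(tJD, tJN, tTE, tsE, tTJ, tTJl, tsJl, tsJr, tJJ, tTE, tsE, ts_jacobi).
rewrite ?(tgDl, tgNl, tgZl, tJD, tJN, tJJ).
ring.
Qed.

(** Twice the part of the real curvature that is linear in [u] and conjugate
    linear in [v]. *)
Definition tRm u v w := Rb u v w + J (Rb u (J v) w).

Definition cscale (a : R[i]) u := complex.Re a *: u + complex.Im a *: J u.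

Definition herm u v : R[i] := (g u v +i* g u (J v))%C.

Lemma herm_cscalel a u v : herm (cscale a u) v = a * herm u v.
Proof.
rewrite /herm /cscale !tgE !tgJl tJJ tgNr opprK; case: a => a1 a2 /=.
by simpc; congr (_ +i* _)%C; ring.
Qed.
Lemma hermDl u v w : herm (u + v) w = herm u w + herm v w.
Proof. by rewrite /herm !tgE; simpc. Qed.
Lemma herm_conj u v : (herm u v)^* = herm v u.
Proof. by rewrite /herm; congr Complex; rewrite ?(tgC B u v) // -tgJl tgC. Qed.
Lemma hermNl u v : herm (- u) v = - herm u v.
Proof. by rewrite /herm !tgE; simpc. Qed.
Lemma hermDr u v w : herm w (u + v) = herm w u + herm w v.
Proof. by rewrite -!(herm_conj _ w) hermDl rmorphD. Qed.
Lemma hermNr u w : herm w (- u) = - herm w u.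
Proof. by rewrite -!(herm_conj _ w) hermNl rmorphN. Qed.
Lemma hermJl u v : herm (J u) v = 'i%C * herm u v.
Proof. by rewrite -herm_cscalel /cscale /= scale0r add0r scale1r. Qed.
Lemma hermJr u v : herm u (J v) = - 'i%C * herm u v.
Proof. by rewrite -!(herm_conj _ u) hermJl rmorphM; congr (_ * _); simpc. Qed.

Lemma ts_herm u v w : herm (s u v) w = herm v (T u w).
Proof. by rewrite /herm !ts_adj tTJ. Qed.

Lemma tRD3 u v w z : Rb w z (u + v) = Rb w z u + Rb w z v.
Proof. by rewrite -[u in LHS]scale1r tR_lin3 scale1r. Qed.
Lemma tRD1 u v w z : Rb (u + v) w z = Rb u w z + Rb v w z.
Proof. by rewrite -[u in LHS]scale1r tR_lin1 scale1r. Qed.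
Lemma tR01 w z : Rb 0 w z = 0.
Proof. by have := tR_lin1 B (-1) 0 0 w z; rewrite scaler0 addr0 scaleN1r addNr. Qed.
Lemma tRZ1 a u w z : Rb (a *: u) w z = a *: Rb u w z.
Proof. by rewrite -[a *: u]addr0 tR_lin1 tR01 addr0. Qed.
Lemma tRN1 u w z : Rb (- u) w z = - Rb u w z.
Proof. by rewrite -scaleN1r tRZ1 scaleN1r. Qed.
Lemma tRN2 u v w : Rb u (- v) w = - Rb u v w.
Proof. by rewrite tRC tRN1 opprK tRC. Qed.

Lemma tR_Jr u v w : Rb u (J v) w = - Rb (J u) v w.
Proof. by rewrite -[LHS](tR_JJ B u) tJJ tRN2. Qed.

Lemma tRmD1 u u' v w : tRm (u + u') v w = tRm u v w + tRm u' v w.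
Proof. by rewrite /tRm !tRD1 tJD addrACA. Qed.
Lemma tRmJ1 u v w : tRm (J u) v w = J (tRm u v w).
Proof. by rewrite /tRm tR_JJ tJD tJJ tR_Jr opprK addrC. Qed.
Lemma tRmZ1 (a : R) u v w : tRm (a *: u) v w = a *: tRm u v w.
Proof. by rewrite /tRm !tRZ1 tJZ scalerDr. Qed.
Lemma tRm_cscale1 a u v w : tRm (cscale a u) v w = cscale a (tRm u v w).
Proof. by rewrite /cscale tRmD1 !tRmZ1 tRmJ1. Qed.
Lemma tRmD3 u v w w' : tRm u v (w + w') = tRm u v w + tRm u v w'.
Proof. by rewrite /tRm !tRD3 tJD addrACA. Qed.
Lemma tRZ3 a u v w : Rb u v (a *: w) = a *: Rb u v w.
Proof.
have R0 : Rb u v 0 = 0.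
  by have := tR_lin3 B (-1) 0 0 u v; rewrite scaler0 addr0 scaleN1r addNr.
by rewrite -[a *: w]addr0 tR_lin3 R0 addr0.
Qed.
Lemma tRm_cscale3 a u v w : tRm u v (cscale a w) = cscale a (tRm u v w).
Proof.
rewrite /cscale tRmD3 /tRm !tRZ3 !tR_J !tJZ -!scalerDr.
by rewrite -tJD.
Qed.

Lemma tRm_herm u v w z : herm (tRm u v w) z = herm w (tRm v u z).
Proof.
have Rh a b x y : herm (Rb a b x) y = herm x (Rb b a y).
  rewrite /herm; congr Complex; first by rewrite tR_skew tRC tgNr opprK.
  by rewrite -tR_J tR_skew tRC tgNr opprK tR_J.
rewrite /tRm hermDl hermDr hermJl hermJr !Rh.
by rewrite (tR_Jr v u) hermNr mulrNN.
Qed.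

Lemma tRm_der u v w z : tRm u v (T w z) = T (tRm u v w) z + T w (tRm u v z).
Proof.
by rewrite /tRm !tR_der tTDl tTDr tTJl tTJ tJD addrACA.
Qed.

Lemma tT_cscaler a u v : T u (cscale a v) = cscale a (T u v).
Proof. by rewrite /cscale tTDr !tTZr tTJ. Qed.
Lemma tT_cscalel a u v : T (cscale a u) v = cscale a (T u v).
Proof. by rewrite /cscale tTDl !tTZl tTJl. Qed.

Lemma tRm_bianchi p y x q :
  herm (tRm p y x) q - herm (tRm x y p) q =
  2 * (herm (T x p) (T y q) - herm (s y p) (s x q) - herm (s q x) (s p y)
       + herm (s y x) (s p q) + herm (s q p) (s x y)).
Proof.
have -> : herm (tRm p y x) q - herm (tRm x y p) q =
    herm (tRm p y x - tRm x y p) q by rewrite hermDl hermNl.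
have -> : tRm p y x - tRm x y p =
    2 *: (T (s y p) x - T (s y x) p + s (s p y) x - s (s x y) p + s y (T x p)).
  rewrite -bianchi_complex /tRm (tRC B y x) (tRC B (J y) x) !tJD tR_J tJJ tJN.
  by apply: tg_ext => z; rewrite !tgE; ring.
rewrite scaler_nat mulr2n hermDl -mulr2n -[LHS]mulr_natl; congr (_ * _).
rewrite !(hermDl, hermNl) !ts_herm.
have e u v w z : herm (T (s u v) w) z = - herm (s u v) (s w z).
  by rewrite tTC hermNl -(herm_conj z) -ts_herm herm_conj.
by rewrite !e !ts_herm !(tTC B q) !hermNr; ring.
Qed.

Lemma tRm_hsc u :
  herm (tRm u u u) u + 2 * herm (s u u) (s u u) = c%:C%C * herm u u ^+ 2.
Proof.
have Rbuu w : Rb u u w = 0.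
  have /eqP := tRC B u u w; rewrite -addr_eq0 -mulr2n -scaler_nat scaler_eq0.
  by rewrite pnatr_eq0 => /eqP.
have gJ0 v : g v (J v) = 0.
  have := tgJl v v; rewrite tgC => /eqP.
  by rewrite -addr_eq0 -mulr2n -mulr_natl mulf_eq0 pnatr_eq0 => /eqP.
have gR0 : g (Rb u (J u) (J u)) (J u) = 0.
  have := tR_skew B u (J u) (J u) (J u); rewrite [X in _ = - X]tgC => /eqP.
  by rewrite -addr_eq0 -mulr2n -mulr_natl mulf_eq0 pnatr_eq0 => /eqP.
rewrite /tRm Rbuu add0r -tR_J /herm gR0 !gJ0 expr2; simpc.
by rewrite -expr2 -tR_hsc.
Qed.

Section Frame.

Context {n : nat} (F : 'I_n -> V).
Hypothesis F_orth : forall i j, herm (F i) (F j) = (i == j)%:R.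
Hypothesis F_span : forall u, u = \sum_t cscale (herm u (F t)) (F t).

Definition of_coord (z : 'rV[R[i]]_n) : V := \sum_t cscale (z 0 t) (F t).
Definition to_coord u : 'rV[R[i]]_n := \row_t herm u (F t).
Local Notation phi := of_coord.
Local Notation psi := to_coord.

Lemma cscaleD a u v : cscale a (u + v) = cscale a u + cscale a v.
Proof. by rewrite /cscale tJD !scalerDr addrACA. Qed.
Lemma cscale_add a b u : cscale (a + b) u = cscale a u + cscale b u.
Proof. by rewrite /cscale; case: a b => [a1 a2] [b1 b2] /=; rewrite !scalerDl addrACA. Qed.
Lemma cscale_mul a b u : cscale (a * b) u = cscale a (cscale b u).
Proof.
rewrite /cscale; case: a b => [a1 a2] [b1 b2] /=; rewrite tJD !tJZ tJJ !scalerDr !scalerA scalerN.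
rewrite scalerBl scalerDl -!addrA; congr (_ + _).
by rewrite addrC -!addrA; congr (_ + _); rewrite addrC.
Qed.

Lemma of_coord_lin a (z z' : 'rV[R[i]]_n) : phi (a *: z + z') = cscale a (phi z) + phi z'.
Proof.
have cs0 : cscale a 0 = 0 by rewrite /cscale tJ0 !scaler0 addr0.
rewrite /of_coord (big_morph (cscale a) (cscaleD a) cs0) -big_split.
by apply: eq_bigr => t _ /=; rewrite !mxE cscale_add cscale_mul.
Qed.
Lemma to_coord_lin a u v : psi (cscale a u + v) = a *: psi u + psi v.
Proof. by apply/rowP => t; rewrite !mxE hermDl herm_cscalel. Qed.
Lemma of_coordK u : phi (psi u) = u.
Proof. by rewrite [RHS]F_span; apply: eq_bigr => t _; rewrite mxE. Qed.
Lemma herm_suml I (r : seq I) (P : pred I) (G : I -> V) w :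
  herm (\sum_(k <- r | P k) G k) w = \sum_(k <- r | P k) herm (G k) w.
Proof.
apply: (big_morph (herm^~ w)) => [u v|]; first exact: hermDl.
by rewrite /herm !tg0l.
Qed.
Lemma to_coordK (z : 'rV[R[i]]_n) : psi (phi z) = z.
Proof.
apply/rowP => t; rewrite mxE herm_suml (bigD1 t) //= herm_cscalel F_orth eqxx mulr1.
by rewrite big1 ?addr0 // => k /negPf kt; rewrite herm_cscalel F_orth kt mulr0.
Qed.
Lemma dot_to_coord u v : '[psi u, psi v] = herm u v.
Proof.
rewrite [u in RHS]F_span herm_suml dotmxE mxE; apply: eq_bigr => t _.
by rewrite !mxE herm_cscalel -(herm_conj v).
Qed.

Definition mxof (f : V -> V) : 'M[R[i]]_n := \matrix_i psi (f (phi (delta_mx 0 i))).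

Lemma mxofE f u : (forall v w, f (v + w) = f v + f w) ->
  (forall a v, f (cscale a v) = cscale a (f v)) -> psi u *m mxof f = psi (f u).
Proof.
move=> fD fc; have f0 : f 0 = 0 by apply: (@addrI _ (f 0)); rewrite -fD !addr0.
have cs0 v : cscale 0 v = 0 by rewrite /cscale !scale0r addr0.
rewrite mulmx_sum_row [u in RHS]F_span.
rewrite (big_morph f fD f0).
have psiD v w : psi (v + w) = psi v + psi w.
  by apply/rowP => t; rewrite !mxE hermDl.
have psi0 : psi 0 = 0 by apply/rowP => t; rewrite !mxE /herm !tg0l.
rewrite (big_morph psi psiD psi0); apply: eq_bigr => t _.
rewrite rowK mxE fc -[cscale _ (f _)]addr0 to_coord_lin psi0 addr0; congr (_ *: psi (f _)).
rewrite /of_coord (bigD1 t) //= mxE !eqxx big1 ?addr0 => [|k /negPf kt].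
  by rewrite /cscale scale0r addr0 scale1r.
by rewrite mxE eqxx kt /= cs0.
Qed.

Definition adC (z : 'rV[R[i]]_n) := mxof (T (phi z)).
Definition RmC (z w : 'rV[R[i]]_n) := mxof (tRm (phi z) (phi w)).

Lemma adCE (z : 'rV[R[i]]_n) u : psi u *m adC z = psi (T (phi z) u).
Proof.
by rewrite mxofE // => [v w|a v]; [exact: tTDr|exact: tT_cscaler].
Qed.
Lemma RmCE (z w : 'rV[R[i]]_n) u : psi u *m RmC z w = psi (tRm (phi z) (phi w) u).
Proof.
by rewrite mxofE // => [v x|a v]; [exact: tRmD3|exact: tRm_cscale3].
Qed.

Lemma mx_ext (A A' : 'M[R[i]]_n) : (forall u, psi u *m A = psi u *m A') -> A = A'.
Proof. by move=> AA; apply/row_matrixP => i; rewrite !rowE -[delta_mx _ _]to_coordK AA. Qed.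

Lemma adC_adj (z : 'rV[R[i]]_n) u : psi u *m (adC z)^t* = psi (s (phi z) u).
Proof.
apply: dot_ext => w; rewrite -[w]to_coordK -dot_adjr adCE !dot_to_coord.
by rewrite ts_herm.
Qed.

Lemma psiN u : psi (- u) = - psi u.
Proof. by apply/rowP => t; rewrite !mxE hermNl. Qed.
Lemma psiD u v : psi (u + v) = psi u + psi v.
Proof. by apply/rowP => t; rewrite !mxE hermDl. Qed.

Lemma bismutPoint_of_torsionData :
  exists B' : bismutPoint n (c%:C%C : R[i]), ad B' = adC.
Proof.
unshelve refine (ex_intro _ (@BismutPoint _ n _ adC RmC _ _ _ _ _ _ _ _ _) erefl).
- move=> a x y; apply: mx_ext => u.
  rewrite mulmxDr -scalemxAr !adCE of_coord_lin tTDl tT_cscalel.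
  by rewrite to_coord_lin.
- move=> x y; rewrite -[y in LHS]to_coordK -[x in RHS]to_coordK !adCE.
  by rewrite tTC psiN.
- move=> x y; apply: mx_ext => u.
  rewrite mulmxBr !mulmxA !adCE -psiN -psiD; congr psi.
  rewrite -[y in y *m _]to_coordK adCE of_coordK.
  have := tT_jacobi B (phi x) (phi y) u.
  rewrite (tTC B u (phi x)) (tTC B u (T _ _)) tTNr => /eqP.
  by rewrite subr_eq0 => /eqP.
- move=> a x y z; apply: mx_ext => u.
  by rewrite mulmxDr -scalemxAr !RmCE of_coord_lin tRmD1 tRm_cscale1 to_coord_lin.
- move=> x y; apply: mx_ext => u; apply: dot_ext => w; rewrite -[w]to_coordK.
  by rewrite -dot_adjr !RmCE !dot_to_coord tRm_herm.
- move=> x y p; apply: mx_ext => u.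
  rewrite mulmxBr !mulmxA !adCE !RmCE adCE -psiN -psiD; congr psi.
  by rewrite -[p in p *m _]to_coordK RmCE of_coordK tRm_der addrK.
- move=> x y p q; move: (phi x) (to_coordK x) (phi y) (to_coordK y) => X <- Y <-.
  move: (phi p) (to_coordK p) (phi q) (to_coordK q) => P <- Q <-.
  by rewrite !(RmCE, adCE, adC_adj) !of_coordK !dot_to_coord tRm_bianchi.
- move=> x; move: (phi x) (to_coordK x) => X <-.
  by rewrite !(RmCE, adC_adj) !of_coordK !dot_to_coord tRm_hsc.
- by congr Complex; rewrite oppr0.
Qed.

(** In unitary coordinates the data become a [bismutPoint], whose bracket is zero. *)
Lemma torsionData_eq0 : c != 0 -> forall u v, T u v = 0.
Proof.
move=> c0 u v; have [B' adB'] := bismutPoint_of_torsionData.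
have cC : (c%:C%C : R[i]) != 0 by rewrite eq_complex /= negb_and c0.
have := bismut_abelian B' cC (psi u) (psi v).
rewrite /bracket adB' adCE of_coordK => e; rewrite -[LHS]of_coordK e.
by rewrite /of_coord big1 // => t _; rewrite mxE /cscale !scale0r addr0.
Qed.

End Frame.
End TorsionData.

(** * Unitary frames *)

Section UnitaryFrame.
Context {R : rcfType} {n : nat} {c : R}.
Local Notation V := 'rV[R]_(n + n).
Local Notation C := R[i].
Context (B : torsionData V c).
Hypothesis tJE : forall u : V, tJ B u = u *m block_mx 0 1%:M (- 1%:M) 0.
Implicit Types (u v w : V) (x y : 'rV[C]_n).
Local Notation cs := (cscale B).
Local Notation h := (herm B).

Definition realify x : V :=
  row_mx (map_mx (@complex.Re R) x) (map_mx (@complex.Im R) x).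
Definition complexify u : 'rV[C]_n :=
  \row_a (u 0 (lshift n a) +i* u 0 (rshift n a))%C.

Lemma complexifyK u : realify (complexify u) = u.
Proof.
rewrite -[RHS]hsubmxK; congr row_mx; apply/rowP => a; by rewrite !mxE.
Qed.

Lemma realify_lin a x y : realify (a *: x + y) = cs a (realify x) + realify y.
Proof.
rewrite /cscale tJE /realify mul_row_block !mulmx0 mulmxN !mulmx1 add0r addr0.
rewrite !scale_row_mx !add_row_mx; congr row_mx; apply/rowP => i; rewrite !mxE /=;
  case: a (x 0 i) (y 0 i) => [a1 a2] [x1 x2] [y1 y2] /=; ring.
Qed.

Lemma realify0 : realify 0 = 0.
Proof. by rewrite -[0 in RHS]complexifyK; congr realify; apply/rowP => i; rewrite !mxE. Qed.

Lemma realify_eq0 x : realify x = 0 -> x = 0.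
Proof.
move=> e; apply/rowP => i; have := congr1 (fun u : V => (u 0 (lshift n i) +i* u 0 (rshift n i))%C) e.
by rewrite /= row_mxEl row_mxEr !mxE; case: (x 0 i).
Qed.

Let realifyD x y : realify (x + y) = realify x + realify y.
Proof. by rewrite -[x in LHS]scale1r realify_lin /cscale scale1r scale0r addr0. Qed.
Let realifyZ a x : realify (a *: x) = cs a (realify x).
Proof. by rewrite -[_ *: _]addr0 realify_lin realify0 addr0. Qed.

Definition gram : 'M[C]_n :=
  \matrix_(a, b) h (realify (delta_mx 0 a)) (realify (delta_mx 0 b)).

Lemma gramE x y : h (realify x) (realify y) = (x *m gram *m y^t*) 0 0.
Proof.
have exp x' w : h (realify x') w = \sum_a x' 0 a * h (realify (delta_mx 0 a)) w.
  rewrite [x' in LHS]row_sum_delta (big_morph realify realifyD realify0) herm_suml.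
  by apply: eq_bigr => a _; rewrite realifyZ herm_cscalel.
have expr w y' : h w (realify y') = \sum_b (y' 0 b)^* * h w (realify (delta_mx 0 b)).
  rewrite -herm_conj exp rmorph_sum; apply: eq_bigr => b _.
  by rewrite rmorphM /= herm_conj.
rewrite expr mxE; apply: eq_bigr => b _; rewrite exp !mxE mulrC; congr (_ * _).
by apply: eq_bigr => a _; rewrite mxE.
Qed.

Lemma gram_herm : gram \is hermsymmx.
Proof.
apply/is_hermitianmxP; rewrite expr0 scale1r; apply/matrixP => a b.
by rewrite !mxE herm_conj.
Qed.

Lemma herm_gt0 u : u != 0 -> 0 < h u u.
Proof.
move=> u0; have gJ0 : tg B u (tJ B u) = 0.
  have := tgJl B u u; rewrite tgC => /eqP.
  by rewrite -addr_eq0 -mulr2n -mulr_natl mulf_eq0 pnatr_eq0 => /eqP.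
by rewrite /herm gJ0 ltcE /= eqxx (tg_gt0 B).
Qed.

(** The frame comes from the spectral decomposition of the Gram matrix of the
    coordinate frame. *)
Lemma unitary_frame_exists : exists F : 'I_n -> V,
  (forall i j, h (F i) (F j) = (i == j)%:R) /\
  (forall u, u = \sum_t cs (h u (F t)) (F t)).
Proof.
have row_entry (A M : 'M[C]_n) i j :
    (row i A *m M *m (row j A)^t*) 0 0 = (A *m M *m A^t*) i j.
  by rewrite -row_mul mxE [RHS]mxE; apply: eq_bigr => k _; rewrite !mxE.
pose P := spectralmx gram; pose d := spectral_diag gram.
have Pu : P \is unitarymx by exact: spectral_unitarymx.
have gE : P *m gram *m P^t* = diag_mx d.
  have /hermitian_normalmx/orthomx_spectralP e := gram_herm.
  rewrite {1}e -/P -/d -invmx_unitary // !mulmxA mulmxV ?unitarymx_unit // mul1mx.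
  by rewrite -mulmxA mulmxV ?unitarymx_unit // mulmx1.
have d_gt0 i : 0 < d 0 i.
  have -> : d 0 i = h (realify (row i P)) (realify (row i P)).
    by rewrite gramE row_entry gE mxE eqxx mulr1n.
  apply: herm_gt0; apply/eqP => /realify_eq0 r0.
  have /row_unitarymxP/(_ i i) := Pu; rewrite r0 eqxx dot0l => /esym/eqP.
  by rewrite oner_eq0.
pose e : 'rV[C]_n := \row_i (sqrtC (d 0 i))^-1.
pose Q := diag_mx e *m P.
have QQ : Q *m (gram *m Q^t*) = 1%:M.
  rewrite /Q trmx_mul map_mxM tr_diag_mx map_diag_mx.
  transitivity (diag_mx e *m (P *m gram *m P^t*) *m diag_mx (map_mx Num.conj e)).
    by rewrite !mulmxA.
  rewrite gE !mulmx_diag; apply/matrixP => i j; rewrite !mxE.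
  have [->|//] := eqVneq i j; rewrite !mulr1n.
  have s0 : 0 < sqrtC (d 0 j) by rewrite sqrtC_gt0.
  rewrite conj_Creal ?rpredV ?gtr0_real // mulrAC -invfM -expr2 sqrtCK.
  by rewrite mulVf // gt_eqF.
exists (fun i => realify (row i Q)); split=> [i j|u].
  rewrite gramE; by rewrite row_entry -mulmxA QQ mxE.
rewrite -[u in LHS]complexifyK; set x := complexify u.
have hx t : h u (realify (row t Q)) = (x *m gram *m Q^t*) 0 t.
  rewrite -[u]complexifyK gramE mxE [RHS]mxE; apply: eq_bigr => k _.
  by rewrite !mxE.
under eq_bigr do rewrite hx -realifyZ.
rewrite -(big_morph realify realifyD realify0); congr realify.
rewrite -mulmx_sum_row -!mulmxA.
by have := mulmx1C QQ; rewrite -mulmxA => ->; rewrite mulmx1.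
Qed.

End UnitaryFrame.

(** * Symmetry of second derivatives *)

Local Open Scope classical_set_scope.
Local Open Scope ring_scope.

Section Schwarz.
Context {R : realType} {V : normedModType R}.
Implicit Types (f F : V -> R) (x u v k : V) (U : set V).

Lemma differentiable_eps F x (e : R) : differentiable F x -> 0 < e ->
  exists2 d : R, 0 < d &
    forall k, `|k| < d -> `|F (k + x) - F x - 'd F x k| <= e * `|k|.
Proof.
move=> dF e0; have [_ oF] := (diff_locallyP x F).1 dF.
have /nbhs_normP[d /= d0 dP] := (eqaddoP _ _ _ _).1 oF _ e0.
exists d => // k kd; have := dP k; rewrite /ball_ /= sub0r normrN => /(_ kd).
by rewrite /= opprD addrA.
Qed.

Lemma derive_line f x u (s : R) : derivable f (s *: u + x) u ->
  is_derive s (1 : R) (fun t : R => f (t *: u + x)) ('D_u f (s *: u + x)).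
Proof.
move=> df.
have e : (fun h : R => h^-1 *: ((f \o shift (s *: u + x)) (h *: u) - f (s *: u + x)))
  = (fun h : R => h^-1 *: (((fun t : R => f (t *: u + x)) \o shift s) (h *: (1 : R))
      - (fun t : R => f (t *: u + x)) s)).
  by apply/funext => h /=; rewrite [h *: 1]mulr1 scalerDl addrA.
by split; [rewrite /derivable -e|rewrite /derive -e].
Qed.

Definition second_difference f x u v (h : R) :=
  f (h *: u + (h *: v + x)) - f (h *: u + x) - (f (h *: v + x) - f x).

Lemma second_differenceC f x u v h :
  second_difference f x u v h = second_difference f x v u h.
Proof.
by rewrite /second_difference [h *: u + (_ + _)]addrCA; ring.
Qed.

(** The mean value theorem in the direction [u], applied to the increment of [f]
    in the direction [v]; only differentiability of ['D_u f] at [x] matters. *)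
Lemma second_difference_eps f x u v U (e : R) : open U -> U x ->
  (forall y, U y -> differentiable f y) -> differentiable ('D_u f) x -> 0 < e ->
  exists2 d : R, 0 < d & forall h : R, 0 < h < d ->
    `|second_difference f x u v h - h ^+ 2 * 'D_v ('D_u f) x|
    <= e * h ^+ 2.
Proof.
move=> Uo Ux df dF e0.
pose K : R := 1 + (2 * `|u| + `|v|).
have K0 : 0 < K by rewrite /K; have := normr_ge0 u; have := normr_ge0 v; lra.
have [d d0 dP] := differentiable_eps dF (divr_gt0 e0 K0).
have /nbhs_normP[r /= r0 rU] : nbhs x U by exact: open_nbhs_nbhs.
have inU k : `|k| < r -> U (k + x).
  by move=> kr; apply: rU; rewrite /ball_ /= opprD addrCA subrr addr0 normrN.
exists (Num.min d r / K); first by rewrite divr_gt0 // lt_min d0 r0.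
move=> h /andP[h0]; rewrite ltr_pdivlMr // lt_min => /andP[hd hr].
pose phi (s : R) := f (s *: u + (h *: v + x)) - f (s *: u + x).
pose dphi (s : R) := 'D_u f (s *: u + (h *: v + x)) - 'D_u f (s *: u + x).
have small (s t : R) : 0 <= s <= h -> 0 <= t <= h -> `|s *: u + t *: v| <= h * (`|u| + `|v|).
  move=> /andP[s0 sh] /andP[t0 th]; apply: le_trans (ler_normD _ _) _.
  by rewrite !normrZ !ger0_norm // mulrDr lerD // ler_wpM2r.
have hK k : `|k| <= h * (`|u| + `|v|) -> `|k| < d /\ `|k| < r.
  move=> kh; have kK : `|k| <= h * K.
    apply: le_trans kh _; rewrite ler_wpM2l ?(ltW h0) // /K.
    have := normr_ge0 u; have := normr_ge0 v; lra.
  by split; [exact: le_lt_trans kK hd|exact: le_lt_trans kK hr].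
have dphiP (s : R) : 0 <= s <= h -> is_derive s (1 : R) phi (dphi s).
  move=> sh; apply: is_deriveB; apply: derive_line; apply: diff_derivable; apply: df.
    by rewrite addrA; apply/inU/(hK _ _).2/small; rewrite ?lexx ?(ltW h0).
  apply/inU/(hK _ _).2; have := small s 0 sh; rewrite scale0r addr0; apply.
  by rewrite lexx ltW.
have [||s] := @MVT R phi dphi 0 h h0.
- by move=> s; rewrite in_itv /= => /andP[s0 sh]; apply: dphiP; rewrite !ltW.
- apply: derivable_within_continuous => s; rewrite in_itv /= => sh.
  by have := dphiP s sh; case.
rewrite in_itv /= => /andP[s0 sh] e1.
have -> : second_difference f x u v h = dphi s * h.
  by rewrite -[in RHS](subr0 h) -e1 /phi /second_difference !scale0r !add0r.
have sh' : 0 <= s <= h by rewrite !ltW.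
have hh : 0 <= h <= h by rewrite (ltW h0) /=.
have z0 : 0 <= (0 : R) <= h by rewrite (ltW h0) lexx.
have k1 := small s h sh' hh; have k2 := small s 0 sh' z0.
rewrite scale0r addr0 in k2.
have E1 := dP _ (hK _ k1).1; have E2 := dP _ (hK _ k2).1.
rewrite (deriveE _ dF) /dphi addrA.
move: E1 E2; set L := 'd _ _ => E1 E2.
have Ls : L (s *: u) = s * L u by rewrite linearZ.
have Lsh : L (s *: u + h *: v) = s * L u + h * L v by rewrite linearD !linearZ.
rewrite Ls in E2; rewrite Lsh in E1.
move: E1 E2; set A := 'D_u f _; set D0 := 'D_u f x; set A' := 'D_u f _ => E1 E2.
have -> : (A - A') * h - h ^+ 2 * L v
    = ((A - D0 - (s * L u + h * L v)) - (A' - D0 - s * L u)) * h by ring.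
rewrite normrM (gtr0_norm h0) expr2 mulrA ler_wpM2r ?(ltW h0) //.
apply: le_trans (ler_normB _ _) _; apply: le_trans (lerD E1 E2) _.
rewrite -mulrDr [e / K * _]mulrAC ler_pdivrMr // -mulrA ler_wpM2l ?(ltW e0) //.
have k3 : `|s *: u| <= h * `|u|.
  by rewrite normrZ (gtr0_norm s0) ler_wpM2r // ltW.
by apply: le_trans (lerD k1 k3) _; rewrite -mulrDr ler_wpM2l ?(ltW h0) // /K; lra.
Qed.

(** Both sides are limits of the same second difference quotient. *)
Theorem derive_comm f x u v U : open U -> U x ->
  (forall y, U y -> differentiable f y) ->
  differentiable ('D_u f) x -> differentiable ('D_v f) x ->
  'D_v ('D_u f) x = 'D_u ('D_v f) x.
Proof.
move=> Uo Ux df du dv; apply/eqP; rewrite -subr_eq0 -normr_le0.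
apply/ler_addgt0Pl => e e0; rewrite addr0.
have e20 : 0 < e / 2 by lra.
have [d1 d10 P1] := second_difference_eps v Uo Ux df du e20.
have [d2 d20 P2] := second_difference_eps u Uo Ux df dv e20.
pose h := Num.min d1 d2 / 2.
have m0 : 0 < Num.min d1 d2 by rewrite lt_min d10.
have h0 : 0 < h by rewrite divr_gt0.
have hm : h < Num.min d1 d2 by rewrite /h; lra.
have [hd1 hd2] : h < d1 /\ h < d2 by move: hm; rewrite lt_min => /andP.
have := P1 h; have := P2 h; rewrite h0 hd1 hd2 second_differenceC => /(_ isT) E1 /(_ isT) E2.
have h2 : 0 < h ^+ 2 by rewrite exprn_gt0.
rewrite -(ler_pM2r h2) -[X in _ * X](gtr0_norm h2) -normrM.
set a := 'D_v _ _ in E1 E2 *; set b := 'D_u _ _ in E1 E2 *.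
set s := second_difference _ _ _ _ _ in E1 E2.
have -> : (a - b) * h ^+ 2 = (s - h ^+ 2 * b) - (s - h ^+ 2 * a) by ring.
apply: le_trans (ler_normB _ _) _; apply: le_trans (lerD E1 E2) _.
by rewrite -mulrDl -splitr.
Qed.

End Schwarz.

(** * Tensors in coordinates *)

Section Tensors.
Context {R : realType} {n : nat}.
Local Notation V := (cspace R n).
Local Notation idx := 'I_(n + n).
Implicit Types (u v w z : V) (t : idx -> idx -> idx -> R).

(** [symbols_val] for the symbols at one point, so that it also applies to their
    derivatives. *)
Definition bil t u v : V := \row_c \sum_a \sum_b u 0 a * v 0 b * t a b c.

Lemma bilDl t u u' v : bil t (u + u') v = bil t u v + bil t u' v.
Proof.
apply/rowP => c; rewrite !mxE -big_split; apply: eq_bigr => a _ /=.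
by rewrite -big_split; apply: eq_bigr => b _ /=; rewrite mxE !mulrDl.
Qed.
Lemma bilDr t u v v' : bil t u (v + v') = bil t u v + bil t u v'.
Proof.
apply/rowP => c; rewrite !mxE -big_split; apply: eq_bigr => a _ /=.
by rewrite -big_split; apply: eq_bigr => b _ /=; rewrite mxE mulrDr mulrDl.
Qed.
Lemma bilZl t (k : R) u v : bil t (k *: u) v = k *: bil t u v.
Proof.
apply/rowP => c; rewrite !mxE big_distrr; apply: eq_bigr => a _ /=.
by rewrite big_distrr; apply: eq_bigr => b _ /=; rewrite mxE !mulrA.
Qed.
Lemma bilZr t (k : R) u v : bil t u (k *: v) = k *: bil t u v.
Proof.
apply/rowP => c; rewrite !mxE big_distrr; apply: eq_bigr => a _ /=.
by rewrite big_distrr; apply: eq_bigr => b _ /=; rewrite mxE !mulrA (mulrC (u 0 a)).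
Qed.
Lemma bilNl t u v : bil t (- u) v = - bil t u v.
Proof. by rewrite -scaleN1r bilZl scaleN1r. Qed.
Lemma bilNr t u v : bil t u (- v) = - bil t u v.
Proof. by rewrite -scaleN1r bilZr scaleN1r. Qed.
Lemma bil_frame t a b : bil t (frame a) (frame b) = \row_c t a b c.
Proof.
apply/rowP => c; rewrite !mxE (bigD1 a) //= [X in _ + X]big1 ?addr0; last first.
  by move=> i /negPf ia; rewrite big1 // => j _; rewrite !mxE eqxx ia !mul0r.
rewrite (bigD1 b) //= big1 ?addr0 => [|j /negPf jb]; rewrite !mxE !eqxx ?jb ?mulr0 ?mul0r //.
by rewrite !mul1r.
Qed.

Lemma bil0l t v : bil t 0 v = 0.
Proof. by have := bilZl t 0 0 v; rewrite !scale0r. Qed.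
Lemma bil0r t u : bil t u 0 = 0.
Proof. by have := bilZr t 0 u 0; rewrite !scale0r. Qed.

Definition bilE := (bilDl, bilDr, bilZl, bilZr, bilNl, bilNr).

Lemma bilBt t t' u v :
  bil (fun a b c => t a b c - t' a b c) u v = bil t u v - bil t' u v.
Proof.
apply/rowP => c; rewrite !mxE -sumrB; apply: eq_bigr => a _.
by rewrite -sumrB; apply: eq_bigr => b _; rewrite mulrBr.
Qed.
Lemma bil_swap t u v : bil (fun a b c => t b a c) u v = bil t v u.
Proof.
apply/rowP => c; rewrite !mxE exchange_big; apply: eq_bigr => b _.
by apply: eq_bigr => a _; rewrite (mulrC (u 0 a)).
Qed.

(** [metric_val] for the matrix at one point. *)
Definition gb (m : 'M[R]_(n + n)) u v : R := (u *m m *m v^T) 0 0.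

Lemma gbE m u v : gb m u v = \sum_a \sum_b u 0 a * v 0 b * m a b.
Proof.
rewrite /gb mxE exchange_big; apply: eq_bigr => b _.
rewrite mxE mxE big_distrl; apply: eq_bigr => a _ /=.
by rewrite mulrAC.
Qed.
Lemma gbDl m u u' v : gb m (u + u') v = gb m u v + gb m u' v.
Proof. by rewrite /gb !mulmxDl mxE. Qed.
Lemma gbDr m u v v' : gb m u (v + v') = gb m u v + gb m u v'.
Proof. by rewrite /gb linearD mulmxDr mxE. Qed.
Lemma gbZl m (k : R) u v : gb m (k *: u) v = k * gb m u v.
Proof. by rewrite /gb -!scalemxAl mxE. Qed.
Lemma gbZr m (k : R) u v : gb m u (k *: v) = k * gb m u v.
Proof. by rewrite /gb linearZ /= -scalemxAr mxE. Qed.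
Lemma gbNl m u v : gb m (- u) v = - gb m u v.
Proof. by rewrite -scaleN1r gbZl mulN1r. Qed.
Lemma gbNr m u v : gb m u (- v) = - gb m u v.
Proof. by rewrite -scaleN1r gbZr mulN1r. Qed.
Lemma gb0l m v : gb m 0 v = 0.
Proof. by have := gbZl m 0 0 v; rewrite scale0r mul0r. Qed.
Lemma gb0r m u : gb m u 0 = 0.
Proof. by have := gbZr m 0 u 0; rewrite scale0r mul0r. Qed.

Definition gblE := (gbDl, gbDr, gbZl, gbZr, gbNl, gbNr).

Lemma frame_sum u : u = \sum_a u 0 a *: frame a.
Proof. exact: row_sum_delta. Qed.

Section Derivatives.
Variables (x w : V).

Definition vderiv (p : V -> V) (dp : V) :=
  forall c, is_derive x w (fun y => p y 0 c) (dp 0 c).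
Definition tderiv (S : symbols R n) (dS : idx -> idx -> idx -> R) :=
  forall a b c, is_derive x w (fun y => S y a b c) (dS a b c).

Lemma is_derive_sum_fun (I : finType) (f : I -> V -> R) (df : I -> R) :
  (forall i, is_derive x w (f i) (df i)) ->
  is_derive x w (fun y => \sum_i f i y) (\sum_i df i).
Proof.
move=> fP; rewrite (_ : (fun y => _) = \sum_i f i); last first.
  by apply/funext => y; rewrite fct_sumE.
elim/big_ind2: _ => //.
- exact: is_derive_cst.
- by move=> f1 d1 f2 d2 h1 h2; exact: is_deriveD.
Qed.

Lemma vderiv_cst v : vderiv (fun=> v) 0.
Proof. by move=> c; rewrite mxE; exact: is_derive_cst. Qed.

Lemma is_derive_mul (f f' : V -> R) (d d' : R) :
  is_derive x w f d -> is_derive x w f' d' ->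
  is_derive x w (fun y => f y * f' y) (d * f' x + f x * d').
Proof.
move=> h h'; apply: (is_derive_eq (is_deriveM h h')).
by rewrite addrC mulrC.
Qed.

Lemma vderiv_bil S dS p dp q dq : tderiv S dS -> vderiv p dp -> vderiv q dq ->
  vderiv (fun y => bil (S y) (p y) (q y))
         (bil dS (p x) (q x) + bil (S x) dp (q x) + bil (S x) (p x) dq).
Proof.
move=> hS hp hq c.
rewrite (_ : (fun y => _) = (fun y => \sum_a \sum_b p y 0 a * q y 0 b * S y a b c)); last first.
  by apply/funext => y; rewrite mxE.
apply: (is_derive_eq (f' := \sum_a \sum_b ((dp 0 a * q x 0 b + p x 0 a * dq 0 b) * S x a b c
   + p x 0 a * q x 0 b * dS a b c))).
  apply: is_derive_sum_fun => a; apply: is_derive_sum_fun => b.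
  by apply: is_derive_mul => //; apply: is_derive_mul.
rewrite !mxE -!big_split; apply: eq_bigr => a _ /=.
by rewrite -!big_split; apply: eq_bigr => b _ /=; ring.
Qed.

Lemma vderiv_bill S dS p dp v : tderiv S dS -> vderiv p dp ->
  vderiv (fun y => bil (S y) (p y) v) (bil dS (p x) v + bil (S x) dp v).
Proof.
by move=> hS hp; have := vderiv_bil hS hp (vderiv_cst v); rewrite bil0r addr0.
Qed.
Lemma vderiv_bilr S dS u q dq : tderiv S dS -> vderiv q dq ->
  vderiv (fun y => bil (S y) u (q y)) (bil dS u (q x) + bil (S x) u dq).
Proof.
by move=> hS hq; have := vderiv_bil hS (vderiv_cst u) hq; rewrite bil0l addr0.
Qed.
Lemma vderiv_bil_cst S dS u v : tderiv S dS ->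
  vderiv (fun y => bil (S y) u v) (bil dS u v).
Proof.
by move=> hS; have := vderiv_bill v hS (vderiv_cst u); rewrite bil0l addr0.
Qed.

Lemma is_derive_gb (m : V -> 'M[R]_(n + n)) (dm : 'M[R]_(n + n)) p dp q dq :
  (forall a b, is_derive x w (fun y => m y a b) (dm a b : R)) ->
  vderiv p dp -> vderiv q dq ->
  is_derive x w (fun y => gb (m y) (p y) (q y))
         (gb dm (p x) (q x) + gb (m x) dp (q x) + gb (m x) (p x) dq).
Proof.
move=> hm hp hq.
rewrite (_ : (fun y => _) = (fun y => \sum_a \sum_b p y 0 a * q y 0 b * m y a b)); last first.
  by apply/funext => y; rewrite gbE.
apply: (is_derive_eq (f' := \sum_a \sum_b ((dp 0 a * q x 0 b + p x 0 a * dq 0 b) * m x a b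
   + p x 0 a * q x 0 b * dm a b))).
  apply: is_derive_sum_fun => a; apply: is_derive_sum_fun => b.
  by apply: is_derive_mul => //; apply: is_derive_mul.
rewrite !gbE -!big_split; apply: eq_bigr => a _ /=.
by rewrite -!big_split; apply: eq_bigr => b _ /=; ring.
Qed.

Lemma vderivD p dp q dq : vderiv p dp -> vderiv q dq ->
  vderiv (fun y => p y + q y) (dp + dq).
Proof.
move=> hp hq c; rewrite mxE (_ : (fun y => _) = (fun y => p y 0 c) + (fun y => q y 0 c)).
  exact: is_deriveD.
by apply/funext => y; rewrite mxE.
Qed.
Lemma vderivN p dp : vderiv p dp -> vderiv (fun y => - p y) (- dp).
Proof.
move=> hp c; rewrite mxE (_ : (fun y => _) = - (fun y => p y 0 c)).
  exact: is_deriveN.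
by apply/funext => y; rewrite mxE.
Qed.

End Derivatives.

Lemma is_derive_near x w (U : set V) (f f' : V -> R) d d' : open U -> U x ->
  (forall y, U y -> f y = f' y) ->
  is_derive x w f d -> is_derive x w f' d' -> d = d'.
Proof.
move=> Uo Ux ff' hd hd'; have [_ <-] := hd; have [_ <-] := hd'.
apply: near_eq_derive.
have : nbhs x U by exact: open_nbhs_nbhs.
by apply: filterS => y Uy; exact: ff'.
Qed.

Lemma vderiv_near x w (U : set V) p p' dp dp' : open U -> U x ->
  (forall y, U y -> p y = p' y) -> vderiv x w p dp -> vderiv x w p' dp' -> dp = dp'.
Proof.
move=> Uo Ux pp' hp hp'; apply/rowP => c.
by apply: (is_derive_near Uo Ux _ (hp c) (hp' c)) => y Uy; rewrite pp'.
Qed.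

Lemma differentiable_is_derive (f : V -> R) x w :
  differentiable f x -> is_derive x w f ('D_w f x).
Proof. by move=> df; apply/derivableP/diff_derivable. Qed.

End Tensors.

(* Generalizing the entries first keeps [ring] from unfolding them when it
   compares atoms. *)
Ltac ring_entries :=
  repeat match goal with
  | |- context [fun_of_matrix ?m ?a ?b] => generalize (fun_of_matrix m a b); intro
  end; ring.
Ltac ring_gb :=
  repeat match goal with
  | |- context [gb ?m ?u ?v] => generalize (gb m u v); intro
  end; ring.

Section Entries.
Context {R : realType} {m : nat}.
Lemma vecD (u v : 'rV[R]_m) k : (u + v) 0 k = u 0 k + v 0 k. Proof. by rewrite mxE. Qed.
Lemma vecN (u : 'rV[R]_m) k : (- u) 0 k = - u 0 k. Proof. by rewrite mxE. Qed.
Lemma vecZ (a : R) (u : 'rV[R]_m) k : (a *: u) 0 k = a * u 0 k. Proof. by rewrite mxE. Qed.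
Lemma vec0 k : (0 : 'rV[R]_m) 0 k = 0. Proof. by rewrite mxE. Qed.
(* Module identities are checked on entries, without unfolding [bil]. *)
Definition vecE := (vecD, vecN, vecZ, vec0).
End Entries.

Section Trilinear.
Context {R : realType} {n : nat}.
Local Notation V := (cspace R n).
Local Notation idx := 'I_(n + n).
Implicit Types (u v w z : V).

Definition tri (t : idx -> idx -> idx -> idx -> R) u v w : V :=
  \row_d \sum_a \sum_b \sum_c u 0 a * v 0 b * w 0 c * t a b c d.

Lemma tri_ext (f : V -> V -> V -> V) t :
  (forall (k : R) u u' v w, f (k *: u + u') v w = k *: f u v w + f u' v w) ->
  (forall (k : R) u v v' w, f u (k *: v + v') w = k *: f u v w + f u v' w) ->
  (forall (k : R) u v w w', f u v (k *: w + w') = k *: f u v w + f u v w') ->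
  (forall a b c, f (frame a) (frame b) (frame c) = \row_d t a b c d) ->
  forall u v w, f u v w = tri t u v w.
Proof.
move=> f1 f2 f3 ft u v w.
have lin (h : V -> V) : (forall (k : R) x y, h (k *: x + y) = k *: h x + h y) ->
    forall x, h x = \sum_a x 0 a *: h (frame a).
  move=> hl x; have h0 : h 0 = 0.
    by have := hl (-1) 0 0; rewrite scaler0 addr0 scaleN1r addNr.
  have hD y z : h (y + z) = h y + h z by rewrite -[y in LHS]scale1r hl scale1r.
  rewrite {1}[x]frame_sum (big_morph h hD h0); apply: eq_bigr => a _.
  by rewrite -[_ *: frame a]addr0 hl h0 addr0.
rewrite (lin (fun x => f x v w)) => [|k x y]; last exact: f1.
apply/rowP => d; rewrite mxE summxE; apply: eq_bigr => a _.
rewrite mxE (lin (f (frame a)^~ w)) => [|k x y]; last exact: f2.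
rewrite summxE big_distrr; apply: eq_bigr => b _ /=.
rewrite mxE (lin (f (frame a) (frame b))) => [|k x y]; last exact: f3.
rewrite summxE !big_distrr; apply: eq_bigr => c _ /=.
by rewrite ft !mxE !mulrA.
Qed.

Lemma bil_framel t a v : bil t (frame a) v = \row_c \sum_b v 0 b * t a b c.
Proof.
apply/rowP => c; rewrite !mxE (bigD1 a) //= [X in _ + X]big1 ?addr0; last first.
  by move=> i /negPf ia; rewrite big1 // => j _; rewrite !mxE eqxx ia !mul0r.
by apply: eq_bigr => b _; rewrite !mxE !eqxx mul1r.
Qed.
Lemma bil_framer t b u : bil t u (frame b) = \row_c \sum_a u 0 a * t a b c.
Proof.
by rewrite -bil_swap bil_framel.
Qed.

Variables (U : set V).
Hypothesis Uo : open U.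

Definition smooth_symbols (G : symbols R n) :=
  forall a b c, smooth_on U (fun y => G y a b c : R).

Definition dsym (G : symbols R n) (x w : V) a b c : R :=
  'D_w (fun y => G y a b c) x.

Lemma smooth_derive (f : V -> R) w : smooth_on U f -> smooth_on U ('D_w f).
Proof.
move=> fs vs x Ux; have := fs (rcons vs w) x Ux.
by rewrite foldr_rcons.
Qed.

Lemma smooth_differentiable (f : V -> R) x : smooth_on U f -> U x -> differentiable f x.
Proof. by move=> fs Ux; have := fs [::] x Ux. Qed.

Lemma smooth_tderiv G x w : smooth_symbols G -> U x -> tderiv x w G (dsym G x w).
Proof.
move=> Gs Ux a b c; apply: differentiable_is_derive.
exact: smooth_differentiable (Gs a b c) Ux.
Qed.

Lemma smooth_tderiv2 G x w z : smooth_symbols G -> U x ->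
  tderiv x z (fun y => dsym G y w)
    (fun a b c => 'D_z ('D_w (fun y => G y a b c)) x).
Proof.
move=> Gs Ux a b c; apply: differentiable_is_derive.
by apply: smooth_differentiable Ux; apply: smooth_derive.
Qed.

Lemma smooth_comm (f : V -> R) x w z : smooth_on U f -> U x ->
  'D_z ('D_w f) x = 'D_w ('D_z f) x.
Proof.
move=> fs Ux; apply: (derive_comm Uo Ux).
- by move=> y Uy; exact: smooth_differentiable.
- by apply: smooth_differentiable Ux; exact: smooth_derive.
- by apply: smooth_differentiable Ux; exact: smooth_derive.
Qed.

Lemma dsym_lin (G : symbols R n) x (k : R) w w' u v :
  (forall a b c, differentiable (fun y => G y a b c : R) x) ->
  bil (dsym G x (k *: w + w')) u v = k *: bil (dsym G x w) u v + bil (dsym G x w') u v.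
Proof.
move=> Gd; apply/rowP => d; rewrite !mxE big_distrr -big_split.
apply: eq_bigr => a _ /=; rewrite big_distrr -big_split; apply: eq_bigr => b _ /=.
have df := Gd a b d.
rewrite /dsym !deriveE // linearD linearZ /= -[_ *: _]/(_ * _).
ring.
Qed.

(** R(u, v) w for constant fields; the bracket [u, v] is zero. *)
Definition curv_vec (G : symbols R n) x u v w : V :=
  bil (dsym G x u) v w - bil (dsym G x v) u w
  + bil (G x) u (bil (G x) v w) - bil (G x) v (bil (G x) u w).

(** (nabla_a T)(u, v) for constant fields. *)
Definition cov_vec (G T : symbols R n) x a u v : V :=
  bil (dsym T x a) u v + bil (G x) a (bil (T x) u v)
  - bil (T x) (bil (G x) a u) v - bil (T x) u (bil (G x) a v).

Lemma curv_vec_lin1 (G : symbols R n) x (k : R) u u' v w :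
  (forall a b c, differentiable (fun y => G y a b c : R) x) ->
  curv_vec G x (k *: u + u') v w = k *: curv_vec G x u v w + curv_vec G x u' v w.
Proof.
by move=> Gd; apply/rowP => i; rewrite /curv_vec dsym_lin // !bilE !vecE; ring_entries.
Qed.

Lemma curv_vecC (G : symbols R n) x u v w : curv_vec G x u v w = - curv_vec G x v u w.
Proof. by apply/rowP => i; rewrite /curv_vec !vecE; ring_entries. Qed.

Lemma curv_vec_lin3 (G : symbols R n) x (k : R) u v w w' :
  curv_vec G x u v (k *: w + w') = k *: curv_vec G x u v w + curv_vec G x u v w'.
Proof. by apply/rowP => i; rewrite /curv_vec !bilE !vecE; ring_entries. Qed.

Lemma tri_curvature (G : symbols R n) x :
  (forall a b c, differentiable (fun y => G y a b c : R) x) -> forall u v w,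
  tri (curvature G x) u v w = curv_vec G x u v w.
Proof.
move=> Gd u v w; symmetry; apply: tri_ext.
- by move=> k u1 u2 v1 w1; exact: curv_vec_lin1.
- move=> k u1 v1 v2 w1; rewrite !(curv_vecC _ _ u1) curv_vec_lin1 //.
  by rewrite opprD scalerN.
- by move=> k u1 v1 w1 w2; exact: curv_vec_lin3.
move=> a b c; rewrite /curv_vec !bil_frame !bil_framel; apply/rowP => d.
rewrite [RHS]mxE /curvature sumrB !vecE !mxE addrA; congr (_ + _ - _);
  by apply: eq_bigr => e _; rewrite mxE.
Qed.

Lemma tri_cov_deriv (G T : symbols R n) x :
  (forall a b c, differentiable (fun y => T y a b c : R) x) -> forall a u v,
  tri (cov_deriv G T x) a u v = cov_vec G T x a u v.
Proof.
move=> Td u v w; symmetry; apply: tri_ext.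
- move=> k u1 u2 v1 w1; apply/rowP => i.
  by rewrite /cov_vec dsym_lin // !bilE !vecE; ring_entries.
- move=> k u1 v1 v2 w1; apply/rowP => i.
  by rewrite /cov_vec !bilE !vecE; ring_entries.
- move=> k u1 v1 w1 w2; apply/rowP => i.
  by rewrite /cov_vec !bilE !vecE; ring_entries.
move=> a b c; rewrite /cov_vec !bil_frame !bil_framel !bil_framer; apply/rowP => d.
rewrite [RHS]mxE /cov_deriv !sumrB !vecE !mxE !addrA; congr (_ + _ - _ - _);
  by apply: eq_bigr => e _; rewrite mxE // mulrC.
Qed.

End Trilinear.

(** * Metric connections and parallel tensors *)

Section Connections.
Context {R : realType} {n : nat}.
Local Notation V := (cspace R n).
Local Notation idx := 'I_(n + n).
Implicit Types (u v w x y z p q : V).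

Lemma trilinear_form_ext (f f' : V -> V -> V -> R) :
  (forall (k : R) u u' v w, f (k *: u + u') v w = k * f u v w + f u' v w) ->
  (forall (k : R) u v v' w, f u (k *: v + v') w = k * f u v w + f u v' w) ->
  (forall (k : R) u v w w', f u v (k *: w + w') = k * f u v w + f u v w') ->
  (forall (k : R) u u' v w, f' (k *: u + u') v w = k * f' u v w + f' u' v w) ->
  (forall (k : R) u v v' w, f' u (k *: v + v') w = k * f' u v w + f' u v' w) ->
  (forall (k : R) u v w w', f' u v (k *: w + w') = k * f' u v w + f' u v w') ->
  (forall a b c, f (frame a) (frame b) (frame c) = f' (frame a) (frame b) (frame c)) ->
  forall u v w, f u v w = f' u v w.
Proof.
move=> f1 f2 f3 f'1 f'2 f'3 ff' u v w.
have lin (h : V -> R) : (forall (k : R) x y, h (k *: x + y) = k * h x + h y) ->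
    forall x, h x = \sum_a x 0 a * h (frame a).
  move=> hl x; have h0 : h 0 = 0.
    by have := hl (-1) 0 0; rewrite scaler0 addr0 mulN1r addNr.
  have hD y z : h (y + z) = h y + h z by rewrite -[y in LHS]scale1r hl mul1r.
  rewrite {1}[x]frame_sum (big_morph h hD h0); apply: eq_bigr => a _.
  by rewrite -[_ *: frame a]addr0 hl h0 addr0.
rewrite (lin (fun x => f x v w)) => [|k x y]; last exact: f1.
rewrite [RHS](lin (fun x => f' x v w)) => [|k x y]; last exact: f'1.
apply: eq_bigr => a _; congr (_ * _).
rewrite (lin (f (frame a)^~ w)) => [|k x y]; last exact: f2.
rewrite [RHS](lin (f' (frame a)^~ w)) => [|k x y]; last exact: f'2.
apply: eq_bigr => b _; congr (_ * _).
rewrite (lin (f (frame a) (frame b))) => [|k x y]; last exact: f3.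
rewrite [RHS](lin (f' (frame a) (frame b))) => [|k x y]; last exact: f'3.
by apply: eq_bigr => c _; rewrite ff'.
Qed.

Variables (U : set V) (g : V -> 'M[R]_(n + n)).
Hypothesis Uo : open U.
Hypothesis g_smooth : forall a b, smooth_on U (fun y => g y a b : R).

Definition dgm y w : 'M[R]_(n + n) := \matrix_(a, b) 'D_w (fun y => g y a b : R) y.

Definition metric_compatible (H : symbols R n) := forall y w u v, U y ->
  gb (dgm y w) u v = gb (g y) (bil (H y) w u) v + gb (g y) u (bil (H y) w v).

Lemma gb_row (m : 'M[R]_(n + n)) (t : idx -> R) b :
  gb m (\row_e t e) (frame b) = \sum_e t e * m e b.
Proof.
rewrite gbE; apply: eq_bigr => e _; rewrite (bigD1 b) //= big1 ?addr0.
  by rewrite !mxE !eqxx mulr1.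
by move=> j /negPf jb; rewrite !mxE jb andbF mulr0 mul0r.
Qed.
Lemma gb_rowr (m : 'M[R]_(n + n)) (t : idx -> R) b :
  gb m (frame b) (\row_e t e) = \sum_e t e * m b e.
Proof.
rewrite gbE (bigD1 b) //= [X in _ + X]big1 ?addr0.
  by apply: eq_bigr => e _; rewrite !mxE !eqxx mul1r.
by move=> j /negPf jb; rewrite big1 // => e _; rewrite !mxE jb andbF !mul0r.
Qed.

Lemma metric_compatibleP (H : symbols R n) :
  (forall y a b c, U y -> 'D_(frame a) (fun y => g y b c : R) y =
    \sum_e (H y a b e * g y e c + H y a c e * g y b e)) ->
  metric_compatible H.
Proof.
move=> Hg y w u v Uy; move: w u v.
apply: trilinear_form_ext => [k w w' u v|k w u u' v|k w u v v'|k w w' u v|k w u u' v|k w u v v'|a b c].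
- rewrite !gbE big_distrr -big_split; apply: eq_bigr => a _ /=.
  rewrite big_distrr -big_split; apply: eq_bigr => b _ /=; rewrite !mxE.
  have df := smooth_differentiable (g_smooth a b) Uy.
  by rewrite !deriveE // linearD linearZ /= -[_ *: _]/(_ * _); ring.
- by rewrite !gblE; ring_gb.
- by rewrite !gblE; ring_gb.
- by rewrite !bilE !gblE; ring_gb.
- by rewrite !bilE !gblE; ring_gb.
- by rewrite !bilE !gblE; ring_gb.
rewrite !bil_frame gb_row gb_rowr -big_split /= -Hg //.
rewrite gbE (bigD1 b) //= [X in _ + X]big1 ?addr0; last first.
  by move=> i /negPf ib; rewrite big1 // => j _; rewrite !mxE ib andbF !mul0r.
rewrite (bigD1 c) //= big1 ?addr0 => [|j /negPf jc]; rewrite !mxE ?eqxx.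
  by rewrite !mul1r.
by rewrite jc mulr0 mul0r.
Qed.

Lemma gb_deriv x w : U x ->
  forall a b, is_derive x w (fun y => g y a b : R) (dgm x w a b : R).
Proof.
move=> Ux a b; rewrite mxE; apply: differentiable_is_derive.
exact: smooth_differentiable (g_smooth a b) Ux.
Qed.

Definition ddgm x w z : 'M[R]_(n + n) :=
  \matrix_(a, b) 'D_z ('D_w (fun y => g y a b : R)) x.

Lemma dgm_deriv x w z : U x ->
  forall a b, is_derive x z (fun y => dgm y w a b : R) (ddgm x w z a b : R).
Proof.
move=> Ux a b; rewrite mxE (_ : (fun y => _) = 'D_w (fun y => g y a b : R)).
  apply: differentiable_is_derive; apply: smooth_differentiable Ux.
  exact: smooth_derive (g_smooth a b).
by apply/funext => y; rewrite mxE.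
Qed.

Lemma ddgmC x w z : U x -> ddgm x w z = ddgm x z w.
Proof.
move=> Ux; apply: eq_mx => a b.
by rewrite (smooth_comm Uo z w (g_smooth a b) Ux).
Qed.

(** By symmetry of the second derivatives of the metric. *)
Lemma curv_skew (H : symbols R n) x : smooth_symbols U H ->
  metric_compatible H -> U x -> forall z w u v,
  gb (g x) (curv_vec H x z w u) v + gb (g x) u (curv_vec H x z w v) = 0.
Proof.
move=> Hs Hg Ux.
have dd z w u v : gb (ddgm x w z) u v =
    gb (g x) (bil (H x) z (bil (H x) w u)) v + gb (g x) (bil (H x) w u) (bil (H x) z v)
    + gb (g x) (bil (dsym H x z) w u) v
    + (gb (g x) (bil (H x) z u) (bil (H x) w v) + gb (g x) u (bil (H x) z (bil (H x) w v))
    + gb (g x) u (bil (dsym H x z) w v)).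
  have h1 := is_derive_gb (dgm_deriv w z Ux) (vderiv_cst x z u) (vderiv_cst x z v).
  have vb u' := vderiv_bil_cst w u' (smooth_tderiv z Hs Ux).
  have h2 := is_derive_gb (gb_deriv z Ux) (vb u) (vderiv_cst x z v).
  have h3 := is_derive_gb (gb_deriv z Ux) (vderiv_cst x z u) (vb v).
  have e := is_derive_near Uo Ux (fun y Uy => Hg y w u v Uy) h1 (is_deriveD h2 h3).
  move: e; rewrite !gb0l !gb0r !addr0 => ->.
  rewrite !(Hg _ _ _ _ Ux).
  by ring_gb.
move=> z w u v; have := dd z w u v; rewrite (ddgmC _ _ Ux) dd /curv_vec !gblE.
move/eqP; rewrite -subr_eq0 => /eqP e; rewrite -[RHS]oppr0 -[in RHS]e.
ring_gb.
Qed.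

(** By symmetry of the second derivatives of the parallel tensor [S], each
    first derivative of which is algebraic in [S] and [H]. *)
Lemma curv_derivation (H S : symbols R n) x : smooth_symbols U H ->
  smooth_symbols U S ->
  (forall y a u v, U y -> cov_vec H S y a u v = 0) -> U x -> forall z w u v,
  curv_vec H x z w (bil (S x) u v)
  = bil (S x) (curv_vec H x z w u) v + bil (S x) u (curv_vec H x z w v).
Proof.
move=> Hs Ss Hp Ux.
pose ddS z w : idx -> idx -> idx -> R := fun a b c => 'D_z ('D_w (fun y => S y a b c)) x.
have ddSC z w : ddS z w = ddS w z.
  by apply/funext => a; apply/funext => b; apply/funext => c; rewrite /ddS (smooth_comm Uo w z (Ss a b c) Ux).
have dS w u v : bil (dsym S x w) u v = bil (S x) (bil (H x) w u) v
    + bil (S x) u (bil (H x) w v) - bil (H x) w (bil (S x) u v).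
  apply/rowP => i; have /rowP/(_ i) := Hp x w u v Ux.
  rewrite /cov_vec !vecE => e; apply/eqP; rewrite -subr_eq0 -e; apply/eqP.
  by ring_entries.
have dd z w u v : bil (ddS z w) u v =
    bil (dsym S x z) (bil (H x) w u) v + bil (S x) (bil (dsym H x z) w u) v
    + (bil (dsym S x z) u (bil (H x) w v) + bil (S x) u (bil (dsym H x z) w v))
    - (bil (dsym H x z) w (bil (S x) u v) + bil (H x) w (bil (dsym S x z) u v)).
  have dH p := vderiv_bil_cst w p (smooth_tderiv z Hs Ux).
  have h0 := vderiv_bil_cst u v (smooth_tderiv2 w z Ss Ux).
  have h1 := vderiv_bilr w (smooth_tderiv z Hs Ux) (vderiv_bil_cst u v (smooth_tderiv z Ss Ux)).
  have h2 := vderiv_bill v (smooth_tderiv z Ss Ux) (dH u).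
  have h3 := vderiv_bilr u (smooth_tderiv z Ss Ux) (dH v).
  have h := vderivD (vderivD h2 h3) (vderivN h1).
  apply: (vderiv_near Uo Ux _ h0 h) => y Uy.
  apply/rowP => i; have /rowP/(_ i) := Hp y w u v Uy.
  rewrite /cov_vec !vecE => e; apply/eqP; rewrite -subr_eq0 -e; apply/eqP.
  by ring_entries.
move=> z w u v; have := dd z w u v; rewrite ddSC dd !dS => e.
apply/rowP => i; have := congr1 (fun r : V => r 0 i) e.
rewrite /curv_vec !bilE !vecE => /eqP; rewrite -subr_eq0 => /eqP e0.
apply/eqP; rewrite -subr_eq0 -e0; apply/eqP.
ring_entries.
Qed.

End Connections.

Lemma differentiable_near0 {R : realType} {V : normedModType R} (U : set V) (k : V -> R) x :
  open U -> U x -> (forall y, U y -> k y = 0) -> differentiable k x.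
Proof.
move=> Uo Ux k0.
have Un : nbhs x U by exact: open_nbhs_nbhs.
have e : k \o shift x = cst (k x) + (\0 : V -> R) +o_ 0 id.
  apply/eqaddoP => eps eps0; near=> y.
  have yU : U (y + x).
    near: y; have /nbhs_normP[d /= d0 dU] := Un.
    apply/nbhs_normP; exists d => // y; rewrite /ball_ /= sub0r normrN => yd; apply: dU.
    by rewrite /ball_ /= opprD addrCA subrr addr0 normrN.
  rewrite /= !fctE /= (k0 _ yU) (k0 _ Ux) addr0 subrr normr0 mulr_ge0 //.
  exact: ltW.
have c0 : continuous (\0 : V -> R) by exact: cst_continuous.
have d0 : 'd k x = \0 :> (V -> R) by exact: diff_unique c0 e.
by apply/diff_locallyP; rewrite d0.
Unshelve. all: by end_near. Qed.

Section SmoothSub.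
Context {R : realType} {n : nat}.
Local Notation V := (cspace R n).
Variable U : set V.
Hypothesis Uo : open U.

Lemma differentiable_near (f h : V -> R) x : U x ->
  (forall y, U y -> f y = h y) -> differentiable h x -> differentiable f x.
Proof.
move=> Ux fh dh; rewrite (_ : f = h + (fun y => f y - h y)); last first.
  by apply/funext => y; rewrite !fctE addrC subrK.
apply: differentiableD => //.
by apply: (differentiable_near0 Uo Ux) => y Uy; rewrite fh ?subrr.
Qed.

(** Linearity of the iterated derivatives is only available on [U]; hence the use
    of [differentiable_near]. *)
Lemma smooth_onB (f h : V -> R) : smooth_on U f -> smooth_on U h ->
  smooth_on U (fun y => f y - h y).
Proof.
move=> fs hs.
pose it (k : V -> R) vs := foldr (fun (v : V) (l : V -> R) => 'D_v l) k vs.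
have st vs : forall y, U y -> it (fun y => f y - h y) vs y = it f vs y - it h vs y.
  elim: vs => [|v vs IH] y Uy //=.
  have d1 := differentiable_is_derive v (fs vs y Uy).
  have d2 := differentiable_is_derive v (hs vs y Uy).
  have [_ <-] := is_deriveB d1 d2.
  apply: near_eq_derive.
  have : nbhs y U by exact: open_nbhs_nbhs.
  by apply: filterS => z Uz; exact: IH.
move=> vs y Uy; apply: (differentiable_near Uy (st vs)).
exact: differentiableB (fs vs y Uy) (hs vs y Uy).
Qed.
End SmoothSub.

(** * The Chern and the Bismut connection at a point *)

Section BismutMinusChern.
Context {R : realFieldType} {V : zmodType}.
Variables (J : V -> V) (e : V -> V -> V -> R).
Hypothesis JJ : forall u, J (J u) = - u.
Hypothesis eN : forall u v w, e (- u) v w = - e u v w.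

(** The hypotheses force total skewness; moving [J] around the three arguments
    then changes the sign of the form. *)
Lemma skew_hermitian_form0 :
  (forall u v w, e u v w = - e u w v) ->
  (forall u v w, e u (J v) (J w) = e u v w) ->
  (forall u v w, e u v w - e v u w = - (e u w v - e w u v)) ->
  forall u v w, e u v w = 0.
Proof.
move=> e23 eJ sk.
have e12 u v w : e u v w = - e v u w.
  have := sk u v w; have := sk v w u.
  by rewrite (e23 u w v) (e23 v u w) (e23 w v u); lra.
have e12J u v w : e (J u) (J v) w = e u v w.
  by rewrite e23 e12 eJ -e12 -e23.
have eNr u v w : e u v (- w) = - e u v w by rewrite e23 e12 eN opprK -e12 -e23.
have eNm u v w : e u (- v) w = - e u v w by rewrite e12 eN -e12.
have a u v w : e (J u) v w = - e u (J v) w by rewrite -(e12J u) JJ eNm opprK.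
have b u v w : e u (J v) w = - e u v (J w) by rewrite -(eJ u v) JJ eNr opprK.
have z u v w : e (J u) v w = 0.
  have := a u v w; have := a u w v.
  by rewrite (b u v w) (e23 (J u) w v) (e23 u (J w)); lra.
by move=> u v w; rewrite -[u]opprK -JJ z.
Qed.
End BismutMinusChern.

(** What the curvatures [RG] and [RH] of the Chern and of the Bismut connection
    satisfy at a point, [T] being the Chern torsion and [s u] the adjoint of
    [T u], so that the Bismut connection is the Chern connection plus
    [s - T]. *)
Section CurvatureComparison.
Context {R : realType} {m : nat}.
Local Notation V := 'rV[R]_m.
Implicit Types (u v w x y z p q : V).
Variables (J : V -> V) (g : V -> V -> R) (T s : V -> V -> V) (RG RH : V -> V -> V -> V).

Hypothesis J_lin : forall a u v, J (a *: u + v) = a *: J u + J v.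
Hypothesis JJ : forall u, J (J u) = - u.
Hypothesis g_lin : forall a u v w, g (a *: u + v) w = a * g u w + g v w.
Hypothesis gC : forall u v, g u v = g v u.
Hypothesis g_gt0 : forall u, u != 0 -> 0 < g u u.
Hypothesis gJ : forall u v, g (J u) (J v) = g u v.
Hypothesis T_lin : forall a u v w, T w (a *: u + v) = a *: T w u + T w v.
Hypothesis TC : forall u v, T u v = - T v u.
Hypothesis TJ : forall u v, T u (J v) = J (T u v).
Hypothesis s_adj : forall u v w, g (s u v) w = g v (T u w).

Let gam u v := s u v - T u v.
Let tau x y := - T x y + s x y - s y x.

Hypothesis RG_type11 : forall u v w,
  RG u v w - RG (J u) (J v) w = - J (RG (J u) v w + RG u (J v) w).
Hypothesis RG_skew : forall u v w z, g (RG u v w) z = - g w (RG u v z).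
Hypothesis RG_J : forall u v w, RG u v (J w) = J (RG u v w).
Hypothesis RG_bianchi : forall u v w,
  RG u v w + RG v w u + RG w u v =
  (T (tau u v) w - gam u (T v w)) + (T (tau v w) u - gam v (T w u))
  + (T (tau w u) v - gam w (T u v)).
Hypothesis RH_RG : forall u v w,
  RH u v w = RG u v w + gam (tau u v) w - gam u (gam v w) + gam v (gam u w).

Lemma jJ0 : J 0 = 0.
Proof. by have := J_lin (-1) 0 0; rewrite scaler0 addr0 scaleN1r addNr. Qed.
Lemma jJD u v : J (u + v) = J u + J v.
Proof. by rewrite -[u in LHS]scale1r J_lin scale1r. Qed.
Lemma jJN u : J (- u) = - J u.
Proof. by rewrite -scaleN1r -[_ *: u]addr0 J_lin jJ0 addr0 scaleN1r. Qed.
Lemma jgDl u v w : g (u + v) w = g u w + g v w.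
Proof. by rewrite -[u]scale1r g_lin mul1r scale1r. Qed.
Lemma jg0l w : g 0 w = 0.
Proof. by have := g_lin (-1) 0 0 w; rewrite scaler0 addr0 mulN1r addNr. Qed.
Lemma jgNl u w : g (- u) w = - g u w.
Proof. by rewrite -scaleN1r -[_ *: u]addr0 g_lin jg0l addr0 mulN1r. Qed.
Lemma jgDr u v w : g w (u + v) = g w u + g w v.
Proof. by rewrite !(gC w) jgDl. Qed.
Lemma jgNr u w : g w (- u) = - g w u.
Proof. by rewrite !(gC w) jgNl. Qed.
Let gE := (jgDl, jgDr, jgNl, jgNr).
Lemma jg_ext u v : (forall w, g u w = g v w) -> u = v.
Proof.
move=> uv; apply/eqP; rewrite -subr_eq0; apply: contraT => /g_gt0.
by rewrite jgDl jgNl uv subrr ltxx.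
Qed.
Lemma jgJl u v : g (J u) v = - g u (J v).
Proof. by rewrite -(gJ u) JJ jgNr opprK. Qed.

Lemma jTDr u v w : T w (u + v) = T w u + T w v.
Proof. by rewrite -[u]scale1r T_lin !scale1r. Qed.
Lemma jT0r w : T w 0 = 0.
Proof. by have := T_lin (-1) 0 0 w; rewrite scaler0 addr0 scaleN1r addNr. Qed.
Lemma jTNr u w : T w (- u) = - T w u.
Proof. by rewrite -scaleN1r -[_ *: u]addr0 T_lin jT0r addr0 scaleN1r. Qed.
Lemma jTDl u v w : T (u + v) w = T u w + T v w.
Proof. by rewrite !(TC _ w) jTDr opprD. Qed.
Lemma jTNl u w : T (- u) w = - T u w.
Proof. by rewrite !(TC _ w) jTNr. Qed.
Lemma jTJl u v : T (J u) v = J (T u v).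
Proof. by rewrite TC TJ -jJN -TC. Qed.
Let TE := (jTDl, jTDr, jTNl, jTNr).

Lemma jsDr u v w : s w (u + v) = s w u + s w v.
Proof. by apply: jg_ext => z; rewrite !(gE, s_adj). Qed.
Lemma jsDl u v w : s (u + v) w = s u w + s v w.
Proof. by apply: jg_ext => z; rewrite !(gE, s_adj, jTDl). Qed.
Lemma jsNl u w : s (- u) w = - s u w.
Proof. by apply: jg_ext => z; rewrite !(gE, s_adj, jTNl). Qed.
Lemma jsNr u w : s w (- u) = - s w u.
Proof. by apply: jg_ext => z; rewrite !(gE, s_adj). Qed.
Lemma jT0l w : T 0 w = 0.
Proof. by rewrite TC jT0r oppr0. Qed.
Lemma js0r w : s w 0 = 0.
Proof. by apply: jg_ext => z; rewrite s_adj !jg0l. Qed.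
Lemma js0l w : s 0 w = 0.
Proof. by apply: jg_ext => z; rewrite s_adj jT0l gC !jg0l. Qed.
Lemma jsJr u v : s u (J v) = J (s u v).
Proof. by apply: jg_ext => z; rewrite s_adj !jgJl s_adj TJ. Qed.
Lemma jsJl u v : s (J u) v = - J (s u v).
Proof. by apply: jg_ext => z; rewrite s_adj jgNl jgJl opprK s_adj jTJl TJ. Qed.
Let sE := (jsDl, jsDr, jsNl, jsNr).

(** The (2,0) part of the curvature is both skew and symmetric for [g]. *)
Lemma chern_curvature_JJ u v w : RG (J u) (J v) w = RG u v w.
Proof.
pose Z x := RG u v x - RG (J u) (J v) x.
suff h : forall x, Z x = 0 by apply/esym/eqP; rewrite -subr_eq0; apply/eqP/h.
have Zsk x y : g (Z x) y = - g x (Z y).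
  by rewrite /Z !gE !(RG_skew _ _ x); ring.
have Zsy x y : g (Z x) y = g x (Z y).
  rewrite /Z !RG_type11 !gE jgJl opprK !gE RG_skew [in X in _ + X]RG_skew !RG_J.
  by rewrite !jJD !gE; ring.
move=> x; apply: jg_ext => y; rewrite jg0l; have := Zsk x y; have := Zsy x y; lra.
Qed.

(** The Chern curvature is of type (1,1), so it drops out of the part of its
    Bianchi identity that is complex linear in all three arguments. The
    adjoint [s] is conjugate linear in its first argument and drops out too. *)
Lemma chern_torsion_jacobi u v w : T u (T v w) + T v (T w u) + T w (T u v) = 0.
Proof.
pose F u v w := RG u v w + RG v w u + RG w u v.
have a p q r : RG (J p) q r = - RG p (J q) r.
  have := RG_type11 p q (J r); rewrite chern_curvature_JJ subrr => /esym/eqP.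
  by rewrite oppr_eq0 !RG_J -jJD JJ oppr_eq0 addr_eq0 => /eqP.
(* Four times the complex trilinear part of [F]. *)
have e : F u v w - F (J u) (J v) w - F (J u) v (J w) - F u (J v) (J w) = 0.
  apply/rowP => i; rewrite /F.
  rewrite !RG_J.
  rewrite !chern_curvature_JJ.
  rewrite !a !jJN.
  rewrite !vecE. ring_entries.
move: e; rewrite /F !RG_bianchi /gam /tau.
rewrite !(TE, sE, jTJl, TJ, jsJl, jsJr, JJ, jJD, jJN, jTNl, jTNr) => e.
rewrite !(TC (T _ _)) in e.
apply/rowP => i; have := congr1 (fun r : V => r 0 i) e; rewrite !vecE => e0.
suff h (r : R) : 8 * r = 0 -> r = 0 by apply: h; rewrite -[RHS]e0; ring_entries.
by move=> r0; lra.
Qed.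

Lemma js_jacobi u v w : s (T u v) w = s v (s u w) - s u (s v w).
Proof.
apply: jg_ext => z; rewrite !(jgDl, jgNl, s_adj) -jgNr -jgDr; congr (g w _).
have := chern_torsion_jacobi u v z; rewrite (TC z u) (TC z (T u v)) jTNr => /eqP.
by rewrite subr_eq0 => /eqP.
Qed.

Lemma jT_jacobi u v w : T (T u v) w = T u (T v w) - T v (T u w).
Proof.
have := chern_torsion_jacobi u v w; rewrite (TC w u) (TC w (T u v)) jTNr => /eqP.
by rewrite subr_eq0 => /eqP.
Qed.

Lemma bismut_curvature_JJ u v w : RH (J u) (J v) w = RH u v w.
Proof.
rewrite !RH_RG chern_curvature_JJ /gam /tau.
rewrite !(TE, sE, jTJl, TJ, jsJl, jsJr, JJ, jJD, jJN, jTNl, jTNr).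
rewrite !jT_jacobi !js_jacobi.
apply/rowP => i; rewrite !vecE; ring_entries.
Qed.

Lemma bismut_curvature_J u v w : RH u v (J w) = J (RH u v w).
Proof.
rewrite !RH_RG RG_J /gam /tau.
by rewrite !(TE, sE, jTJl, TJ, jsJl, jsJr, JJ, jJD, jJN, jTNl, jTNr).
Qed.

Lemma bismut_hol_sect u : g (RH u (J u) (J u)) u
  = g (RG u (J u) (J u)) u - 2 * g (s u u) (s u u).
Proof.
have T0 : T u u = 0.
  by apply/rowP => i; have := congr1 (fun r : V => r 0 i) (TC u u); rewrite !vecE; lra.
have e : RH u (J u) (J u) = RG u (J u) (J u) + (s (s u u) u + s (s u u) u).
  rewrite RH_RG /gam /tau.
  rewrite !(TE, sE, jTJl, TJ, jsJl, jsJr, JJ, jJD, jJN, jTNl, jTNr) ?T0.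
  rewrite ?jT0l ?jT0r ?js0l ?js0r.
  rewrite ?(TC u (s u u)).
  apply/rowP => i; rewrite !vecE; ring_entries.
rewrite e !gE !s_adj (TC (s u u) u) jgNr -s_adj; by lra.
Qed.

Variable c : R.
Hypothesis RH_lin1 : forall a u v w z, RH (a *: u + v) w z = a *: RH u w z + RH v w z.
Hypothesis RHC : forall u v w, RH u v w = - RH v u w.
Hypothesis RH_lin3 : forall a u v w z, RH w z (a *: u + v) = a *: RH w z u + RH w z v.
Hypothesis RH_skew : forall u v w z, g (RH u v w) z = - g w (RH u v z).
Hypothesis RH_der : forall u v w z, RH u v (T w z) = T (RH u v w) z + T w (RH u v z).
Hypothesis RH_bianchi : forall u v w,
  RH u v w + RH v w u + RH w u v
  = tau (tau u v) w + tau (tau v w) u + tau (tau w u) v.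
Hypothesis RG_hsc : forall u, g (RG u (J u) (J u)) u = c * g u u ^+ 2.

Lemma bismut_hsc u :
  g (RH u (J u) (J u)) u + 2 * g (s u u) (s u u) = c * g u u ^+ 2.
Proof. by rewrite bismut_hol_sect RG_hsc subrK. Qed.

Definition torsion_data : torsionData 'rV[R]_m c :=
  TorsionData J_lin JJ g_lin gC g_gt0 gJ T_lin TC TJ s_adj chern_torsion_jacobi
    RH_lin1 RHC RH_lin3 bismut_curvature_J bismut_curvature_JJ RH_skew RH_der
    RH_bianchi bismut_hsc.
End CurvatureComparison.

(** [G] and [H] are the values at a point of the symbols of the Chern and of the
    Bismut connection, [dG] and [dH] their derivatives. The torsion [T] and the
    difference [gam] of the connections are parallel for [H], which eliminates
    the derivatives from the Bianchi identities and from the difference of the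
    curvatures. *)
Section PointCurvature.
Context {R : realType} {m : nat}.
Local Notation V := 'rV[R]_m.
Implicit Types (u v w x y z p q : V).
Variables (J : V -> V) (G H : V -> V -> V) (dG dH : V -> V -> V -> V).
Hypothesis G_lin1 : forall (a : R) u v w, G (a *: u + v) w = a *: G u w + G v w.
Hypothesis G_lin2 : forall (a : R) u v w, G w (a *: u + v) = a *: G w u + G w v.
Hypothesis H_lin1 : forall (a : R) u v w, H (a *: u + v) w = a *: H u w + H v w.
Hypothesis H_lin2 : forall (a : R) u v w, H w (a *: u + v) = a *: H w u + H w v.
Hypothesis J_lin : forall (a : R) u v, J (a *: u + v) = a *: J u + J v.
Hypothesis JJ : forall u, J (J u) = - u.
Hypothesis GJ1 : forall u v, G (J u) v = J (G u v).
Hypothesis GJ2 : forall u v, G u (J v) = J (G u v).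
Hypothesis HJ2 : forall u v, H u (J v) = J (H u v).
Hypothesis dGJ1 : forall w u v, dG w (J u) v = J (dG w u v).
Hypothesis dGJ2 : forall w u v, dG w u (J v) = J (dG w u v).

Let T u v := G u v - G v u.
Let s u v := H u v - G v u.
Let gam u v := s u v - T u v.
Let tau x y := - T x y + s x y - s y x.
Let RG u v w := dG u v w - dG v u w + G u (G v w) - G v (G u w).
Let RH u v w := dH u v w - dH v u w + H u (H v w) - H v (H u w).

Hypothesis dT_parallel : forall w u v, dG w u v - dG w v u
  = T (H w u) v + T u (H w v) - H w (T u v).
Hypothesis dgam_parallel : forall w u v, dH w u v - dG w u v
  = gam (H w u) v + gam u (H w v) - H w (gam u v).

Lemma linD (f : V -> V) : (forall (a : R) u v, f (a *: u + v) = a *: f u + f v) ->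
  forall u v, f (u + v) = f u + f v.
Proof. by move=> fl u v; rewrite -[u in LHS]scale1r fl scale1r. Qed.
Lemma linN (f : V -> V) : (forall (a : R) u v, f (a *: u + v) = a *: f u + f v) ->
  forall u, f (- u) = - f u.
Proof.
move=> fl u; have f0 : f 0 = 0.
  by have := fl (-1) 0 0; rewrite scaler0 addr0 scaleN1r addNr.
by have := fl (-1) u 0; rewrite f0 !addr0 !scaleN1r.
Qed.
Let lE := (fun w => linD (fun a u v => G_lin1 a u v w), fun w => linN (fun a u v => G_lin1 a u v w),
   fun w => linD (fun a u v => G_lin2 a u v w), fun w => linN (fun a u v => G_lin2 a u v w),
  fun w => linD (fun a u v => H_lin1 a u v w), fun w => linN (fun a u v => H_lin1 a u v w),
   fun w => linD (fun a u v => H_lin2 a u v w), fun w => linN (fun a u v => H_lin2 a u v w)).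

Lemma dT_rule w u v : dG w u v = dG w v u + (T (H w u) v + T u (H w v) - H w (T u v)).
Proof. by rewrite -dT_parallel addrC subrK. Qed.
Lemma dgam_rule w u v :
  dH w u v = dG w u v + (gam (H w u) v + gam u (H w v) - H w (gam u v)).
Proof. by rewrite -dgam_parallel addrC subrK. Qed.

Lemma bismut_chern_curvature u v w :
  RH u v w = RG u v w + gam (tau u v) w - gam u (gam v w) + gam v (gam u w).
Proof.
rewrite /RH /RG !dgam_rule /gam /tau /s /T !lE.
apply/rowP => i; rewrite !vecE; ring_entries.
Qed.

Lemma chern_bianchi u v w : RG u v w + RG v w u + RG w u v =
  (T (tau u v) w - gam u (T v w)) + (T (tau v w) u - gam v (T w u))
  + (T (tau w u) v - gam w (T u v)).
Proof.
rewrite /RG (dT_rule u v w) (dT_rule v w u) (dT_rule w u v) /gam /tau /s /T !lE.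
apply/rowP => i; rewrite !vecE; ring_entries.
Qed.

Lemma tauE u v : tau u v = H u v - H v u.
Proof. by apply/rowP => i; rewrite /tau /s /T !vecE; ring_entries. Qed.

Lemma dtau_parallel w u v : dH w u v - dH w v u
  = tau (H w u) v + tau u (H w v) - H w (tau u v).
Proof.
rewrite !dgam_rule (dT_rule w u v) !tauE /gam /s /T !lE.
by apply/rowP => i; rewrite !vecE; ring_entries.
Qed.

Lemma dtau_rule w u v :
  dH w u v = dH w v u + (tau (H w u) v + tau u (H w v) - H w (tau u v)).
Proof. by rewrite -dtau_parallel addrC subrK. Qed.

Lemma bismut_bianchi u v w : RH u v w + RH v w u + RH w u v
  = tau (tau u v) w + tau (tau v w) u + tau (tau w u) v.
Proof.
rewrite /RH (dtau_rule u v w) (dtau_rule v w u) (dtau_rule w u v) !tauE !lE.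
by apply/rowP => i; rewrite !vecE; ring_entries.
Qed.

(** The (0,2) part of the curvature vanishes because [G] and [dG] are complex
    bilinear. *)
Lemma chern_type11 u v w :
  RG u v w - RG (J u) (J v) w = - J (RG (J u) v w + RG u (J v) w).
Proof.
rewrite /RG !(dGJ1, dGJ2, GJ1, GJ2) !(linD J_lin, linN J_lin) !JJ.
apply/rowP => i; rewrite !vecE; ring_entries.
Qed.

Lemma chern_curv_J u v w : RG u v (J w) = J (RG u v w).
Proof. by rewrite /RG !(dGJ2, GJ2) !(linD J_lin, linN J_lin). Qed.
End PointCurvature.

(** * Vanishing of the Chern torsion *)

Section ChernBismut.
Context {R : realType} {n : nat}.
Local Notation V := (cspace R n).
Local Notation idx := 'I_(n + n).
Implicit Types (u v w x y z p q : V).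

Variables (U : set V) (g : V -> 'M[R]_(n + n)) (G H : symbols R n).
Hypothesis Uo : open U.
Hypothesis g_smooth : forall a b, smooth_on U (fun y => g y a b : R).
Hypothesis g_sym : forall y, U y -> (g y)^T = g y.
Hypothesis g_pos : forall y v, U y -> v != 0 -> 0 < gb (g y) v v.
Hypothesis g_J : forall y u v, U y -> gb (g y) (u *m Jmx) (v *m Jmx) = gb (g y) u v.
Hypothesis G_smooth : smooth_symbols U G.
Hypothesis H_smooth : smooth_symbols U H.
Hypothesis G_metric : metric_compatible U g G.
Hypothesis H_metric : metric_compatible U g H.
Hypothesis G_J1 : forall y u v, U y -> bil (G y) (u *m Jmx) v = bil (G y) u v *m Jmx.
Hypothesis G_J2 : forall y u v, U y -> bil (G y) u (v *m Jmx) = bil (G y) u v *m Jmx.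
Hypothesis H_J2 : forall y u v, U y -> bil (H y) u (v *m Jmx) = bil (H y) u v *m Jmx.
Hypothesis H_skew : forall y u v w, U y ->
  gb (g y) (bil (torsion H y) u v) w = - gb (g y) (bil (torsion H y) u w) v.
Hypothesis T_parallel : forall y a u v, U y -> cov_vec H (torsion G) y a u v = 0.

Lemma bil_torsion (S : symbols R n) y u v :
  bil (torsion S y) u v = bil (S y) u v - bil (S y) v u.
Proof. by rewrite -(bil_swap (S y) u v) -bilBt. Qed.

Lemma JmxK u : u *m Jmx *m Jmx = - u :> V.
Proof.
have JJ : Jmx *m Jmx = - 1%:M :> 'M[R]_(n + n).
  rewrite /Jmx mulmx_block !(mulmx0, mul0mx, add0r, addr0, mul1mx, mulmx1).
  by rewrite scalar_mx_block opp_block_mx !oppr0.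
by rewrite -mulmxA JJ mulmxN mulmx1.
Qed.

Lemma Jmx_lin a u v : (a *: u + v) *m Jmx = a *: (u *m Jmx) + v *m Jmx :> V.
Proof. by rewrite mulmxDl scalemxAl. Qed.

Lemma gbC y u v : U y -> gb (g y) u v = gb (g y) v u.
Proof.
move=> Uy; rewrite !gbE exchange_big; apply: eq_bigr => a _; apply: eq_bigr => b _.
by rewrite -[in LHS](g_sym Uy) mxE (mulrC (u 0 b)).
Qed.

Lemma gb_ext y u v : U y -> (forall w, gb (g y) u w = gb (g y) v w) -> u = v.
Proof.
move=> Uy uv; apply/eqP; rewrite -subr_eq0; apply: contraT => /(g_pos Uy).
by rewrite gbDl gbNl uv subrr ltxx.
Qed.

(** Uniqueness of the Bismut connection, in the form that expresses it through
    the Chern torsion. *)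
Lemma bismut_minus_chern y u v w : U y ->
  gb (g y) (bil (H y) u v - bil (G y) u v) w =
  - gb (g y) (bil (torsion G y) u v) w + gb (g y) v (bil (torsion G y) u w).
Proof.
move=> Uy; pose t u v w := gb (g y) (bil (torsion G y) u v) w.
pose e u v w := gb (g y) (bil (H y) u v - bil (G y) u v) w + t u v w - t u w v.
suff e0 : e u v w = 0.
  have := e0; rewrite /e /t (gbC _ v Uy); lra.
have gJl p q : gb (g y) (p *m Jmx) q = - gb (g y) p (q *m Jmx).
  by rewrite -(g_J _ (q *m Jmx) Uy) JmxK gbNr opprK.
have TJ u' v' : bil (torsion G y) u' (v' *m Jmx) = bil (torsion G y) u' v' *m Jmx.
  by rewrite !bil_torsion G_J1 // G_J2 // mulmxBl.
apply: (skew_hermitian_form0 (J := fun u => u *m Jmx)) => {u v w}.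
- exact: JmxK.
- by move=> u v w; rewrite /e /t !bilE !gblE; ring_gb.
- move=> u v w; rewrite /e /t !gblE.
  have := G_metric u v w Uy; rewrite H_metric // (gbC v _ Uy) (gbC v _ Uy).
  by lra.
- move=> u v w; rewrite /e /t !TJ G_J2 // H_J2 // -mulmxBl !g_J //.
- move=> u v w; have := H_skew u v w Uy.
  have := H_skew w u v Uy; have := H_skew v w u Uy.
  rewrite /e /t !bil_torsion !gblE; lra.
Qed.

Lemma torsion_smooth : smooth_symbols U (torsion G).
Proof. by move=> a b c; apply: smooth_onB. Qed.

Lemma bil_dtorsion x w u v : U x -> bil (dsym (torsion G) x w) u v =
  bil (dsym G x w) u v - bil (dsym G x w) v u.
Proof.
move=> Ux; rewrite -(bil_swap (dsym G x w) u v) -bilBt; congr (bil _ u v).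
apply/funext => a; apply/funext => b; apply/funext => c.
have [_ <-] := is_deriveB (smooth_tderiv w G_smooth Ux a b c) (smooth_tderiv w G_smooth Ux b a c).
by [].
Qed.

Lemma torsion_deriv x w u v : U x ->
  bil (dsym (torsion G) x w) u v = bil (torsion G x) (bil (H x) w u) v
    + bil (torsion G x) u (bil (H x) w v) - bil (H x) w (bil (torsion G x) u v).
Proof.
move=> Ux; apply/rowP => i; have /rowP/(_ i) := T_parallel w u v Ux.
rewrite /cov_vec !vecE => e; apply/eqP; rewrite -subr_eq0 -e; apply/eqP.
by ring_entries.
Qed.

Let gam y u v := bil (H y) u v - bil (G y) u v.

(** The difference of the two connections is built from the metric and the
    Chern torsion, which are parallel. *)
Lemma gam_parallel x z u v : U x ->
  bil (dsym H x z) u v - bil (dsym G x z) u v =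
  gam x (bil (H x) z u) v + gam x u (bil (H x) z v) - bil (H x) z (gam x u v).
Proof.
move=> Ux; apply: (gb_ext Ux) => w.
have vz p := vderiv_cst x z p.
have dgam := vderivD (vderiv_bil_cst u v (smooth_tderiv z H_smooth Ux))
  (vderivN (vderiv_bil_cst u v (smooth_tderiv z G_smooth Ux))).
have dT p q := vderiv_bil_cst p q (smooth_tderiv z torsion_smooth Ux).
have h1 := is_derive_gb (gb_deriv g_smooth z Ux) dgam (vz w).
have h2 := is_derive_gb (gb_deriv g_smooth z Ux) (vderivN (dT u v)) (vz w).
have h3 := is_derive_gb (gb_deriv g_smooth z Ux) (vz v) (dT u w).
have := is_derive_near Uo Ux _ h1 (is_deriveD h2 h3).
rewrite !gb0l !gb0r !addr0 => e.
have {e h1 h2 h3 dgam dT} := e (fun y Uy => etrans (bismut_minus_chern u v w Uy)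
  (congr1 (fun r => r + _) (esym (gbNl _ _ _)))).
rewrite !(H_metric _ _ _ Ux) !torsion_deriv //.
have A p q r := bismut_minus_chern p q r Ux.
rewrite (A u v (bil (H x) z w)) => e.
rewrite /gam [RHS]gbDl gbNl [in RHS]gbDl !A; move: e; rewrite !bilNr !gblE; lra.
Qed.

Lemma vderiv_mulmx x w (p : V -> V) (dp : V) (A : 'M[R]_(n + n)) : vderiv x w p dp ->
  vderiv x w (fun y => p y *m A) (dp *m A).
Proof.
move=> hp c; rewrite (_ : (fun y => _) = fun y => \sum_k p y 0 k * A k c); last first.
  by apply/funext => y; rewrite mxE.
rewrite mxE; apply: is_derive_sum_fun => k.
apply: (is_derive_eq (is_derive_mul (hp k) (is_derive_cst (A k c) x w))).
by rewrite mulr0 addr0.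
Qed.

Lemma dsym_J1 (S : symbols R n) x : smooth_symbols U S ->
  (forall y u v, U y -> bil (S y) (u *m Jmx) v = bil (S y) u v *m Jmx) -> U x ->
  forall w u v, bil (dsym S x w) (u *m Jmx) v = bil (dsym S x w) u v *m Jmx.
Proof.
move=> Ss SJ Ux w u v; have cst u v := vderiv_bil_cst u v (smooth_tderiv w Ss Ux).
exact: (vderiv_near Uo Ux (fun y Uy => SJ y u v Uy) (cst _ _) (vderiv_mulmx _ (cst _ _))).
Qed.

Lemma dsym_J2 (S : symbols R n) x : smooth_symbols U S ->
  (forall y u v, U y -> bil (S y) u (v *m Jmx) = bil (S y) u v *m Jmx) -> U x ->
  forall w u v, bil (dsym S x w) u (v *m Jmx) = bil (dsym S x w) u v *m Jmx.
Proof.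
move=> Ss SJ Ux w u v; have cst u v := vderiv_bil_cst u v (smooth_tderiv w Ss Ux).
exact: (vderiv_near Uo Ux (fun y Uy => SJ y u v Uy) (cst _ _) (vderiv_mulmx _ (cst _ _))).
Qed.

(** At each point the data satisfy the hypotheses of [torsionData_eq0]. *)
Lemma chern_torsion_eq0 x (c : R) : U x -> c != 0 ->
  (forall u, gb (g x) (curv_vec G x u (u *m Jmx) (u *m Jmx)) u
     = c * gb (g x) u u ^+ 2) ->
  forall u v, bil (torsion G x) u v = 0.
Proof.
move=> Ux c0 hsc.
have lin1 (S : symbols R n) (a : R) u v w : bil (S x) (a *: u + v) w = a *: bil (S x) u w + bil (S x) v w.
  by rewrite !bilE.
have lin2 (S : symbols R n) (a : R) u v w : bil (S x) w (a *: u + v) = a *: bil (S x) w u + bil (S x) w v.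
  by rewrite !bilE.
have dGJ1 := dsym_J1 G_smooth G_J1 Ux; have dGJ2 := dsym_J2 G_smooth G_J2 Ux.
pose T := torsion G; pose s u v := bil (H x) u v - bil (G x) v u.
have TE u v : bil (T x) u v = bil (G x) u v - bil (G x) v u by exact: bil_torsion.
have TJ u v : bil (T x) u (v *m Jmx) = bil (T x) u v *m Jmx.
  by rewrite !TE G_J1 // G_J2 // mulmxBl.
have s_adj u v w : gb (g x) (s u v) w = gb (g x) v (bil (T x) u w).
  have -> : s u v = (bil (H x) u v - bil (G x) u v) + bil (T x) u v.
    by apply/rowP => i; rewrite TE /s !vecE; ring_entries.
  by rewrite gbDl bismut_minus_chern // addrAC addNr add0r.
have dT w u v : bil (dsym G x w) u v - bil (dsym G x w) v u =
    bil (T x) (bil (H x) w u) v + bil (T x) u (bil (H x) w v) - bil (H x) w (bil (T x) u v).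
  by rewrite -bil_dtorsion // torsion_deriv.
have TsE u v : s u v - bil (T x) u v = bil (H x) u v - bil (G x) u v.
  by apply/rowP => i; rewrite TE /s !vecE; ring_entries.
have dgam w u v : bil (dsym H x w) u v - bil (dsym G x w) u v =
    (s (bil (H x) w u) v - bil (T x) (bil (H x) w u) v)
    + (s u (bil (H x) w v) - bil (T x) u (bil (H x) w v))
    - bil (H x) w (s u v - bil (T x) u v).
  by rewrite !TsE gam_parallel.
have glin (a : R) u v w : gb (g x) (a *: u + v) w = a * gb (g x) u w + gb (g x) v w.
  by rewrite !gblE.
have skew (S : symbols R n) u v w z : smooth_symbols U S -> metric_compatible U g S ->
    gb (g x) (curv_vec S x u v w) z = - gb (g x) w (curv_vec S x u v z).
  by move=> Ss Sg; apply/eqP; rewrite -addr_eq0 (curv_skew Uo g_smooth Ss Sg Ux).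
have Hd a b c := smooth_differentiable (H_smooth a b c) Ux.
pose BG := bil (G x); pose BH := bil (H x).
pose dG w := bil (dsym G x w); pose dH w := bil (dsym H x w).
have dT' w u v : dG w u v - dG w v u = (BG (BH w u) v - BG v (BH w u))
   + (BG u (BH w v) - BG (BH w v) u) - BH w (BG u v - BG v u).
  by have := dT w u v; rewrite !TE.
have dgam' w u v : dH w u v - dG w u v =
  ((BH (BH w u) v - BG v (BH w u)) - (BG (BH w u) v - BG v (BH w u)))
  + ((BH u (BH w v) - BG (BH w v) u) - (BG u (BH w v) - BG (BH w v) u))
  - BH w ((BH u v - BG v u) - (BG u v - BG v u)).
  by have := dgam w u v; rewrite !TE.
have RHG u v w := bismut_chern_curvature (lin1 G) (lin2 G) (lin1 H) (lin2 H) dgam' u v w.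
have bG u v w := chern_bianchi (lin1 G) (lin2 G) (lin2 H) dT' u v w.
have bH u v w := bismut_bianchi (lin1 H) (lin2 H) dT' dgam' u v w.
have t11 u v w := chern_type11 Jmx_lin JmxK (fun u v => G_J1 u v Ux) (fun u v => G_J2 u v Ux) dGJ1 u v w.
have RGJ u v w := chern_curv_J Jmx_lin (fun u v => G_J2 u v Ux) dGJ2 u v w.
have RHl1 (a : R) u v w z := curv_vec_lin1 a u v w z Hd.
pose T0 u v := BG u v - BG v u.
have T0E u v : T0 u v = bil (T x) u v by rewrite TE.
have T0l (a : R) u v w : T0 w (a *: u + v) = a *: T0 w u + T0 w v by rewrite !T0E lin2.
have T0C u v : T0 u v = - T0 v u by rewrite /T0 opprB.
have T0J u v : T0 u (v *m Jmx) = T0 u v *m Jmx by rewrite !T0E TJ.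
have s_adj0 u v w : gb (g x) (s u v) w = gb (g x) v (T0 u w) by rewrite T0E s_adj.
have Rder u v w z : curv_vec H x u v (T0 w z) = T0 (curv_vec H x u v w) z + T0 w (curv_vec H x u v z).
  rewrite !T0E; exact: (curv_derivation Uo H_smooth torsion_smooth T_parallel Ux).
pose B := @torsion_data R (n + n) (fun u => u *m Jmx) (gb (g x)) T0 s
  (curv_vec G x) (curv_vec H x) Jmx_lin JmxK glin (fun u v => gbC u v Ux)
  (fun u nz => g_pos Ux nz) (fun u v => g_J u v Ux) T0l T0C T0J s_adj0 t11
  (fun u v w z => skew G u v w z G_smooth G_metric) RGJ bG RHG c RHl1 (curv_vecC H x)
  (fun a u v w z => curv_vec_lin3 H x a w z u v)
  (fun u v w z => skew H u v w z H_smooth H_metric) Rder bH hsc.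
have [F [Fo Fs]] := unitary_frame_exists (B := B) (fun u => erefl).
by move=> u v; rewrite -T0E; exact: (torsionData_eq0 Fo Fs c0 u v).
Qed.
End ChernBismut.

(** * Complex tangent vectors and the Hermitian form *)

Section RealParts.
Context {R : realType} {n : nat}.
Local Notation V := (cspace R n).
Local Notation VC := ('rV[R[i]]_(n + n)).
Implicit Types (p q u v w : V).

Definition cmk p q : VC := \row_k (p 0 k +i* q 0 k)%C.

Lemma cmk_inj p q p' q' : cmk p q = cmk p' q' -> p = p' /\ q = q'.
Proof.
by move=> e; split; apply/rowP => k; have /rowP/(_ k) := e; rewrite !mxE => -[].
Qed.

Lemma complex_sum (I : finType) (f h : I -> R) :
  \sum_i (f i +i* h i)%C = ((\sum_i f i) +i* (\sum_i h i))%C.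
Proof.
elim/big_rec3: _ => // i x y z _ ->.
by [].
Qed.

Lemma symbolsC_mk (t : symbols R n) x p q p' q' :
  symbolsC t x (cmk p q) (cmk p' q') =
  cmk (bil (t x) p p' - bil (t x) q q') (bil (t x) p q' + bil (t x) q p').
Proof.
apply/rowP => c; rewrite !mxE.
under eq_bigr => a _.
  under eq_bigr => b _.
    rewrite !mxE (_ : _ * _ = ((p 0 a * p' 0 b * t x a b c - q 0 a * q' 0 b * t x a b c)
      +i* (p 0 a * q' 0 b * t x a b c + q 0 a * p' 0 b * t x a b c))%C); last first.
      by simpc; congr (_ +i* _)%C; ring.
    over.
  rewrite complex_sum; over.
rewrite complex_sum; congr (_ +i* _)%C.
  by rewrite -sumrB; apply: eq_bigr => a _; rewrite -sumrB.
by rewrite -big_split; apply: eq_bigr => a _; rewrite -big_split.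
Qed.

Definition triC (t : 'I_(n + n) -> 'I_(n + n) -> 'I_(n + n) -> 'I_(n + n) -> R) (X Y Z : VC) : VC :=
  \row_d \sum_a \sum_b \sum_c X 0 a * Y 0 b * Z 0 c * (t a b c d)%:C%C.

Lemma triC_mk t p q p' q' r s :
  triC t (cmk p q) (cmk p' q') (cmk r s) =
  cmk (tri t p p' r - tri t q q' r - tri t q p' s - tri t p q' s)
      (tri t q p' r + tri t p q' r + tri t p p' s - tri t q q' s).
Proof.
apply/rowP => d; rewrite !mxE.
under eq_bigr => a _.
  under eq_bigr => b _.
    under eq_bigr => c _.
      rewrite !mxE (_ : _ * _ =
       ((p 0 a * p' 0 b * r 0 c * t a b c d - q 0 a * q' 0 b * r 0 c * t a b c d
        - q 0 a * p' 0 b * s 0 c * t a b c d - p 0 a * q' 0 b * s 0 c * t a b c d)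
      +i* (q 0 a * p' 0 b * r 0 c * t a b c d + p 0 a * q' 0 b * r 0 c * t a b c d
        + p 0 a * p' 0 b * s 0 c * t a b c d - q 0 a * q' 0 b * s 0 c * t a b c d))%C); last first.
        by simpc; congr (_ +i* _)%C; ring.
      over.
    rewrite complex_sum; over.
  rewrite complex_sum; over.
rewrite complex_sum; congr (_ +i* _)%C.
  rewrite -!sumrB; apply: eq_bigr => a _; rewrite -!sumrB; apply: eq_bigr => b _.
  by rewrite -!sumrB.
rewrite -!(big_split, sumrB); apply: eq_bigr => a _ /=.
rewrite -!(big_split, sumrB); apply: eq_bigr => b _ /=.
by rewrite -!(big_split, sumrB).
Qed.

Lemma triN1 t p q r : tri t (- p) q r = - tri t p q r :> V.
Proof.
apply/rowP => d; rewrite !mxE -sumrN; apply: eq_bigr => a _.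
by rewrite -sumrN; apply: eq_bigr => b _; rewrite -sumrN; apply: eq_bigr => c _; rewrite mxE !mulNr.
Qed.
Lemma triN2 t p q r : tri t p (- q) r = - tri t p q r :> V.
Proof.
apply/rowP => d; rewrite !mxE -sumrN; apply: eq_bigr => a _.
rewrite -sumrN; apply: eq_bigr => b _; rewrite -sumrN; apply: eq_bigr => c _.
by rewrite mxE mulrN !mulNr.
Qed.
Lemma triN3 t p q r : tri t p q (- r) = - tri t p q r :> V.
Proof.
apply/rowP => d; rewrite !mxE -sumrN; apply: eq_bigr => a _.
rewrite -sumrN; apply: eq_bigr => b _; rewrite -sumrN; apply: eq_bigr => c _.
by rewrite mxE mulrN !mulNr.
Qed.
Lemma tri0 t q r : tri t 0 q r = 0 :> V.
Proof.
by apply/rowP => d; rewrite !mxE big1 // => a _; rewrite big1 // => b _; rewrite big1 // => c _; rewrite mxE !mul0r.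
Qed.

Lemma metricC_mk (g : V -> 'M[R]_(n + n)) x p q p' q' :
  metricC g x (cmk p q) (cmk p' q') =
  ((gb (g x) p p' - gb (g x) q q') +i* (gb (g x) p q' + gb (g x) q p'))%C.
Proof.
transitivity (\sum_a \sum_b cmk p q 0 a * (g x a b)%:C%C * cmk p' q' 0 b).
  rewrite exchange_big /metricC mxE; apply: eq_bigr => b _.
  by rewrite mxE big_distrl /=; apply: eq_bigr => a _; rewrite !mxE.
under eq_bigr => a _.
  under eq_bigr => b _.
    rewrite !mxE (_ : _ * _ * _ = ((p 0 a * p' 0 b * g x a b - q 0 a * q' 0 b * g x a b)
      +i* (p 0 a * q' 0 b * g x a b + q 0 a * p' 0 b * g x a b))%C); last first.
      by simpc; congr (_ +i* _)%C; ring.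
    over.
  rewrite complex_sum; over.
rewrite complex_sum !gbE; congr (_ +i* _)%C.
  by rewrite -sumrB; apply: eq_bigr => a _; rewrite -sumrB.
by rewrite -big_split; apply: eq_bigr => a _; rewrite -big_split.
Qed.

Lemma cbar_mk p q : cbar (cmk p q) = cmk p (- q).
Proof. by apply/rowP => k; rewrite !mxE. Qed.

Lemma mulmxC_mk p q (A : 'M[R]_(n + n)) :
  cmk p q *m map_mx (real_complex R) A = cmk (p *m A) (q *m A).
Proof.
apply/rowP => k; rewrite !mxE.
under eq_bigr => a _.
  rewrite !mxE (_ : _ * _ = ((p 0 a * A a k) +i* (q 0 a * A a k))%C); last first.
    by simpc.
  over.
by rewrite complex_sum.
Qed.

(** The vector of type (1,0) with real part [u]. *)
Definition vec10 u := cmk u (- (u *m Jmx)).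

Lemma vec10_T10 u : T10 (vec10 u).
Proof.
rewrite /T10 mulmxC_mk mulNmx JmxK opprK; apply/rowP => k.
by rewrite !mxE; simpc.
Qed.

Lemma cbar_vec10 u : cbar (vec10 u) = cmk u (u *m Jmx).
Proof. by rewrite cbar_mk opprK. Qed.

(** The (0,1) part of the connection vanishing on constant sections of type
    (1,0) means that the symbols are complex linear in the direction. *)
Lemma chern_symbols_J (G : symbols R n) x :
  (forall X Z, T10 X -> T10 Z -> symbolsC G x (cbar X) Z = 0) ->
  (forall u v, bil (G x) u (v *m Jmx) = bil (G x) u v *m Jmx) ->
  forall u v, bil (G x) (u *m Jmx) v = bil (G x) u v *m Jmx.
Proof.
move=> G01 GJ u v; have := G01 _ _ (vec10_T10 u) (vec10_T10 v).
have -> : 0 = cmk 0 0 by apply/rowP => k; rewrite !mxE.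
rewrite cbar_vec10 symbolsC_mk => /cmk_inj[/eqP + _].
rewrite bilNr opprK GJ addr_eq0 => /eqP ->.
by rewrite mulNmx JmxK opprK.
Qed.

Lemma triC_cov (G T : symbols R n) x A X Y : cov_derivC G T x A X Y = triC (cov_deriv G T x) A X Y.
Proof. by []. Qed.

(** The derivative of the torsion is complex bilinear in the real setting as well,
    so its values on vectors of type (1,0) determine it. *)
Lemma parallel_torsion_real (H T : symbols R n) x :
  (forall a b c, differentiable (fun y => T y a b c : R) x) ->
  (forall u v, bil (H x) u (v *m Jmx) = bil (H x) u v *m Jmx) ->
  (forall u v, bil (T x) (u *m Jmx) v = bil (T x) u v *m Jmx) ->
  (forall u v, bil (T x) u (v *m Jmx) = bil (T x) u v *m Jmx) ->
  (forall w u v, bil (dsym T x w) (u *m Jmx) v = bil (dsym T x w) u v *m Jmx) ->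
  (forall w u v, bil (dsym T x w) u (v *m Jmx) = bil (dsym T x w) u v *m Jmx) ->
  (forall A X Y, T10 X -> T10 Y -> cov_derivC H T x A X Y = 0) ->
  forall z u v, cov_vec H T x z u v = 0.
Proof.
move=> Td HJ TJ1 TJ2 dTJ1 dTJ2 T0 a u v.
have CJ : cov_vec H T x a (u *m Jmx) (v *m Jmx) = - cov_vec H T x a u v.
  rewrite /cov_vec !(HJ, TJ1, TJ2, dTJ1, dTJ2, JmxK).
  by apply/rowP => i; rewrite !(bilE, vecE); ring_entries.
have := T0 (cmk a 0) _ _ (vec10_T10 u) (vec10_T10 v).
have -> : 0 = cmk 0 0 by apply/rowP => k; rewrite !mxE.
rewrite triC_cov triC_mk !(triN2, triN3, tri0) !(tri_cov_deriv H Td) CJ.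
move=> /cmk_inj[/rowP e _]; apply/rowP => i; have := e i; rewrite !vecE; lra.
Qed.

(** For X = u - i J u with conjugate Y, one has R(X, Y) = 2 i R(u, J u), and the
    squared norm of X is 2 g(u, u). *)
Lemma hol_sect_real (g : V -> 'M[R]_(n + n)) (G : symbols R n) x c u :
  (forall a b c, differentiable (fun y => G y a b c : R) x) ->
  (forall u v, gb (g x) (u *m Jmx) (v *m Jmx) = gb (g x) u v) ->
  (forall u v, gb (g x) u v = gb (g x) v u) ->
  (forall u v w z, gb (g x) (curv_vec G x u v w) z + gb (g x) w (curv_vec G x u v z) = 0) ->
  0 < gb (g x) u u ->
  hol_sect_curv g G x (vec10 u) = c%:C%C ->
  gb (g x) (curv_vec G x u (u *m Jmx) (u *m Jmx)) u = c * gb (g x) u u ^+ 2.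
Proof.
move=> Gd gJ gC Rsk u0.
rewrite /hol_sect_curv cbar_vec10.
rewrite -[curvatureC _ _ _ _ _]/(triC (curvature G x) (vec10 u) (cmk u (u *m Jmx)) (vec10 u)).
rewrite triC_mk !(triN1, triN2, triN3) !(tri_curvature Gd) !metricC_mk.
have RC p q w := curv_vecC G x p q w.
have R0 p w : curv_vec G x p p w = 0.
  by apply/rowP => i; have /rowP/(_ i) := RC p p w; rewrite !vecE; lra.
have s1 := Rsk u (u *m Jmx) u u; have s2 := Rsk u (u *m Jmx) u (u *m Jmx).
have s3 := Rsk u (u *m Jmx) (u *m Jmx) (u *m Jmx).
rewrite !R0 !(RC (u *m Jmx) u) !(oppr0, opprK, addr0, add0r, subr0, sub0r).
move: (curv_vec G x u (u *m Jmx)) s1 s2 s3 => W.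
rewrite !(gC _ (W _)) !gblE gJ (gC (u *m Jmx) u).
rewrite [X in (_ +i* X)%C ^+ 2](_ : _ = 0) ?[X in (X +i* _)%C ^+ 2](_ : _ = 2 * gb (g x) u u); [|by ring_gb|by rewrite addrN].
move=> s1 s2 s3.
rewrite [X in (_ +i* X)%C / _](_ : _ = 0) ?[X in (X +i* _)%C / _](_ : _ = 4 * gb (g x) (W (u *m Jmx)) u); [|lra|lra].
rewrite -![(_ +i* 0)%C]/(_%:C%C) -rmorphXn -fmorphV -rmorphM => /complexI <-.
field; lra.
Qed.

End RealParts.

Section ChernForm.
Context {R : realType} {n : nat}.
Local Notation V := (cspace R n).
Variables (U : set V) (g : V -> 'M[R]_(n + n)) (G : symbols R n).
Hypothesis g_smooth : forall a b, smooth_on U (fun y => g y a b : R).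
Hypothesis G_metric : metric_compatible U g G.

(** The exterior derivative of the Hermitian form is the cyclic sum of
    omega(T(u, v), w). *)
Lemma ext_d_hermitian_form0 x : U x ->
  (forall u v, gb (g x) (u *m Jmx) (v *m Jmx) = gb (g x) u v) ->
  (forall u v, gb (g x) u v = gb (g x) v u) ->
  (forall u v, bil (G x) u (v *m Jmx) = bil (G x) u v *m Jmx) ->
  (forall u v, bil (torsion G x) u v = 0) ->
  forall v, ext_d (hermitian_form g) x v = 0.
Proof.
move=> Ux gJ gC GJ T0 v.
have om p q : gb (g x) (p *m Jmx) q = - gb (g x) (q *m Jmx) p.
  by rewrite -gJ JmxK gbNl gC.
have GC p q : bil (G x) p q = bil (G x) q p.
  by apply/eqP; rewrite -subr_eq0 -bil_torsion T0.
have D w p q : 'D_w (fun y => metric_val g y p q : R) x = gb (g x) (bil (G x) w p) q + gb (g x) p (bil (G x) w q).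
  have vz := vderiv_cst x w.
  have [_ h] := is_derive_gb (gb_deriv g_smooth w Ux) (vz p) (vz q).
  rewrite [LHS]h !gb0l !gb0r !addr0; exact: G_metric.
rewrite /ext_d !big_ord_recl big_ord0 /hermitian_form.
rewrite (_ : lift ord0 ord_max = lift ord0 (lift ord0 ord0)); last exact: val_inj.
rewrite (_ : lift (lift ord0 ord0) ord0 = ord0); last exact: val_inj.
rewrite (_ : lift (lift ord0 ord0) ord_max = lift ord0 (lift ord0 ord0)); last exact: val_inj.
rewrite (_ : lift (lift ord0 (lift ord0 ord0)) ord0 = ord0); last exact: val_inj.
rewrite (_ : lift (lift ord0 (lift ord0 ord0)) ord_max = lift ord0 ord0); last exact: val_inj.
move: (v ord0) (v (lift ord0 ord0)) (v (lift ord0 (lift ord0 ord0))) => p q r.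
rewrite !D !GJ (GC q p) (GC r p) (GC r q) /= !expr0 !expr1.
rewrite (om q (bil _ p r)) -[bump 0 (bump 0 0)]/2%N.
ring_gb.
Qed.
End ChernForm.

Theorem theorem1p2 (R : realType) (n : nat) (n_ge2 : (2 <= n)%N)
    (M : complexManifold R n) (g : hermitianMetric M)
    (Dc Db : connection M) (c : R) :
  is_chern g Dc ->
  is_bismut g Db ->
  balanced g ->
  torsion_parallel Db Dc ->
  c != 0 ->
  constant_hol_sect_curv g Dc c ->
  torsion_zero Dc /\ kahler g.
Proof.
move=> [[gDc JDc] ch] [[gDb JDb] bis] _ Tpar c0 hsc.
pose U (i : chart_index M) : set (cspace R n) := chart_im i; pose G := christoffel Dc; pose H := christoffel Db.
have Uo i : open (U i) by exact: chart_im_open.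
have gs i := @gmx_smooth _ _ _ g i.
have Gs i : smooth_symbols (U i) (G i) by exact: christoffel_smooth.
have Hs i : smooth_symbols (U i) (H i) by exact: christoffel_smooth.
have Gm i : metric_compatible (U i) (gmx g i) (G i).
  by apply: metric_compatibleP => // y a b d Uy; exact: gDc.
have Hm i : metric_compatible (U i) (gmx g i) (H i).
  by apply: metric_compatibleP => // y a b d Uy; exact: gDb.
have gJ i y u v (Uy : U i y) : gb (gmx g i y) (u *m Jmx) (v *m Jmx) = gb (gmx g i y) u v.
  exact: (@gmx_J _ _ _ g i y u v Uy).
have gpos i y v (Uy : U i y) : v != 0 -> 0 < gb (gmx g i y) v v by exact: (@gmx_pos _ _ _ g i y v Uy).
have gsym i y (Uy : U i y) : (gmx g i y)^T = gmx g i y by exact: (@gmx_sym _ _ _ g i y Uy).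
have GJ2 i y u v (Uy : U i y) : bil (G i y) u (v *m Jmx) = bil (G i y) u v *m Jmx by exact: JDc.
have HJ2 i y u v (Uy : U i y) : bil (H i y) u (v *m Jmx) = bil (H i y) u v *m Jmx by exact: JDb.
have GJ1 i y u v (Uy : U i y) : bil (G i y) (u *m Jmx) v = bil (G i y) u v *m Jmx.
  apply: chern_symbols_J => [X Z X10 Z10|p q]; [exact: (ch i)|exact: GJ2].
have Hsk i y u v w (Uy : U i y) : gb (gmx g i y) (bil (torsion (H i) y) u v) w =
    - gb (gmx g i y) (bil (torsion (H i) y) u w) v by exact: bis.
have Ts i : smooth_symbols (U i) (torsion (G i)) by move=> a b d; exact: (smooth_onB (Uo i) (Gs i a b d) (Gs i b a d)).
have TJ1 i y u v (Uy : U i y) : bil (torsion (G i) y) (u *m Jmx) v = bil (torsion (G i) y) u v *m Jmx.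
  by rewrite !bil_torsion GJ1 // GJ2 // mulmxBl.
have TJ2 i y u v (Uy : U i y) : bil (torsion (G i) y) u (v *m Jmx) = bil (torsion (G i) y) u v *m Jmx.
  by rewrite !bil_torsion GJ1 // GJ2 // mulmxBl.
have Tp i y a u v (Uy : U i y) : cov_vec (H i) (torsion (G i)) y a u v = 0.
  apply: parallel_torsion_real.
  - by move=> a' b' c'; exact: smooth_differentiable (Ts i _ _ _) Uy.
  - by move=> p q; exact: HJ2.
  - by move=> p q; exact: TJ1.
  - by move=> p q; exact: TJ2.
  - exact: (dsym_J1 (Uo i) (Ts i) (TJ1 i) Uy).
  - exact: (dsym_J2 (Uo i) (Ts i) (TJ2 i) Uy).
  - by move=> A X Y; exact: Tpar.
have gC i y u v (Uy : U i y) : gb (gmx g i y) u v = gb (gmx g i y) v u by exact: (gbC (gsym i)).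
have T0 i y u v (Uy : U i y) : bil (torsion (G i) y) u v = 0.
  apply: (chern_torsion_eq0 (Uo i) (gs i) (gsym i) (gpos i) (gJ i) (Gs i) (Hs i) (Gm i) (Hm i)
    (GJ1 i) (GJ2 i) (HJ2 i) (Hsk i) (Tp i) Uy c0) => {u v} u.
  have [->|u0] := eqVneq u 0; first by rewrite !gb0r expr0n mulr0.
  apply: hol_sect_real.
  - by move=> a b d; exact: smooth_differentiable (Gs i _ _ _) Uy.
  - by move=> p q; exact: gJ.
  - by move=> p q; exact: gC.
  - by move=> p q r z; exact: (curv_skew (Uo i) (gs i) (Gs i) (Gm i) Uy).
  - exact: gpos.
  apply: hsc => //; first exact: vec10_T10.
  apply: contra_neq u0 => e0; have : vec10 u = cmk 0 0.
    by rewrite e0; apply/rowP => k; rewrite !mxE.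
  by case/cmk_inj.
split.
  move=> i y X Y Uy _ _; apply/rowP => d; rewrite !mxE big1 // => a _; rewrite big1 // => b _.
  have := T0 i y (frame a) (frame b) Uy; rewrite bil_frame => /rowP/(_ d); rewrite !mxE => ->.
  by rewrite mulr0.
move=> i y v Uy; apply: (ext_d_hermitian_form0 (gs i) (Gm i) Uy) => [p q|p q|p q|p q].
- exact: gJ.
- exact: gC.
- exact: GJ2.
- exact: T0.
Qed.
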